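(* Consider the two-group model without factors described in the context, with nonnull probability $\pi_1\in(0,1)$ not depending on $m$, and $\pi_0=1-\pi_1$. Let $\tau_*$ be the unique $t\in(0,1)$ satisfying $t/q=\pi_0t+\pi_1\bar\Phi(\bar\Phi^{-1}(t)-\mu_A)$, and let $(a,b)\subset(0,1)$ be any open interval containing both $\tau_*$ and $q$. Suppose that (i) there exist an even integer $Q>2$ and $\gamma>0$ with $\frac{\gamma}{2+\gamma}+\frac2Q<1$ and $\sum_{d=1}^\infty d^{Q-2}\alpha(d)^{\gamma/(Q+\gamma)}<\infty$; and (ii) the limit $\varrho(t,s)=\lim_{m\to\infty}\frac1m\sum_{i\ne j}\tilde\rho(t,s,\Gamma^{(m)}_{ij})$ exists for all $t,s\in\big[a,\bar\Phi(\bar\Phi^{-1}(b)-\mu_A)\big]$. Then, as $m\to\infty$, $$\sqrt m\,(\mathrm{FDP}_m-\pi_0q)\xrightarrow{d}\mathcal N\Big(0,\ \frac{\pi_0^2q^2}{\tau_*^2}\Big(\frac{\tau_*}{\pi_0}-\tau_*^2+\varrho(\tau_*,\tau_* )\Big)\Big).$$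
   Context: Notation: $\Phi$ is the standard normal CDF, $\bar\Phi=1-\Phi$. Fix $q\in(0,1)$ and $\mu_A>0$. Model (no factor component). For each $m\ge1$: $H_{m1},\dots,H_{mm}$ are i.i.d. Bernoulli$(\pi_1)$ ($H_{mi}=1$ iff hypothesis $i$ is nonnull), independent of $(\varepsilon_{m1},\dots,\varepsilon_{mm})\sim\mathcal N(0,\Gamma^{(m)})$, where $\Gamma^{(m)}$ is an $m\times m$ correlation matrix (unit diagonal). The $p$-values are $P_{mi}=\bar\Phi(\mu_AH_{mi}+\varepsilon_{mi})$. Benjamini-Hochberg at level $q$: with sorted $p$-values $P_{m(1)}\le\dots\le P_{m(m)}$ and $P_{m(0)}=0$, let $R_m=\max\{j\in\{0,\dots,m\}:P_{m(j)}\le jq/m\}$, $\tau_{\mathrm{BH},m}=P_{m(R_m)}$, $V_m=\sum_{i=1}^mI\{P_{mi}\le\tau_{\mathrm{BH},m},H_{mi}=0\}$, $\mathrm{FDP}_m=V_m/\max\{R_m,1\}$. Mixing coefficients: $\xi_{mi}=(\varepsilon_{mi},H_{mi})$, $\mathcal A_1^n(m)=\sigma(\xi_{mi}:1\le i\le n)$, $\mathcal A_{n+d}^\infty(m)=\sigma(\xi_{mi}:n+d\le i\le m)$, and $\alpha(d)=\sup_{n,m}\sup\{|P(A_0\cap A_1)-P(A_0)P(A_1)|:A_0\in\mathcal A_1^n(m),A_1\in\mathcal A_{n+d}^\infty(m)\}$. For $t,s\in[0,1]$ and $|\rho|\le1$, $\tilde\rho(t,s,\rho)=\Pr(Z_1\ge\bar\Phi^{-1}(t),Z_2\ge\bar\Phi^{-1}(s))-ts$,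 where $(Z_1,Z_2)$ is centered bivariate normal with unit variances and correlation $\rho$. *)

(* Defs.v *)
From HB Require Import structures.
From mathcomp Require Export all_boot all_order all_algebra.
From mathcomp Require Export all_classical all_reals all_analysis.

Set Implicit Arguments.
Unset Strict Implicit.
Unset Printing Implicit Defensive.

Import Order.TTheory GRing.Theory Num.Theory.
Import numFieldNormedType.Exports.
Local Open Scope classical_set_scope.
Local Open Scope ring_scope.

Section normal.
Context {R : realType}.
Implicit Types (x : \bar R) (t s rho : R).

(* [Phi] and [Phibar] take extended real arguments so that [Phibar] is a
   bijection from [\bar R] onto [0, 1], with inverse [Phibar_inv]; thus
   Phibar_inv 0 = +oo and Phibar_inv 1 = -oo. *)
Definition Phi x : R := fine (normal_prob 0 1 [set z : R | (z%:E <= x)%E]).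

Definition Phibar x : R := 1 - Phi x.

(* Junk value 0 when t is outside [0, 1]. *)
Definition Phibar_inv t : \bar R := xget 0%E [set x | Phibar x = t].

(* The centred bivariate normal law with unit variances and correlation rho is
   the law of (U, rho U + sqrt (1 - rho^2) V), with U and V independent
   standard normal. *)
Definition bivariate_normal rho : set (R * R) -> \bar R :=
  pushforward (normal_prob (0 : R) 1 \x normal_prob (0 : R) 1)%E
    (fun u : R * R => (u.1, rho * u.1 + Num.sqrt (1 - rho ^+ 2) * u.2)).

Definition rho_tilde t s rho : R :=
  fine (bivariate_normal rho
    [set z | (Phibar_inv t <= z.1%:E)%E /\ (Phibar_inv s <= z.2%:E)%E]) - t * s.

(* N(mu, v), parametrised by its variance v >= 0. The case v = 0 is separate
   because [normal_prob mu 0] is the uniform law on [0, 1], not a point mass. *)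
Definition normal_law (mu v : R) : set R -> \bar R :=
  if v == 0 then \d_ mu else normal_prob mu (Num.sqrt v).

Definition correlation_mx (m : nat) (G : 'M[R]_m) : Prop :=
  [/\ G^T = G,
      forall i, G i i = 1 &
      forall c : 'rV[R]_m, 0 <= (c *m G *m c^T) 0 0].

End normal.

Section random_vectors.
Context d (T : measurableType d) (R : realType) (P : probability T R).

Definition sigma_generated d' (T' : measurableType d') (I : Type)
    (X : I -> T -> T') (D : set I) : set (set T) :=
  <<s \bigcup_(i in D) preimage_set_system setT (X i) measurable >>.

(* The product rule for subfamilies is the case where some B i are setT. *)
Definition mutually_independent d' (T' : measurableType d') (I : finType)
    (X : I -> T -> T') : Prop :=
  forall B : I -> set T', (forall i, measurable (B i)) ->
    P (\bigcap_i (X i @^-1` B i)) = (\prod_i P (X i @^-1` B i))%E.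

Definition independent_families d1 (T1 : measurableType d1)
    d2 (T2 : measurableType d2) (I J : Type)
    (X : I -> T -> T1) (Y : J -> T -> T2) : Prop :=
  forall A B, sigma_generated X setT A -> sigma_generated Y setT B ->
    P (A `&` B) = (P A * P B)%E.

(* The law of X is N(0, G), possibly singular: every linear combination
   \sum_i c_i X_i has law N(0, c G c^T). *)
Definition centered_gaussian_vector (m : nat) (X : 'I_m -> T -> R)
    (G : 'M[R]_m) : Prop :=
  forall (c : 'rV[R]_m) (B : set R), measurable B ->
    P ((fun w => \sum_i c 0 i * X i w) @^-1` B) =
    normal_law 0 ((c *m G *m c^T) 0 0) B.

End random_vectors.

Section two_group_model.
Context d (T : measurableType d) (R : realType) (P : probability T R) (m : nat).
Implicit Types (H : 'I_m -> T -> bool) (eps : 'I_m -> T -> R).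

Definition two_group_model (pi1 : R) (H : 'I_m -> {RV P >-> bool})
    (eps : 'I_m -> {RV P >-> R}) (G : 'M[R]_m) : Prop :=
  [/\ forall i, distribution P (H i) = bernoulli_prob pi1 :> (set bool -> \bar R),
      mutually_independent P H,
      independent_families P H eps,
      correlation_mx G &
      centered_gaussian_vector P eps G].

Definition pvalue (muA : R) H eps (w : T) : 'I_m -> R :=
  fun i => Phibar (muA * (H i w)%:R + eps i w)%:E.

Definition xi H eps (i : 'I_m) (w : T) : R * bool := (eps i w, H i w).

(* i : 'I_m starts at 0, so i.+1 is its rank in the sequence xi_1, ..., xi_m. *)
Definition sigma_past H eps (n : nat) : set (set T) :=
  sigma_generated (xi H eps) [set i : 'I_m | (i.+1 <= n)%N].

Definition sigma_future H eps (n : nat) : set (set T) :=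
  sigma_generated (xi H eps) [set i : 'I_m | (n <= i.+1)%N].

End two_group_model.

Section benjamini_hochberg.
Context {R : realType} (m : nat).
Implicit Types (q : R) (p : 'I_m -> R) (h : 'I_m -> bool).

(* P_(j), with P_(0) = 0. *)
Definition order_stat p (j : nat) : R :=
  nth 0 (0 :: sort <=%R [seq p i | i <- enum 'I_m]) j.

Definition BH_rejections q p : nat :=
  \max_(j < m.+1 | order_stat p j <= j%:R * q / m%:R) j.

Definition BH_threshold q p : R := order_stat p (BH_rejections q p).

Definition BH_false_rejections q p h : nat :=
  #|[pred i | (p i <= BH_threshold q p) && ~~ h i]|.

Definition FDP q p h : R :=
  (BH_false_rejections q p h)%:R / (maxn (BH_rejections q p) 1)%:R.

End benjamini_hochberg.

Section triangular_arrays.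
Context (R : realType) (d : nat -> measure_display)
  (T : forall m, measurableType (d m)) (P : forall m, probability (T m) R).

Definition alpha_mixing (H : forall m, 'I_m -> T m -> bool)
    (eps : forall m, 'I_m -> T m -> R) (k : nat) : R :=
  sup [set x : R | exists n m A0 A1,
    [/\ (0 < n)%N, (0 < m)%N,
        sigma_past (H m) (eps m) n A0,
        sigma_future (H m) (eps m) (n + k) A1 &
        x = `|fine (P m (A0 `&` A1)) - fine (P m A0) * fine (P m A1)| ] ].

(* Convergence of the distribution functions at the continuity points of the
   limit; the X m may live on different probability spaces. *)
Definition cvg_in_distribution (X : forall m, T m -> R)
    (mu : set R -> \bar R) : Prop :=
  forall x : R, mu [set x] = 0%E ->
    P m [set w | X m w <= x] @[m --> \oo] --> mu `]-oo, x]%classic.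

End triangular_arrays.

(* Main.v *)
(* Write t^ = R q / m. By maximality of R, exactly R p-values are at most t^, so
   sqrt m (FDP - pi0 q) = (q / t^) W(t^), where W(t) is the normalised centred
   count of null p-values at most t.

   Summability of the mixing coefficients gives Var(W(t) - W(s)) <= C |t - s|^(1/2)
   and a bounded variance for the count U(t) of all p-values at most t. The curve
   t |-> pi0 t + pi1 Phibar(Phibar^-1(t) - muA) is concave and crosses t / q
   transversally at tau, so a union bound over the grid tau + j / sqrt m shows that
   t^ = tau + O(1 / sqrt m) in probability. On that scale W oscillates little, and
   sqrt m (FDP - pi0 q) = (q / tau) W(tau) + o(1).

   W(tau) is a normalised sum of bounded alpha-mixing variables; big blocks
   separated by small gaps show that its characteristic function is asymptotic to
   the Gaussian one with the same variance, and this variance converges by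
   hypothesis (ii), each pair of null p-values contributing
   pi0^2 (rho_tilde(tau, tau, Gamma_ij) + tau^2).

   Levy's continuity theorem is replaced by uniform approximation of step functions
   by explicit trigonometric polynomials, which also yields the Cramer-Wold argument
   identifying the law of a pair of errors with the bivariate normal one. *)
From HB Require Import structures.
Require Import Defs.
From mathcomp Require Import measurable_realfun ring lra.

Set Implicit Arguments.
Unset Strict Implicit.
Unset Printing Implicit Defensive.

Import Order.TTheory GRing.Theory Num.Theory.
Import numFieldNormedType.Exports.
Local Open Scope classical_set_scope.
Local Open Scope ring_scope.

(** * Bounded random variables, their means and probabilities *)

Section bounded_rv.
Context d (T : measurableType d) (R : realType).
Implicit Types f g : T -> R.

(** The cut-off [t^] depends on every p-value, so [W(t^)] is not a sum to which a limit theorem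
    applies; it is exchanged for [W(tau)] by second moments alone. This works for two reasons. A
    displacement of [t^] by [j / sqrt m] forces a deviation of order [j] in [U], so the Chebyshev
    bounds are of order [1 / j^2] and their sum over [j >= J] is small for large [J]. And between
    grid points [W] can drop by no more than its deterministic drift. The increments of [W] need a
    variance that vanishes with [t - s], hence a covariance bound that feels both the mixing and the
    small probability; it costs a square root of [alpha], whose summability is what the condition on
    [Q] and [gamma] provides. The same condition gives [alpha(k) = O(k^-4)], from which the block
    sizes are chosen. All variables whose mean is taken are bounded, so integrability comes for
    free, and the real means of [cos (a Y + b)], with a free phase [b], carry the whole
    characteristic function. *)

Definition bounded_rv f : Prop :=
  measurable_fun setT f /\ exists M, forall w, `|f w| <= M.

Lemma brv_cst (c : R) : bounded_rv (fun=> c).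
Proof. by split => //; exists `|c|. Qed.

Lemma brvD f g : bounded_rv f -> bounded_rv g -> bounded_rv (fun w => f w + g w).
Proof.
move=> [mf [M fM]] [mg [N gN]]; split; first exact: measurable_funD.
by exists (M + N) => w; rewrite (le_trans (ler_normD _ _))// lerD.
Qed.

Lemma brvN f : bounded_rv f -> bounded_rv (fun w => - f w).
Proof.
move=> [mf [M fM]]; split; first exact: measurableT_comp.
by exists M => w; rewrite normrN.
Qed.

Lemma brvB f g : bounded_rv f -> bounded_rv g -> bounded_rv (fun w => f w - g w).
Proof. by move=> bf bg; apply: brvD => //; exact: brvN. Qed.

Lemma brvM f g : bounded_rv f -> bounded_rv g -> bounded_rv (fun w => f w * g w).
Proof.
move=> [mf [M fM]] [mg [N gN]]; split; first exact: measurable_funM.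
by exists (M * N) => w; rewrite normrM ler_pM.
Qed.

Lemma brvX f n : bounded_rv f -> bounded_rv (fun w => f w ^+ n).
Proof.
move=> bf; elim: n => [|n IH]; first exact: brv_cst.
by under eq_fun do rewrite exprS; exact: brvM.
Qed.

Lemma brv_norm f : bounded_rv f -> bounded_rv (fun w => `|f w|).
Proof.
move=> [mf [M fM]]; split; first exact: measurableT_comp.
by exists M => w; rewrite normr_id.
Qed.

Lemma brv_sum (I : Type) (r : seq I) (p : pred I) (f : I -> T -> R) :
  (forall i, p i -> bounded_rv (f i)) ->
  bounded_rv (fun w => \sum_(i <- r | p i) f i w).
Proof.
move=> bf; elim: r => [|i r IH].
  by rewrite (_ : (fun w => _) = fun=> 0);
    [exact: brv_cst|apply/funext => w; rewrite big_nil].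
have [pi|npi] := boolP (p i); last first.
  rewrite (_ : (fun w => _) = (fun w => \sum_(i <- r | p i) f i w)) //.
  by apply/funext => w; rewrite big_cons (negbTE npi).
rewrite (_ : (fun w => _) = (fun w => f i w + \sum_(i <- r | p i) f i w)).
  by apply: brvD => //; exact: bf.
by apply/funext => w; rewrite big_cons pi.
Qed.

Lemma brv_indic (A : set T) : measurable A -> bounded_rv (\1_A : T -> R).
Proof.
move=> mA; split; first exact: measurable_indic.
by exists 1 => w; rewrite indicE normr_nat lern1 leq_b1.
Qed.

Lemma brv_cos f : measurable_fun setT f -> bounded_rv (fun w => cos (f w)).
Proof.
move=> mf; split.
  apply: measurableT_comp mf; apply: continuous_measurable_fun.
  exact: continuous_cos.
by exists 1 => w; rewrite ler_norml cos_geN1 cos_le1.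
Qed.

Lemma brv_sin f : measurable_fun setT f -> bounded_rv (fun w => sin (f w)).
Proof.
move=> mf; split.
  apply: measurableT_comp mf; apply: continuous_measurable_fun.
  exact: continuous_sin.
by exists 1 => w; rewrite ler_norml sin_geN1 sin_le1.
Qed.

End bounded_rv.

Section mean.
Context d (T : measurableType d) (R : realType) (P : probability T R).
Implicit Types f g : T -> R.

Definition mean f : R := \int[P]_w f w.
Definition prob (A : set T) : R := fine (P A).

Lemma brv_integrable f : bounded_rv f -> P.-integrable setT (EFin \o f).
Proof.
move=> [mf [M fM]]; apply: measurable_bounded_integrable => //.
  by rewrite (le_lt_trans (probability_le1 _ _)) ?ltry.
exists M; split; first exact: num_real.
by move=> x Mx w _ /=; rewrite (le_trans (fM w)) ?ltW.
Qed.

Lemma meanD f g : bounded_rv f -> bounded_rv g ->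
  mean (fun w => f w + g w) = mean f + mean g.
Proof. by move=> bf bg; apply: RintegralD => //; exact: brv_integrable. Qed.

Lemma meanB f g : bounded_rv f -> bounded_rv g ->
  mean (fun w => f w - g w) = mean f - mean g.
Proof. by move=> bf bg; apply: RintegralB => //; exact: brv_integrable. Qed.

Lemma meanZ (c : R) f : bounded_rv f -> mean (fun w => c * f w) = c * mean f.
Proof. by move=> bf; apply: RintegralZl => //; exact: brv_integrable. Qed.

Lemma mean_cst (c : R) : mean (fun=> c) = c.
Proof. by rewrite /mean Rintegral_cst// [X in fine X](_ : _ = 1%E) ?mulr1//; exact: probability_setT. Qed.

Lemma mean_sum (I : Type) (r : seq I) (p : pred I) (f : I -> T -> R) :
  (forall i, p i -> bounded_rv (f i)) ->
  mean (fun w => \sum_(i <- r | p i) f i w) = \sum_(i <- r | p i) mean (f i).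
Proof.
move=> bf; elim: r => [|i r IH].
  by rewrite big_nil -[RHS]mean_cst; congr mean; apply/funext => w; rewrite big_nil.
rewrite big_cons -IH; have [pi|npi] := boolP (p i); last first.
  by congr mean; apply/funext => w; rewrite big_cons (negbTE npi).
rewrite -meanD; [|exact: bf|exact: brv_sum].
by congr mean; apply/funext => w; rewrite big_cons pi.
Qed.

Lemma mean_le f g : bounded_rv f -> bounded_rv g -> (forall w, f w <= g w) ->
  mean f <= mean g.
Proof. by move=> bf bg fg; apply: le_Rintegral => //; exact: brv_integrable. Qed.

Lemma mean_ge0 f : (forall w, 0 <= f w) -> 0 <= mean f.
Proof. by move=> f0; apply: Rintegral_ge0. Qed.

Lemma mean_normr f : bounded_rv f -> `|mean f| <= mean (fun w => `|f w|).
Proof. by move=> bf; apply: le_normr_Rintegral => //; exact: brv_integrable. Qed.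

Lemma mean_bound f M : bounded_rv f -> (forall w, `|f w| <= M) -> `|mean f| <= M.
Proof.
move=> bf fM; rewrite (le_trans (mean_normr bf))// -[leRHS]mean_cst.
by apply: mean_le => //; [exact: brv_norm|exact: brv_cst].
Qed.

Lemma mean_indic (A : set T) : measurable A -> mean \1_A = prob A.
Proof. by move=> mA; rewrite /mean /Rintegral integral_indic// setIT. Qed.

Lemma mean_dist f g (e : R) : bounded_rv f -> bounded_rv g ->
  (forall w, `|f w - g w| <= e) -> `|mean f - mean g| <= e.
Proof. by move=> bf bg fge; rewrite -meanB//; apply: mean_bound => //; exact: brvB. Qed.

(* Cauchy-Schwarz *)
Lemma mean_mul_sqr f g : bounded_rv f -> bounded_rv g ->
  mean (fun w => f w * g w) ^+ 2 <=
  mean (fun w => f w ^+ 2) * mean (fun w => g w ^+ 2).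
Proof.
move=> bf bg.
set a := mean (fun w => f w ^+ 2); set b := mean _; set c := mean (fun w => g w ^+ 2).
have bff := brvX 2 bf; have bgg := brvX 2 bg; have bfg := brvM bf bg.
have a0 : 0 <= a by apply: mean_ge0 => w; exact: sqr_ge0.
have c0 : 0 <= c by apply: mean_ge0 => w; exact: sqr_ge0.
have q (x y : R) : 0 <= x ^+ 2 * a - 2 * x * y * b + y ^+ 2 * c.
  suff -> : x ^+ 2 * a - 2 * x * y * b + y ^+ 2 * c =
      mean (fun w => (x * f w - y * g w) ^+ 2).
    by apply: mean_ge0 => w; exact: sqr_ge0.
  rewrite (_ : (fun w => _ ^+ 2) = (fun w => x ^+ 2 * (f w ^+ 2) -
      2 * x * y * (f w * g w) + y ^+ 2 * (g w ^+ 2))); last first.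
    by apply/funext => w; ring.
  have bc c' h : bounded_rv h -> bounded_rv (fun w => c' * h w).
    by move=> ?; apply: brvM => //; exact: brv_cst.
  by rewrite meanD ?meanB ?meanZ//; [exact: bc|exact: bc|apply: brvB|]; exact: bc.
(* [q b a] reads [a (a c - b^2) >= 0] and [q c b] reads [c (a c - b^2) >= 0]; if [a] and [c] both
   vanish, [q 1 1] and [q 1 (-1)] force [b = 0]. *)
have [a_eq0|a_neq0] := eqVneq a 0; last first.
  have agt0 : 0 < a by rewrite lt_def a_neq0.
  have := q b a; nra.
have [c_eq0|c_neq0] := eqVneq c 0; last first.
  have cgt0 : 0 < c by rewrite lt_def c_neq0.
  have := q c b; nra.
have := q 1 1; have := q 1 (-1); rewrite a_eq0 c_eq0 => h1 h2.
suff -> : b = 0 by lra.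
lra.
Qed.

Lemma mean_norm_sqr f : bounded_rv f ->
  mean (fun w => `|f w|) ^+ 2 <= mean (fun w => f w ^+ 2).
Proof.
move=> bf; have := mean_mul_sqr (brv_norm bf) (brv_cst T (1 : R)).
rewrite expr1n mean_cst mulr1.
under eq_fun do rewrite mulr1.
by under [in leRHS]eq_fun do rewrite -normrX ger0_norm ?sqr_ge0//.
Qed.

Lemma prob_ge0 A : 0 <= prob A.
Proof. by rewrite /prob fine_ge0. Qed.

Lemma prob_le1 A : measurable A -> prob A <= 1.
Proof.
move=> mA; rewrite -lee_fin fineK ?fin_num_measure//; exact: probability_le1.
Qed.

Lemma probE A : measurable A -> P A = (prob A)%:E.
Proof. by move=> mA; rewrite /prob fineK// fin_num_measure. Qed.

Lemma le_prob A B : measurable A -> measurable B -> A `<=` B -> prob A <= prob B.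
Proof.
move=> mA mB AB; rewrite /prob fine_le ?fin_num_measure//.
by rewrite le_measure ?inE.
Qed.

Lemma prob_setC A : measurable A -> prob (~` A) = 1 - prob A.
Proof.
move=> mA; rewrite /prob probability_setC// fineB ?fin_num_measure//.
Qed.

Lemma prob_setU A B : measurable A -> measurable B ->
  prob (A `|` B) <= prob A + prob B.
Proof.
move=> mA mB; rewrite -lee_fin EFinD -!probE//; last exact: measurableU.
exact: measureU2.
Qed.

Lemma prob_bigU (I : Type) (r : seq I) (p : pred I) (F : I -> set T) :
  (forall i, measurable (F i)) ->
  prob (\big[setU/set0]_(i <- r | p i) F i) <= \sum_(i <- r | p i) prob (F i).
Proof.
move=> mF; elim: r => [|i r IH]; first by rewrite !big_nil /prob measure0.
rewrite !big_cons; case: ifP => // _.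
apply: (le_trans (prob_setU _ _)) => //; last by rewrite lerD2l.
exact: bigsetU_measurable.
Qed.

Lemma chebyshev_sqr f (e : R) : 0 < e -> bounded_rv f ->
  prob [set w | e <= `|f w|] <= mean (fun w => f w ^+ 2) / e ^+ 2.
Proof.
move=> e0 bf; have mA : measurable [set w | e <= `|f w|].
  rewrite -[X in measurable X]setTI; apply: measurable_fun_le => //.
  by have [] := brv_norm bf.
rewrite -mean_indic// ler_pdivlMr ?exprn_gt0// mulrC -meanZ; last exact: brv_indic.
apply: mean_le => [||w]; [by apply: brvM; [exact: brv_cst|exact: brv_indic]|exact: brvX|].
rewrite indicE; have [|] := boolP (w \in _); last by rewrite mulr0 sqr_ge0.
rewrite inE/= => ew; rewrite mulr1 -[leRHS]ger0_norm ?sqr_ge0// normrX.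
by rewrite ler_pXn2r// nnegrE ltW// (lt_le_trans e0).
Qed.

End mean.

Section boolean_means.
Context d (T : measurableType d) (R : realType) (P : probability T R).
Implicit Types b : T -> bool.

Lemma natr_indic b : (fun w => (b w)%:R) = \1_[set w | b w] :> (T -> R).
Proof.
apply/funext => w; rewrite indicE; congr (_ %:R).
by case E : (b w); [rewrite mem_set|rewrite memNset//= E].
Qed.

Lemma brv_natr b : measurable [set w | b w] -> bounded_rv (fun w => (b w)%:R : R).
Proof. by move=> mb; rewrite natr_indic; exact: brv_indic. Qed.

Lemma mean_natr b : measurable [set w | b w] ->
  mean P (fun w => (b w)%:R) = prob P [set w | b w].
Proof. by move=> mb; rewrite natr_indic mean_indic. Qed.

Lemma measurable_set_le (f g : T -> R) : measurable_fun setT f ->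
  measurable_fun setT g -> measurable [set w | f w <= g w].
Proof. by move=> mf mg; rewrite -[X in measurable X]setTI; exact: measurable_fun_le. Qed.

Lemma measurable_set_lt (f g : T -> R) : measurable_fun setT f ->
  measurable_fun setT g -> measurable [set w | f w < g w].
Proof.
move=> mf mg; rewrite (_ : [set w | _] = ~` [set w | g w <= f w]).
  by apply: measurableC; exact: measurable_set_le.
by apply/seteqP; split => w /=; rewrite ltNge => /negP.
Qed.

End boolean_means.

Ltac bounded := repeat first
  [ exact: brv_cst | by auto | apply: brvB | apply: brvD | apply: brvM | apply: brvX
  | apply: brv_norm | apply: brv_natr | apply: brv_cos | apply: brv_sin ].

(** * Taylor and Lipschitz bounds for sine, cosine and exponential *)

Section elementary_inequalities.
Context (R : realType).
Implicit Types x y : R.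

Lemma MVT_is_derive (f df : R -> R) (a b : R) :
  (forall x, is_derive x 1 f (df x)) -> a <= b ->
  exists2 c, a <= c <= b & f b - f a = df c * (b - a).
Proof.
move=> fd; rewrite le_eqVlt => /predU1P[->|ab].
  by exists b; rewrite ?lexx// !subrr mulr0.
have cf : {within `[a, b], continuous f}.
  apply: continuous_subspaceT => x; apply: differentiable_continuous.
  by apply/derivable1_diffP; have [] := fd x.
have [c] := MVT ab (fun x _ => fd x) cf.
by rewrite in_itv/= => /andP[/ltW ac /ltW cb] ->; exists c; rewrite ?ac.
Qed.

(** The Taylor bounds below climb by this comparison: the difference of the two sides vanishes at 0
    and its derivative is the difference treated just before. *)
Lemma ge0_derive_le (f df : R -> R) x : (forall x, is_derive x 1 f (df x)) ->
  (forall x, 0 <= x -> 0 <= df x) -> 0 <= x -> f 0 <= f x.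
Proof.
move=> fd df0 x0; have [c /andP[c0 _] fE] := MVT_is_derive fd x0.
by rewrite -subr_ge0 fE mulr_ge0 ?df0// subr0.
Qed.

Lemma lipschitz1_derive (f df : R -> R) : (forall x, is_derive x 1 f (df x)) ->
  (forall x, `|df x| <= 1) -> forall x y, `|f x - f y| <= `|x - y|.
Proof.
move=> fd df1 x y; wlog xy : x y / x <= y.
  by move=> h; case: (leP x y) => [|/ltW] /h// + ; rewrite distrC (distrC x).
have [c _ fE] := MVT_is_derive fd xy.
by rewrite distrC fE normrM (distrC x) ler_piMl.
Qed.

Lemma lipschitz_cos x y : `|cos x - cos y| <= `|x - y|.
Proof. by apply: (@lipschitz1_derive _ (fun x => - sin x)) => z; rewrite ?normrN ?sin_max. Qed.

Lemma lipschitz_sin x y : `|sin x - sin y| <= `|x - y|.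
Proof. by apply: (@lipschitz1_derive _ cos) => z; rewrite ?cos_max. Qed.

Lemma sin_le_id x : 0 <= x -> sin x <= x.
Proof.
move=> x0; rewrite (le_trans (ler_norm _))// -{1}(subr0 (sin x)) -sin0.
by rewrite (le_trans (lipschitz_sin _ _))// subr0 ger0_norm.
Qed.

Lemma cos_ge_taylor2 x : 1 - x ^+ 2 / 2 <= cos x.
Proof.
have cos_ge y : 0 <= y -> 1 - y ^+ 2 / 2 <= cos y.
  move=> y0; rewrite -subr_ge0.
  apply: (le_trans _ (@ge0_derive_le (fun x => cos x - (1 - x ^+ 2 / 2))
    (fun x => - sin x + x) y _ _ y0)) => [|z|z z0].
  - by rewrite cos0 expr0n/= mul0r subr0 subrr.
  - apply: is_derive_eq; rewrite /GRing.scale/=; lra.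
  - by have := sin_le_id z0; lra.
by have := cos_ge _ (normr_ge0 x); rewrite cos_norm real_normK ?num_real.
Qed.

Lemma sin_ge_taylor3 x : 0 <= x -> x - x ^+ 3 / 6 <= sin x.
Proof.
move=> x0; rewrite -subr_ge0.
apply: (le_trans _ (@ge0_derive_le (fun x => sin x - (x - x ^+ 3 / 6))
  (fun x => cos x - (1 - x ^+ 2 / 2)) x _ _ x0)) => [|z|z z0].
- by rewrite sin0 expr0n/= mul0r !subr0.
- apply: is_derive_eq; rewrite /GRing.scale/=; lra.
- by rewrite subr_ge0 cos_ge_taylor2.
Qed.

Lemma cos_taylor x : `|cos x - (1 - x ^+ 2 / 2)| <= x ^+ 4.
Proof.
rewrite ger0_norm ?subr_ge0 ?cos_ge_taylor2//.
have cos_le y : 0 <= y -> cos y - (1 - y ^+ 2 / 2) <= y ^+ 4.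
  move=> y0; suff : cos y - (1 - y ^+ 2 / 2) <= y ^+ 4 / 24.
    have : 0 <= y ^+ 4 by rewrite exprn_ge0.
    by set z := y ^+ 4; lra.
  rewrite -subr_ge0.
  apply: (le_trans _ (@ge0_derive_le (fun x => x ^+ 4 / 24 - (cos x - (1 - x ^+ 2 / 2)))
    (fun x => sin x - (x - x ^+ 3 / 6)) y _ _ y0)) => [|z|z z0].
  - by rewrite cos0 !expr0n/= !mul0r subr0 subrr subr0.
  - apply: is_derive_eq; rewrite /GRing.scale/=; lra.
  - by rewrite subr_ge0 sin_ge_taylor3.
have := cos_le _ (normr_ge0 x); rewrite cos_norm real_normK ?num_real//.
by rewrite -[in leRHS]normrX ger0_norm// exprn_even_ge0.
Qed.

Lemma sin_taylor x : `|sin x - x| <= `|x| ^+ 3.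
Proof.
have sin_taylor_ge0 y : 0 <= y -> `|sin y - y| <= `|y| ^+ 3.
  move=> y0; have := sin_le_id y0; have := sin_ge_taylor3 y0.
  have : 0 <= y ^+ 3 by rewrite exprn_ge0.
  rewrite (ger0_norm y0) ler_norml; set z := y ^+ 3 => ? ? ?.
  by lra.
have [x0|/ltW x0] := leP 0 x; first exact: sin_taylor_ge0.
have := @sin_taylor_ge0 (- x); rewrite sinN -opprD normrN normrN; apply.
by rewrite oppr_ge0.
Qed.

Lemma sin_ge_half x : 0 <= x <= 1 -> x / 2 <= sin x.
Proof.
move=> /andP[x0 x1]; have := sin_ge_taylor3 x0.
have : x ^+ 3 <= x by rewrite exprS ler_piMr// exprn_ile1.
by set z := x ^+ 3; lra.
Qed.

(** The function [z |-> cos (x + z) + z sin x] has derivative [sin x - sin (x + z)], of size at most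
    [|z|]. A remainder uniform in [x] is what allows differentiation under the mean later on. *)
Lemma cos_add_taylor1 x y : `|cos (x + y) - cos x + y * sin x| <= 2 * y ^+ 2.
Proof.
pose f z := cos (x + z) + z * sin x.
have fd (z : R) : is_derive z (1 : R) f (- sin (x + z) + sin x).
  apply: is_derive_eq; rewrite /GRing.scale/=; lra.
have key (a b c : R) : a <= c <= b -> `|c| <= `|b| + `|a| ->
    f b - f a = (- sin (x + c) + sin x) * (b - a) ->
    `|f b - f a| <= (`|b| + `|a|) * `|b - a|.
  move=> _ cab ->; rewrite normrM ler_wpM2r//.
  rewrite addrC (le_trans (lipschitz_sin _ _))//.
  by rewrite opprD addrA subrr sub0r normrN.
have -> : cos (x + y) - cos x + y * sin x = f y - f 0.
  by rewrite /f addr0 mul0r addr0; lra.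
have y2 : (`|y| + `|0 : R|) * `|y - 0| <= 2 * y ^+ 2.
  rewrite normr0 addr0 subr0 -expr2 real_normK ?num_real//.
  by have := sqr_ge0 y; lra.
apply: le_trans y2.
have [y0|/ltW y0] := leP 0 y.
  have [c cy fE] := MVT_is_derive fd y0; apply: (key _ _ _ cy _ fE).
  by case/andP: cy => c0 cy; rewrite !ger0_norm// addr0.
have [c cy fE] := MVT_is_derive fd y0.
rewrite distrC (distrC y) (addrC `|y|); apply: (key _ _ _ cy _ fE).
by case/andP: cy => yc c0; rewrite !ler0_norm// oppr0 add0r lerN2.
Qed.

Lemma expRN_lipschitz x y : 0 <= x -> 0 <= y ->
  `|expR (- x) - expR (- y)| <= `|x - y|.
Proof.
wlog xy : x y / x <= y.
  by move=> h x0 y0; case: (leP x y) => [|/ltW] xy;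
    [|rewrite distrC (distrC x)]; exact: h.
move=> x0 y0; rewrite ger0_norm ?subr_ge0 ?ler_expR ?lerN2//.
rewrite distrC ger0_norm ?subr_ge0//.
have -> : - y = - x + (x - y) by lra.
rewrite expRD; set e := expR _; have e0 : 0 <= e by exact: expR_ge0.
have e1 : e <= 1 by rewrite -expR0 ler_expR oppr_le0.
have := expR_ge1Dx (x - y); nra.
Qed.

Lemma expRN_taylor x : 0 <= x -> `|expR (- x) - (1 - x)| <= x ^+ 2.
Proof.
move=> x0; have h1 := expR_ge1Dx (- x).
rewrite ger0_norm; last by lra.
have := @expR_ge1Dx _ x; have := expR_gt0 x; have := expR_gt0 (- x).
have := expRxMexpNx_1 x; set u := expR (- x); set v := expR x => uv u0 v0 v1.
have [x1|x1] := leP 1 x.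
  have : u <= 1 by rewrite -expR0 ler_expR oppr_le0.
  nra.
suff : u * (1 + x) <= 1 by nra.
nra.
Qed.

End elementary_inequalities.

(** * Step functions approximated by trigonometric polynomials *)

Section trig_polynomials.
Context (R : realType).
Implicit Types (f g : R -> R) (x y : R).

(** A triple [(c, a, b)] stands for [c cos (a x + b)]. The phase [b] covers sines as well, and
    frequencies are arbitrary reals, so the class is closed under products and rescaling of the
    variable. *)
Definition trig_poly f : Prop := exists s : seq (R * R * R),
  forall x, f x = \sum_(u <- s) u.1.1 * cos (u.1.2 * x + u.2).

Lemma trig_polyD f g : trig_poly f -> trig_poly g -> trig_poly (fun x => f x + g x).
Proof. by move=> [s fE] [t gE]; exists (s ++ t) => x; rewrite big_cat fE gE. Qed.

Lemma trig_poly_cos (c a b : R) : trig_poly (fun x => c * cos (a * x + b)).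
Proof. by exists [:: (c, a, b)] => x; rewrite big_seq1. Qed.

Lemma trig_poly_cst (c : R) : trig_poly (fun=> c).
Proof. by exists [:: (c, 0, 0)] => x; rewrite big_seq1 mul0r addr0 cos0 mulr1. Qed.

Lemma trig_poly_ext f g : f =1 g -> trig_poly f -> trig_poly g.
Proof. by move=> fg [s fE]; exists s => x; rewrite -fg. Qed.

Lemma trig_polyM f g : trig_poly f -> trig_poly g -> trig_poly (fun x => f x * g x).
Proof.
move=> [s fE] [t gE].
elim: s => [|[[c a] b] s IH] in f fE *.
  by apply: (trig_poly_ext _ (trig_poly_cst 0)) => x; rewrite fE big_nil mul0r.
have {}IH := IH _ (fun x => erefl).
apply: (@trig_poly_ext (fun x => c * cos (a * x + b) * g x +
    (\sum_(u <- s) u.1.1 * cos (u.1.2 * x + u.2)) * g x)).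
  by move=> x; rewrite fE big_cons mulrDl.
apply: trig_polyD => // {IH fE}.
elim: t => [|[[c' a'] b'] t IH] in g gE *.
  by apply: (trig_poly_ext _ (trig_poly_cst 0)) => x; rewrite gE big_nil mulr0.
have {}IH := IH _ (fun x => erefl).
apply: (@trig_poly_ext (fun x =>
   (c * c' / 2 * cos ((a + a') * x + (b + b')) +
    c * c' / 2 * cos ((a - a') * x + (b - b'))) +
    c * cos (a * x + b) * (\sum_(u <- t) u.1.1 * cos (u.1.2 * x + u.2)))).
  move=> x; rewrite gE big_cons/= mulrDr; congr (_ + _).
  have -> : (a + a') * x + (b + b') = (a * x + b) + (a' * x + b') by ring.
  have -> : (a - a') * x + (b - b') = (a * x + b) - (a' * x + b') by ring.
  rewrite cosD cosB; lra.
by apply: trig_polyD => //; apply: trig_polyD; exact: trig_poly_cos.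
Qed.

Lemma trig_poly_brv f : trig_poly f ->
  bounded_rv (f : measurableTypeR R -> R).
Proof.
move=> [s fE]; rewrite (_ : f = fun x => \sum_(u <- s) u.1.1 * cos (u.1.2 * x + u.2)).
  apply: brv_sum => u _; apply: brvM; first exact: brv_cst.
  by apply: brv_cos; apply: measurable_funD => //; exact: measurable_funM.
exact/funext.
Qed.

(* Iterating smoothstep drives [0, 1/2) to 0 and (1/2, 1] to 1; applied to
   1/2 + sin/2 it turns a sine wave into a trigonometric polynomial close to a step. *)
Definition smoothstep x : R := x ^+ 2 * (3 - 2 * x).

Lemma smoothstep01 x : 0 <= x <= 1 -> 0 <= smoothstep x <= 1.
Proof.
move=> /andP[x0 x1]; rewrite /smoothstep mulr_ge0 ?sqr_ge0 ?subr_ge0//=; last lra.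
have : 0 <= (1 - x) ^+ 2 * (1 + 2 * x) by rewrite mulr_ge0 ?sqr_ge0//; lra.
rewrite !expr2; lra.
Qed.

Lemma iter_smoothstep01 n x : 0 <= x <= 1 -> 0 <= iter n smoothstep x <= 1.
Proof. by move=> x01; elim: n => //= n; exact: smoothstep01. Qed.

Lemma smoothstep_sym x : smoothstep (1 - x) = 1 - smoothstep x.
Proof. by rewrite /smoothstep; ring. Qed.

Lemma iter_smoothstep_sym n x : iter n smoothstep (1 - x) = 1 - iter n smoothstep x.
Proof. by elim: n => //= n ->; rewrite smoothstep_sym. Qed.

(** Below [1 / 2 - k] the ratio [smoothstep u / u = u (3 - 2 u)] is at most [1 - k], so the iterates
    stay there and contract geometrically. *)
Lemma iter_smoothstep_le n x k : 0 < k -> 0 <= x <= 1 / 2 - k ->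
  iter n smoothstep x <= (1 - k) ^+ n.
Proof.
move=> k0 /andP[x0 xk].
suff : 0 <= iter n smoothstep x <= 1 / 2 - k /\ iter n smoothstep x <= (1 - k) ^+ n.
  by case.
elim: n => [|n [/andP[u0 uk] IH]]; first by rewrite /= expr0 x0 xk; split => //; lra.
rewrite iterS; set u := iter n smoothstep x in u0 uk IH *.
have r1 : u * (3 - 2 * u) <= 1 - k by nra.
have r0 : 0 <= u * (3 - 2 * u) by rewrite mulr_ge0//; lra.
have -> : smoothstep u = u * (u * (3 - 2 * u)) by rewrite /smoothstep; ring.
split; first by nra.
rewrite exprSr; apply: ler_pM => //.
Qed.

Lemma trig_poly_iter_smoothstep n f : trig_poly f ->
  trig_poly (fun x => iter n smoothstep (f x)).
Proof.
move=> tf; elim: n => //= n IH.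
apply: (@trig_poly_ext (fun x => (iter n smoothstep (f x) * iter n smoothstep (f x)) *
   (3 + -2 * iter n smoothstep (f x)))).
  by move=> x; rewrite /smoothstep; ring.
apply: trig_polyM; first exact: trig_polyM.
apply: trig_polyD; first exact: trig_poly_cst.
by apply: trig_polyM => //; exact: trig_poly_cst.
Qed.

Lemma trig_poly_step x (delta L e : R) : 0 < delta -> 0 < L -> 0 < e ->
  exists f, [/\ trig_poly f, forall y, 0 <= f y <= 1,
    forall y, delta <= x - y <= L -> 1 - e <= f y &
    forall y, delta <= y - x <= L -> f y <= e].
Proof.
move=> delta0 L0 e0.
(* For [delta <= |x - y| <= L] the sine is at least half its argument in size, so [u y] below keeps
   distance [delta / (4 L)] from 1/2; the cap 1/4 keeps [1 - k] inside (0, 1). *)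
pose k := Num.min (1 / 4) (delta / (4 * L)) : R.
have k0 : 0 < k by rewrite lt_min !divr_gt0 ?mulr_gt0.
have k4 : k <= 1 / 4 by rewrite ge_min lexx.
have kL : k <= delta / (4 * L) by rewrite ge_min lexx orbT.
have [n ne] : exists n, (1 - k) ^+ n <= e.
  have /cvgrPdist_le/(_ _ e0)[n _ /(_ n (leqnn _))] : (1 - k) ^+ n @[n --> \oo] --> 0.
    by apply: cvg_expr; rewrite ger0_norm; move: k0 k4; lra.
  rewrite sub0r normrN => h; exists n; rewrite (le_trans (ler_norm _))//.
pose u y : R := 1 / 2 + 1 / 2 * sin ((x - y) / L).
have u01 y : 0 <= u y <= 1.
  have := sin_le1 ((x - y) / L); have := sin_geN1 ((x - y) / L).
  by rewrite /u => ? ?; lra.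
have usym y : u (2 * x - y) = 1 - u y.
  rewrite /u; have -> : (x - (2 * x - y)) / L = - ((x - y) / L) by field; lra.
  rewrite sinN; lra.
have ule y : delta <= y - x <= L -> iter n smoothstep (u y) <= e.
  move=> /andP[dy yL]; apply: (le_trans _ ne); apply: iter_smoothstep_le => //.
  have /andP[-> _] := u01 y; rewrite /=.
  have : 0 <= (y - x) / L <= 1.
    rewrite divr_ge0//=; [|lra|exact: ltW].
    by rewrite ler_pdivrMr// mul1r.
  move=> /sin_ge_half; have -> : (y - x) / L = - ((x - y) / L) by rewrite -mulNr opprB.
  rewrite sinN /u => h.
  have : delta / L <= - ((x - y) / L) by rewrite -mulNr opprB ler_pM2r ?invr_gt0.
  have dL : delta / (4 * L) = 1 / 4 * (delta / L) by field; lra.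
  rewrite dL in kL.
  lra.
exists (fun y => iter n smoothstep (u y)); split => //.
- apply: trig_poly_iter_smoothstep.
  apply: (@trig_poly_ext (fun y => 1 / 2 + 1 / 2 * cos (- L^-1 * y + (x / L - pi / 2)))).
    move=> y; rewrite /u; congr (_ + _ * _).
    by rewrite -cosBpihalf; congr cos; ring.
  by apply: trig_polyD; [exact: trig_poly_cst|exact: trig_poly_cos].
- by move=> y; exact: iter_smoothstep01.
(* The reflection about [x] exchanges the two sides of the step and turns [u] into [1 - u], with
   which [smoothstep] commutes. *)
- move=> y dy; have := ule (2 * x - y).
  rewrite usym iter_smoothstep_sym => h.
  suff : 1 - iter n smoothstep (u y) <= e by lra.
  by apply: h; have -> : 2 * x - y - x = x - y by ring.
Qed.

End trig_polynomials.

Section small_sets.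
Context (R : realType) (mu : probability (measurableTypeR R) R).

Lemma prob_ball_small (x e : R) : mu [set x] = 0%E -> 0 < e ->
  exists2 delta : R, 0 < delta & prob mu [set y | `|y - x| < delta] <= e.
Proof.
move=> mux e0.
pose F (n : nat) : set (measurableTypeR R) := [set y : R | `|y - x| < n.+1%:R^-1].
have mF n : measurable (F n).
  apply: open_measurable; rewrite (_ : F n = ball x n.+1%:R^-1); first exact: ball_open.
  by apply/seteqP; split => y /=; rewrite /F /ball/= distrC.
have : mu \o F @ \oo --> mu (\bigcap_n F n).
  apply: nonincreasing_cvg_mu => //.
  - by rewrite (le_lt_trans (probability_le1 _ _))// ?ltry.
  - exact: bigcap_measurable.
  - move=> m n mn; apply/subsetPset => y; rewrite /F/= => /lt_le_trans; apply.
    by rewrite lef_pV2 ?posrE ?ltr0n// ler_nat ltnS.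
have -> : \bigcap_n F n = [set x].
  apply/seteqP; split => [y Fy|_ -> n _]; last by rewrite /F/= subrr normr0.
  apply/eqP; rewrite -subr_eq0 -normr_eq0; apply/negP => /negP yx.
  have {}yx : 0 < `|y - x| by rewrite lt_def yx normr_ge0.
  have [n] := ltr_add_invr yx; rewrite add0r => yn.
  by have := Fy n Logic.I; rewrite /F/= => /(lt_trans yn); rewrite ltxx.
rewrite mux => /fine_cvgP[_] /cvgrPdist_le/(_ _ e0)[n _ /(_ n (leqnn _))].
rewrite /= sub0r normrN => h; exists n.+1%:R^-1 => //.
exact: le_trans (ler_norm _) h.
Qed.

Lemma prob_tail_small (e : R) : 0 < e ->
  exists2 L : R, 0 < L & prob mu [set y | L <= `|y|] <= e.
Proof.
move=> e0.
pose F (n : nat) : set (measurableTypeR R) := [set y : R | n.+1%:R <= `|y|].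
have mF n : measurable (F n).
  by rewrite -[X in measurable X]setTI; apply: measurable_fun_le.
have : mu \o F @ \oo --> mu (\bigcap_n F n).
  apply: nonincreasing_cvg_mu => //.
  - by rewrite (le_lt_trans (probability_le1 _ _))// ?ltry.
  - exact: bigcap_measurable.
  - move=> m n mn; apply/subsetPset => y; rewrite /F/=; apply: le_trans.
    by rewrite ler_nat ltnS.
have -> : \bigcap_n F n = set0.
  apply/seteqP; split => // y Fy.
  have := Fy (Num.truncn `|y|) Logic.I; rewrite /F/= leNgt.
  by rewrite truncnS_gt.
rewrite measure0 => /fine_cvgP[_] /cvgrPdist_le/(_ _ e0)[n _ /(_ n (leqnn _))].
rewrite /= sub0r normrN => h; exists n.+1%:R => //.
exact: le_trans (ler_norm _) h.
Qed.

End small_sets.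

Section trig_step_sandwich.
Context (R : realType).

(** Far from [x] the polynomial is only known to lie in [0, 1], and the indicator of [L <= |y|] pays
    for that. The step is built on the range [|x| + L + delta], which contains [|x - y|] whenever
    [|y| < L]. *)
Lemma trig_poly_sandwich (x delta L e : R) : 0 < delta -> 0 < L -> 0 < e ->
  exists f : R -> R, [/\ trig_poly f, forall y, 0 <= f y <= 1,
    forall y, f y <= (y <= x + delta)%R%:R + e + (L <= `|y|)%R%:R &
    forall y, (y <= x - delta)%R%:R <= f y + e + (L <= `|y|)%R%:R].
Proof.
move=> delta0 L0 e0.
have L'0 : 0 < `|x| + L + delta by rewrite ltr_wpDl// addr_ge0// ltW.
have [f [tf f01 f1 f0]] := trig_poly_step x delta0 L'0 e0.
have xl : - `|x| <= x <= `|x| by rewrite -ler_norml.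
exists f; split => // y; have /andP[fy0 fy1] := f01 y.
  have [yx|yx] := leP y (x + delta); first by rewrite !ler_wpDr// ltW.
  have [yL|yL] := leP L `|y|; first by rewrite add0r ler_wpDl// ltW.
  rewrite add0r addr0; apply: f0; move: yL; rewrite ltr_norml.
  by case/andP: xl; lra.
have [yx|yx] := leP y (x - delta); last by rewrite !addr_ge0// ltW.
have [yL|yL] := leP L `|y|; first by rewrite ler_wpDl// addr_ge0// ltW.
rewrite addr0 -lerBlDr; apply: f1; move: yL; rewrite ltr_norml.
by case/andP: xl; lra.
Qed.

End trig_step_sandwich.

Section sandwich.
Context d (T : measurableType d) (R : realType) (P : probability T R).
Variables (Y : T -> R) (f : R -> R) (c e L : R).
Hypotheses (mY : measurable_fun setT Y) (bf : bounded_rv (fun w => f (Y w))).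

Let mle : measurable [set w | Y w <= c].
Proof. exact: measurable_set_le. Qed.

Let mtail : measurable [set w | L <= `|Y w|].
Proof. by apply: measurable_set_le => //; exact: measurableT_comp. Qed.

Lemma mean_le_step : (forall y, f y <= (y <= c)%R%:R + e + (L <= `|y|)%R%:R) ->
  mean P (fun w => f (Y w)) <=
  prob P [set w | Y w <= c] + e + prob P [set w | L <= `|Y w|].
Proof.
move=> fle; rewrite -[e](mean_cst P) -!mean_natr// -!meanD; try by bounded.
by apply: mean_le => [||w]; [exact: bf|bounded|exact: fle].
Qed.

Lemma step_le_mean : (forall y, (y <= c)%R%:R <= f y + e + (L <= `|y|)%R%:R) ->
  prob P [set w | Y w <= c] <=
  mean P (fun w => f (Y w)) + e + prob P [set w | L <= `|Y w|].
Proof.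
move=> lef; rewrite -[e](mean_cst P) -!mean_natr// -!meanD; try by bounded.
by apply: mean_le => [||w]; [bounded|bounded|exact: lef].
Qed.

End sandwich.

(** * Convergence in distribution from means of cosines *)

Section levy.
Context (R : realType) (d : nat -> measure_display)
  (T : forall m, measurableType (d m)) (P : forall m, probability (T m) R).
Variables (X Y : forall m, T m -> R) (mu : probability (measurableTypeR R) R).
Arguments X : clear implicits.
Arguments Y : clear implicits.
Hypotheses (mX : forall m, measurable_fun setT (X m))
  (mY : forall m, measurable_fun setT (Y m)).
(** The approximating polynomials are close to a step only on a bounded range, so the mass of [Y m]
    outside it is controlled by a separate hypothesis. *)
Hypothesis tightY : forall e : R, 0 < e -> exists2 L : R, 0 < L &
  \forall m \near \oo, prob (P m) [set w | L <= `|Y m w|] <= e.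
Hypothesis cvgY : forall a b : R,
  mean (P m) (fun w => cos (a * Y m w + b)) @[m --> \oo] -->
  mean mu (fun y => cos (a * y + b)).
Hypothesis XY : forall e : R, 0 < e ->
  prob (P m) [set w | e <= `|X m w - Y m w|] @[m --> \oo] --> (0 : R).

Let measurable_comp_trig m f : trig_poly f -> bounded_rv (fun w => f (Y m w)).
Proof.
move=> /trig_poly_brv[mf [M fM]]; split; first exact: measurableT_comp.
by exists M => w; exact: fM.
Qed.

Lemma cvg_mean_trig_poly f : trig_poly f ->
  mean (P m) (fun w => f (Y m w)) @[m --> \oo] --> mean mu f.
Proof.
move=> [s fE].
have {fE} -> : f = fun x => \sum_(u <- s) u.1.1 * cos (u.1.2 * x + u.2).
  exact/funext.
have bY m (u : R * R * R) : bounded_rv (fun w => cos (u.1.2 * Y m w + u.2)).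
  apply: brv_cos; apply: measurable_funD => //; exact: measurable_funM.
have bmu (u : R * R * R) :
    bounded_rv (fun y : measurableTypeR R => cos (u.1.2 * y + u.2) : R).
  apply: brv_cos; apply: measurable_funD => //; exact: measurable_funM.
rewrite mean_sum; last by move=> u _; apply: brvM => //; exact: brv_cst.
rewrite (_ : (fun m => _) = (fun m => \sum_(u <- s) u.1.1 *
    mean (P m) (fun w => cos (u.1.2 * Y m w + u.2)))); last first.
  apply/funext => m; rewrite mean_sum; last by move=> u _; apply: brvM => //; exact: brv_cst.
  by apply: eq_bigr => u _; rewrite meanZ.
rewrite [X in _ --> X](_ : _ = \sum_(u <- s) u.1.1 *
   mean mu (fun y => cos (u.1.2 * y + u.2))); last first.
  by apply: eq_bigr => u _; rewrite meanZ.
elim: s => [|u s IH].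
  rewrite big_nil (_ : (fun m => _) = fun=> 0); first exact: cvg_cst.
  by apply/funext => m; rewrite big_nil.
rewrite big_cons (_ : (fun m => _) = (fun m => u.1.1 *
    mean (P m) (fun w => cos (u.1.2 * Y m w + u.2)) + \sum_(u <- s) u.1.1 *
    mean (P m) (fun w => cos (u.1.2 * Y m w + u.2)))).
  by apply: cvgD => //; apply: cvgM; [exact: cvg_cst|exact: cvgY].
by apply/funext => m; rewrite big_cons.
Qed.

Let mle m c : measurable [set w | Y m w <= c].
Proof. exact: measurable_set_le. Qed.

Let mtail m L : measurable [set w | L <= `|Y m w|].
Proof. by apply: measurable_set_le => //; exact: measurableT_comp. Qed.

Let mclose m e : measurable [set w | e <= `|X m w - Y m w|].
Proof.
apply: measurable_set_le => //; apply: measurableT_comp => //.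
exact: measurable_funB.
Qed.

(** The event [X m <= x] is compared with [Y m <= x + dlt] and [Y m <= x - dlt], these with means of
    trigonometric polynomials, which converge, and the limits with [mu] near [x], where there is
    little mass. *)
Lemma levy_slutsky_prob x : mu [set x] = 0%E ->
  prob (P m) [set w | X m w <= x] @[m --> \oo] --> prob mu `]-oo, x]%classic.
Proof.
move=> mux; apply/cvgrPdist_le => e0 e0gt0.
pose e := e0 / 8; have e_gt0 : 0 < e by rewrite divr_gt0.
have [dl dl0 xdl] := prob_ball_small mux e_gt0.
have [L1 L10 muL1] := prob_tail_small mu e_gt0.
have [L2 L20 YL2] := tightY e_gt0.
pose L := Num.max L1 L2; have L0 : 0 < L by rewrite lt_max L10.
(* With steps centred at [x + 2 dlt] and [x - 2 dlt], the sandwich reaches back to distance [dlt]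
   from [x] on the side of [Y], the room left for [|X - Y|], and out to [3 dlt] on the side of [mu],
   still inside the ball of radius [dl]. *)
pose dlt := dl / 4; have dlt0 : 0 < dlt by rewrite divr_gt0.
have dltE : dl = 4 * dlt by rewrite /dlt; field.
have [f [tf f01 fle lef]] := trig_poly_sandwich (x + 2 * dlt) dlt0 L0 e_gt0.
have [g [tg g01 gle leg]] := trig_poly_sandwich (x - 2 * dlt) dlt0 L0 e_gt0.
have mmu c : measurable [set y : measurableTypeR R | y <= c].
  exact: (@measurable_set_le _ (measurableTypeR R)).
have mmuL : measurable [set y : measurableTypeR R | L <= `|y|].
  exact: (@measurable_set_le _ (measurableTypeR R)).
have mmub : measurable [set y : measurableTypeR R | `|y - x| < dl].
  apply: (@measurable_set_lt _ (measurableTypeR R)) => //.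
  by apply: measurableT_comp => //; exact: measurable_funB.
have muL : prob mu [set y | L <= `|y|] <= e.
  apply: le_trans muL1; apply: le_prob => //.
    exact: (@measurable_set_le _ (measurableTypeR R)).
  by move=> y /=; apply: le_trans; rewrite le_max lexx.
have setE : `]-oo, x]%classic = [set y : measurableTypeR R | y <= x].
  by apply/seteqP; split => y /=; rewrite in_itv.
have xle : prob mu [set y | y <= x + 3 * dlt] <= prob mu `]-oo, x]%classic + e.
  rewrite setE; apply: (le_trans (y := prob mu ([set y : R | y <= x] `|`
      [set y : R | `|y - x| < dl]))).
    apply: le_prob => //; first exact: measurableU.
    move=> y /= yx; have [yx'|yx'] := leP y x; [by left|right].
    by rewrite ltr_norml; move: yx yx' dlt0; rewrite dltE; lra.
  by apply: (le_trans (prob_setU _ _ _)) => //; rewrite lerD2l.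
have lex : prob mu `]-oo, x]%classic <= prob mu [set y | y <= x - 3 * dlt] + e.
  rewrite setE; apply: (le_trans (y := prob mu ([set y : R | y <= x - 3 * dlt] `|`
      [set y : R | `|y - x| < dl]))).
    apply: le_prob => //; first exact: measurableU.
    move=> y /= yx; have [yx'|yx'] := leP y (x - 3 * dlt); [by left|right].
    by rewrite ltr_norml; move: yx yx' dlt0; rewrite dltE; lra.
  by apply: (le_trans (prob_setU _ _ _)) => //; rewrite lerD2l.
have bmu h : trig_poly h -> bounded_rv (h : measurableTypeR R -> R).
  exact: trig_poly_brv.
have muf : mean mu f <= prob mu `]-oo, x]%classic + 3 * e.
  have := mean_le_step mu (@measurable_id _ _ _) (bmu _ tf) fle.
  by rewrite (_ : x + 2 * dlt + dlt = x + 3 * dlt); [move: xle muL; lra|ring].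
have mug : prob mu `]-oo, x]%classic <= mean mu g + 3 * e.
  have := step_le_mean mu (@measurable_id _ _ _) (bmu _ tg) leg.
  by rewrite (_ : x - 2 * dlt - dlt = x - 3 * dlt); [move: lex muL; lra|ring].
have /cvgrPdist_le/(_ _ e_gt0) Nf := cvg_mean_trig_poly tf.
have /cvgrPdist_le/(_ _ e_gt0) Ng := cvg_mean_trig_poly tg.
have /cvgrPdist_le/(_ _ e_gt0) NXY := XY dlt0.
near=> m.
have fm : `|mean mu f - mean (P m) (fun w => f (Y m w))| <= e.
  near: m; exact: Nf.
have gm : `|mean mu g - mean (P m) (fun w => g (Y m w))| <= e.
  near: m; exact: Ng.
have XYm : `|0 - prob (P m) [set w | dlt <= `|X m w - Y m w|]| <= e.
  near: m; exact: NXY.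
have tY : prob (P m) [set w | L <= `|Y m w|] <= e.
  apply: (le_trans (y := prob (P m) [set w | L2 <= `|Y m w|])); last by near: m.
  by apply: le_prob => // w /=; apply: le_trans; rewrite le_max lexx orbT.
rewrite sub0r normrN ger0_norm ?prob_ge0// in XYm.
have XleY : prob (P m) [set w | X m w <= x] <=
    prob (P m) [set w | Y m w <= x + dlt] + prob (P m) [set w | dlt <= `|X m w - Y m w|].
  apply: (le_trans _ (prob_setU _ _ _)) => //; apply: le_prob.
  - exact: measurable_set_le.
  - exact: measurableU.
  move=> w /= Xx; have [|c] := leP dlt `|X m w - Y m w|; [by right|].
  left; move: c; rewrite ltr_norml => /andP[]; lra.
have YleX : prob (P m) [set w | Y m w <= x - dlt] <=
    prob (P m) [set w | X m w <= x] + prob (P m) [set w | dlt <= `|X m w - Y m w|].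
  apply: (le_trans _ (prob_setU _ _ _)) => //; last exact: measurable_set_le.
  apply: le_prob => //.
    by apply: measurableU => //; exact: measurable_set_le.
  move=> w /= Xx; have [|c] := leP dlt `|X m w - Y m w|; [by right|].
  left; move: c; rewrite ltr_norml => /andP[]; lra.
have Yf : prob (P m) [set w | Y m w <= x + dlt] <= mean (P m) (fun w => f (Y m w)) + 2 * e.
  have := step_le_mean (P m) (@mY m) (measurable_comp_trig m tf) lef.
  by rewrite (_ : x + 2 * dlt - dlt = x + dlt); [move: tY; lra|ring].
have gY : mean (P m) (fun w => g (Y m w)) <= prob (P m) [set w | Y m w <= x - dlt] + 2 * e.
  have := mean_le_step (P m) (@mY m) (measurable_comp_trig m tg) gle.
  by rewrite (_ : x - 2 * dlt + dlt = x - dlt); [move: tY; lra|ring].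
have e0E : e0 = 8 * e by rewrite /e; field.
move: fm gm; rewrite !ler_norml e0E.
move: muf mug XYm XleY YleX Yf gY; lra.
Unshelve. all: by end_near. Qed.

Lemma levy_slutsky x : mu [set x] = 0%E ->
  P m [set w | X m w <= x] @[m --> \oo] --> mu `]-oo, x]%classic.
Proof.
move=> mux; rewrite [X in _ --> X]probE//.
rewrite (_ : (fun m => _) = EFin \o (fun m => prob (P m) [set w | X m w <= x])).
  by apply: cvg_EFin; [exact: nearW|exact: levy_slutsky_prob].
by apply/funext => m /=; rewrite probE//; exact: measurable_set_le.
Qed.

End levy.

(** * Quadrant probabilities determined by linear combinations *)

Section quadrants.
Context (R : realType).

Lemma dist_mul01 (a b c e : R) : 0 <= a <= 1 -> 0 <= e <= 1 ->
  `|a * b - c * e| <= `|a - c| + `|b - e|.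
Proof.
move=> /andP[a0 a1] /andP[e0 e1].
have -> : a * b - c * e = a * (b - e) + (a - c) * e by ring.
rewrite (le_trans (ler_normD _ _))// !normrM (ger0_norm a0) (ger0_norm e0) addrC.
by rewrite lerD// ?ler_piMl// ler_piMr.
Qed.

(** A product of numbers in [0, 1] moves by at most the sum of the moves of its factors, and each
    factor errs by [3 e] in mean. That error involves the common marginal law only, so it is the
    same for every coupling of [X] and [Y]. *)
Lemma prob_quadrant_approx d (T : measurableType d) (P : probability T R)
  (X Y : T -> R) (mu : probability (measurableTypeR R) R) (z dl L e : R) (f : R -> R) :
  measurable_fun setT X -> measurable_fun setT Y ->
  (forall B, measurable B -> P (X @^-1` B) = mu B) ->
  (forall B, measurable B -> P (Y @^-1` B) = mu B) ->
  prob mu [set y | `|y - z| < dl] <= e -> prob mu [set y | L <= `|y|] <= e ->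
  bounded_rv (f : measurableTypeR R -> R) -> (forall y, 0 <= f y <= 1) ->
  (forall y, `|(z <= y)%R%:R - f y| <= e + (`|y - z| < dl)%R%:R + (L <= `|y|)%R%:R) ->
  `|prob P [set w | z <= X w /\ z <= Y w] - mean P (fun w => f (X w) * f (Y w))|
    <= 6 * e.
Proof.
move=> mX mY lX lY me mL bf f01 fE.
have bfc Z : measurable_fun setT Z -> bounded_rv (fun w : T => f (Z w)).
  move=> mZ; case: bf => mf [M fM]; split; first exact: measurableT_comp.
  by exists M => w; exact: fM.
have bz Z : measurable_fun setT Z -> bounded_rv (fun w : T => (z <= Z w)%R%:R : R).
  by move=> mZ; apply: brv_natr; exact: measurable_set_le.
have mmub : measurable [set y : measurableTypeR R | `|y - z| < dl].
  apply: (@measurable_set_lt _ (measurableTypeR R)) => //.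
  by apply: measurableT_comp => //; exact: measurable_funB.
have mmuL : measurable [set y : measurableTypeR R | L <= `|y|].
  exact: (@measurable_set_le _ (measurableTypeR R)).
have close Z : measurable_fun setT Z -> (forall B, measurable B -> P (Z @^-1` B) = mu B) ->
    mean P (fun w => `|(z <= Z w)%R%:R - f (Z w)|) <= 3 * e.
  move=> mZ lZ; have bzZ := bz _ mZ; have bfZ := bfc _ mZ.
  have mZb : measurable [set w | `|Z w - z| < dl].
    by rewrite -[X in measurable X]setTI; exact: (mZ _ _ mmub).
  have mZL : measurable [set w | L <= `|Z w|].
    by rewrite -[X in measurable X]setTI; exact: (mZ _ _ mmuL).
  apply: (le_trans (y := mean P (fun w => e + (`|Z w - z| < dl)%R%:R + (L <= `|Z w|)%R%:R))).
    apply: mean_le => [||w]; last exact: fE.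
    - by bounded.
    - by bounded.
  rewrite !meanD ?mean_natr ?mean_cst//.
  - have -> : prob P [set w | `|Z w - z| < dl] = prob mu [set y | `|y - z| < dl].
      by rewrite /prob -lZ.
    have -> : prob P [set w | L <= `|Z w|] = prob mu [set y | L <= `|y|].
      by rewrite /prob -lZ.
    by move: me mL; lra.
  1-4: by bounded.
have -> : prob P [set w | z <= X w /\ z <= Y w] =
    mean P (fun w => (z <= X w)%R%:R * (z <= Y w)%R%:R).
  rewrite (_ : (fun w => _) = (fun w => ((z <= X w) && (z <= Y w))%R%:R)); last first.
    by apply/funext => w; rewrite -natrM mulnb.
  rewrite mean_natr.
    by congr prob; apply/seteqP; split => w /=; [case=> -> ->|case/andP].
  rewrite (_ : [set w | _] = [set w | z <= X w] `&` [set w | z <= Y w]).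
    by apply: measurableI; exact: measurable_set_le.
  by apply/seteqP; split => w /=; [case/andP|case=> -> ->].
have bzX := bz _ mX; have bzY := bz _ mY; have bfX := bfc _ mX; have bfY := bfc _ mY.
rewrite -meanB; first last; [by bounded|by bounded|].
apply: (le_trans (mean_normr _ _)).
    by bounded.
  apply: (le_trans (y := mean P (fun w => `|(z <= X w)%R%:R - f (X w)| +
      `|(z <= Y w)%R%:R - f (Y w)|))).
    apply: mean_le => [||w].
    - by bounded.
    - by bounded.
    have := @dist_mul01 ((z <= X w)%R%:R) ((z <= Y w)%R%:R) (f (X w)) (f (Y w)).
      apply; last exact: f01.
      by rewrite ler0n lern1 leq_b1.
  rewrite meanD; first by have := close _ mX lX; have := close _ mY lY; lra.
1-2: by bounded.
Qed.

Lemma mean_trig_poly2 d1 (T1 : measurableType d1) (P1 : probability T1 R)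
  d2 (T2 : measurableType d2) (P2 : probability T2 R)
  (X1 Y1 : T1 -> R) (X2 Y2 : T2 -> R) (f g : R -> R) :
  measurable_fun setT X1 -> measurable_fun setT Y1 ->
  measurable_fun setT X2 -> measurable_fun setT Y2 ->
  (forall s t b, mean P1 (fun w => cos (s * X1 w + t * Y1 w + b)) =
                 mean P2 (fun w => cos (s * X2 w + t * Y2 w + b))) ->
  trig_poly f -> trig_poly g ->
  mean P1 (fun w => f (X1 w) * g (Y1 w)) = mean P2 (fun w => f (X2 w) * g (Y2 w)).
Proof.
move=> mX1 mY1 mX2 mY2 ch [s fE] [t gE].
pose E d (T : measurableType d) (P : probability T R) (X Y : T -> R) :=
  \sum_(u <- s) \sum_(v <- t) (u.1.1 * v.1.1 / 2 *
    mean P (fun w => cos (u.1.2 * X w + v.1.2 * Y w + (u.2 + v.2))) +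
    u.1.1 * v.1.1 / 2 *
    mean P (fun w => cos (u.1.2 * X w + - v.1.2 * Y w + (u.2 - v.2)))).
have EE d (T : measurableType d) (P : probability T R) (X Y : T -> R) :
    measurable_fun setT X -> measurable_fun setT Y ->
    mean P (fun w => f (X w) * g (Y w)) = E _ _ P X Y.
  move=> mX mY.
  have bc a b c : bounded_rv (fun w => cos (a * X w + b * Y w + c)).
    apply: brv_cos; apply: measurable_funD => //; apply: measurable_funD;
    exact: measurable_funM.
  have bcc k a b c : bounded_rv (fun w => k * cos (a * X w + b * Y w + c)).
    by apply: brvM; [exact: brv_cst|exact: bc].
  rewrite (_ : (fun w => _) = (fun w => \sum_(u <- s) \sum_(v <- t)
     (u.1.1 * v.1.1 / 2 * cos (u.1.2 * X w + v.1.2 * Y w + (u.2 + v.2)) +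
      u.1.1 * v.1.1 / 2 * cos (u.1.2 * X w + - v.1.2 * Y w + (u.2 - v.2))))).
    rewrite mean_sum; last by move=> u _; apply: brv_sum => v _; apply: brvD; exact: bcc.
    apply: eq_bigr => u _; rewrite mean_sum; last by move=> v _; apply: brvD; exact: bcc.
    by apply: eq_bigr => v _; rewrite meanD ?meanZ//; exact: bcc.
  apply/funext => w; rewrite fE gE mulr_suml; apply: eq_bigr => u _.
  rewrite mulr_sumr; apply: eq_bigr => v _.
  rewrite (_ : _ + (u.2 + v.2) = (u.1.2 * X w + u.2) + (v.1.2 * Y w + v.2)); last ring.
  rewrite (_ : _ + (u.2 - v.2) = (u.1.2 * X w + u.2) - (v.1.2 * Y w + v.2)); last ring.
  move: (u.1.2 * X w + u.2) (v.1.2 * Y w + v.2) => A B.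
  by rewrite cosD cosB; lra.
rewrite !EE//; apply: eq_bigr => u _; apply: eq_bigr => v _.
by rewrite !ch.
Qed.

(* Cramer-Wold for quadrants *)
Lemma prob_quadrant_unique d1 (T1 : measurableType d1) (P1 : probability T1 R)
  d2 (T2 : measurableType d2) (P2 : probability T2 R)
  (X1 Y1 : T1 -> R) (X2 Y2 : T2 -> R) (mu : probability (measurableTypeR R) R) (z : R) :
  measurable_fun setT X1 -> measurable_fun setT Y1 ->
  measurable_fun setT X2 -> measurable_fun setT Y2 ->
  (forall B, measurable B -> P1 (X1 @^-1` B) = mu B) ->
  (forall B, measurable B -> P1 (Y1 @^-1` B) = mu B) ->
  (forall B, measurable B -> P2 (X2 @^-1` B) = mu B) ->
  (forall B, measurable B -> P2 (Y2 @^-1` B) = mu B) ->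
  mu [set z] = 0%E ->
  (forall s t b, mean P1 (fun w => cos (s * X1 w + t * Y1 w + b)) =
                 mean P2 (fun w => cos (s * X2 w + t * Y2 w + b))) ->
  prob P1 [set w | z <= X1 w /\ z <= Y1 w] = prob P2 [set w | z <= X2 w /\ z <= Y2 w].
Proof.
move=> mX1 mY1 mX2 mY2 lX1 lY1 lX2 lY2 muz ch.
apply/eqP; rewrite -subr_eq0 -normr_le0; apply/ler_addgt0Pl => e0 e00.
(* The approximation costs [6 e] for each pair, and the two approximating means coincide. *)
pose e := e0 / 12; have egt0 : 0 < e by rewrite divr_gt0.
have [dl dl0 zdl] := prob_ball_small muz egt0.
have [L L0 muL] := prob_tail_small mu egt0.
pose dlt := dl / 2; have dlt0 : 0 < dlt by rewrite divr_gt0.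
have dltE : dl = 2 * dlt by rewrite /dlt; field.
have [f [tf f01 fle lef]] := trig_poly_sandwich z dlt0 L0 egt0.
pose g y : R := 1 - f y.
have tg : trig_poly g.
  apply: (@trig_poly_ext _ (fun y => 1 + -1 * f y)); first by move=> y; rewrite mulN1r.
  by apply: trig_polyD; [exact: trig_poly_cst|apply: trig_polyM => //; exact: trig_poly_cst].
have g01 y : 0 <= g y <= 1 by have /andP[] := f01 y; rewrite /g => ? ?; lra.
have gE y : `|(z <= y)%R%:R - g y| <= e + (`|y - z| < dl)%R%:R + (L <= `|y|)%R%:R.
  have := fle y; have := lef y; have /andP[f0 f1] := f01 y.
  set l := (L <= `|y|)%R%:R; have l0 : 0 <= l by rewrite ler0n.
  have [yz|yz] := ltP `|y - z| dl.
    move=> _ _; apply: (@le_trans _ _ 1); last by move: egt0 l0; rewrite /=; lra.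
    by rewrite /g ler_norml; case: (z <= y)%R => /=; lra.
  rewrite /= addr0 => h1 h2.
  move: yz; rewrite real_ler_normr ?num_real// => /orP[] yz.
    have zy : z <= y by move: yz dlt0; rewrite dltE; lra.
    have -> : (z <= y)%R = true by [].
    have h : (y <= z + dlt) = false.
      by apply/negbTE; rewrite -ltNge; move: yz dlt0; rewrite dltE; lra.
    rewrite h /= in h2; rewrite /g ler_norml /=; move: h2 f0 f1 egt0 l0; lra.
  have -> : (z <= y)%R = false.
    by apply/negbTE; rewrite -ltNge; move: yz dlt0; rewrite dltE; lra.
  have h : (y <= z - dlt) = true by move: yz dlt0; rewrite dltE; lra.
  rewrite h /= in h1; rewrite /g ler_norml /=; move: h1 f0 f1 egt0 l0; lra.
have bg := trig_poly_brv tg.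
have := prob_quadrant_approx mX1 mY1 lX1 lY1 zdl muL bg g01 gE.
have := prob_quadrant_approx mX2 mY2 lX2 lY2 zdl muL bg g01 gE.
rewrite (mean_trig_poly2 mX1 mY1 mX2 mY2 ch tg tg).
have e0E : e0 = 12 * e by rewrite /e; field.
rewrite !ler_norml e0E; lra.
Qed.

End quadrants.

(** * The characteristic function of the normal law *)

Section normal_char.
Context (R : realType).
Local Notation leb := (@lebesgue_measure R).

(** A quadratic Taylor remainder survives taking means, so this differentiates a mean with respect
    to a parameter without dominated convergence. *)
Lemma is_derive_quadratic (f : R -> R) (x l K : R) :
  (forall h, `|f (x + h) - f x - h * l| <= K * h ^+ 2) -> is_derive x 1 f l.
Proof.
move=> fK; have K0 : 0 <= K.
  by have := le_trans (normr_ge0 _) (fK 1); rewrite expr1n mulr1.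
have lim : h^-1 *: (f (h *: (1 : R) + x) - f x) @[h --> 0^'] --> l.
  apply/cvgrPdist_le => e e0; near=> h.
  have h0 : h != 0 by near: h; exact: nbhs_dnbhs_neq.
  have hK : `|h| <= e / (K + 1).
    by near: h; apply: dnbhs0_le; rewrite divr_gt0// ltr_wpDl.
  have -> : l - h^-1 *: (f (h *: (1 : R) + x) - f x) = - h^-1 * (f (x + h) - f x - h * l).
    by rewrite /GRing.scale/= mulr1 (addrC h); field.
  rewrite normrM normrN normfV ler_pdivrMl ?normr_gt0//.
  apply: (le_trans (fK h)); rewrite -real_normK ?num_real// expr2 mulrA mulrC.
  apply: ler_wpM2l => //; apply: (le_trans (y := (K + 1) * (e / (K + 1)))).
    by apply: ler_pM => //; rewrite ler_wpDr.
  by rewrite mulrC divfK// gt_eqF// ltr_wpDl.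
by apply: DeriveDef; [apply/cvg_ex; exists l|exact: cvg_lim lim].
Unshelve. all: by end_near. Qed.

Variable s : R.
Hypothesis s0 : s != 0.
Local Notation nu := (normal_prob 0 s : probability (measurableTypeR R) R).
Local Notation pdf := (normal_pdf 0 s).

Lemma is_derive_normal_pdf (x : R) : is_derive x 1 pdf (- x / s ^+ 2 * pdf x).
Proof.
rewrite normal_pdfE//; set c := normal_peak s.
pose g y : R := - (y - 0) ^+ 2 / (s ^+ 2 *+ 2).
have gd : is_derive x 1 g (- x / s ^+ 2).
  rewrite /g; apply: is_derive_eq; rewrite /GRing.scale/=; field.
  by rewrite s0.
have -> : (fun x => c * normal_fun 0 s x) = (fun x => c * (expR \o g) x) by [].
apply: is_derive_eq; rewrite /GRing.scale/= /normal_fun -/(g x).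
by ring.
Qed.

Lemma continuous_normal_pdf0 : continuous pdf.
Proof. exact: continuous_normal_pdf. Qed.

(** The Radon-Nikodym derivative of [nu] agrees with [pdf] almost everywhere, since both have the
    same integral over every measurable set. *)
Lemma integral_normal_prob (f : R -> \bar R) : nu.-integrable setT f ->
  (\int[nu]_x f x = \int[leb]_x (f x * (pdf x)%:E))%E.
Proof.
move=> intf; have dom : (nu : set _ -> \bar R) `<< leb by exact: normal_prob_dominates.
have mpdf : measurable_fun setT (EFin \o pdf).
  by apply/measurable_EFinP; exact: measurable_normal_pdf.
rewrite -(Radon_Nikodym_change_of_variables dom)//=.
apply: ae_eq_integral => //.
- by apply: emeasurable_funM => //; exact: measurable_int intf.
- by apply: emeasurable_funM => //; exact: measurable_int intf.
- apply: ae_eqe_mul2l => /=; apply: integral_ae_eq => //.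
    exact: Radon_Nikodym_integrable.
  by move=> E _ mE; rewrite -Radon_Nikodym_integral.
Qed.

Lemma mean_normal_indic (f : R -> R) (a b : R) :
  measurable_fun setT f -> {within `[a, b], continuous f} ->
  bounded_rv (fun x : measurableTypeR R => f x * \1_`[a, b] x) ->
  mean nu (fun x => f x * \1_`[a, b] x) = \int[leb]_(x in `[a, b]) (f x * pdf x).
Proof.
move=> mf cf bf; rewrite /mean /Rintegral integral_normal_prob; last first.
  exact: brv_integrable.
congr fine; rewrite [RHS]integral_mkcond; apply: eq_integral => x _.
rewrite patchE indicE; case: ifPn => xab; first by rewrite mulr1.
by rewrite mulr0 mul0e.
Qed.

Lemma continuous_is_derive (f df : R -> R) :
  (forall x : R, is_derive x (1 : R) f (df x)) -> continuous f.
Proof.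
move=> fd x; apply: differentiable_continuous; apply/derivable1_diffP.
by have [] := fd x.
Qed.

Lemma RintegralFTC (f df : R -> R) (a b : R) : a < b ->
  (forall x : R, is_derive x (1 : R) f (df x)) -> continuous df ->
  \int[leb]_(x in `[a, b]) df x = f b - f a.
Proof.
move=> ab fd cdf; rewrite /Rintegral (continuous_FTC2 (F := f) ab)//.
- exact: continuous_subspaceT.
- have cf := continuous_is_derive fd; split.
  + by move=> x _; have [] := fd x.
  + by apply: cvg_at_right_filter; exact: cf.
  + by apply: cvg_at_left_filter; exact: cf.
- by move=> x _; rewrite derive1E; have [_ ->] := fd x.
Qed.

Lemma normal_pdfN x : pdf (- x) = pdf x.
Proof. by rewrite normal_pdfE// /normal_fun !subr0 sqrrN. Qed.

Let I (N x : R) : R := (`|x| <= N)%R%:R.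

Let IE N : \1_`[(- N), N] = I N :> (R -> R).
Proof.
apply/funext => x; rewrite indicE /I; congr ((_ : bool)%:R).
by apply/idP/idP; rewrite inE/= in_itv/= ler_norml.
Qed.

Let brv_I N : bounded_rv (I N : measurableTypeR R -> R).
Proof. by apply: brv_natr; exact: (@measurable_set_le _ (measurableTypeR R)). Qed.

Let brv_xI N : 0 <= N -> bounded_rv (fun x : measurableTypeR R => x * I N x).
Proof.
move=> N0; split; first by apply: measurable_funM => //; have [] := brv_I N.
by exists N => x; rewrite /I; case: (leP `|x| N) => xN; rewrite /= ?mulr1n ?mulr0n ?mulr1 ?mulr0 ?normr0.
Qed.

Let mlin (t b : R) : measurable_fun setT (fun x : measurableTypeR R => t * x + b).
Proof. by apply: measurable_funD => //; exact: measurable_funM. Qed.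

(** [C] is the characteristic function truncated to [|x| <= N], and [- S] is its derivative in [t];
    the truncation keeps the factor [x] bounded. *)
Let C (N b t : R) := mean nu (fun x => cos (t * x + b) * I N x).
Let S (N b t : R) := mean nu (fun x => sin (t * x + b) * (x * I N x)).

Let C_brv N b t : bounded_rv (fun x : measurableTypeR R => cos (t * x + b) * I N x).
Proof. by bounded. Qed.

Let S_brv N b t : 0 <= N ->
  bounded_rv (fun x : measurableTypeR R => sin (t * x + b) * (x * I N x)).
Proof. by move=> N0; apply: brvM; [apply: brv_sin; exact: mlin|exact: brv_xI]. Qed.

Let I01 N x : 0 <= I N x <= 1.
Proof. by rewrite /I ler0n lern1 leq_b1. Qed.

Let IN N x : 0 <= N -> `|x| * I N x <= N.
Proof. by move=> N0; rewrite /I; case: (leP `|x| N) => xN; rewrite /= ?mulr1n ?mulr0n ?mulr1 ?mulr0. Qed.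

Let is_derive_C (N b t : R) : 0 <= N -> is_derive t (1 : R) (C N b) (- S N b t).
Proof.
move=> N0; apply: (@is_derive_quadratic _ _ _ (2 * N ^+ 2)) => h.
rewrite mulrN opprK -meanZ; last exact: S_brv.
rewrite -meanB; [|exact: C_brv|exact: C_brv].
rewrite -meanD; last 2 first.
  by bounded.
  by bounded.
apply: mean_bound.
  apply: brvD; first by bounded.
  by bounded.
move=> x; have := cos_add_taylor1 (t * x + b) (h * x).
have -> : t * x + b + h * x = (t + h) * x + b by ring.
set u := cos _ - _ + _ => hu.
have -> : cos ((t + h) * x + b) * I N x - cos (t * x + b) * I N x +
   h * (sin (t * x + b) * (x * I N x)) = u * I N x by rewrite /u; ring.
rewrite normrM (ger0_norm (proj1 (andP (I01 N x)))).
have := IN x N0; have /andP[i0 i1] := I01 N x.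
set i := I N x in i0 i1 *; set v := `|x| => vN.
have v0 : 0 <= v by exact: normr_ge0.
have vx : x ^+ 2 = v ^+ 2 by rewrite /v real_normK ?num_real.
apply: (@le_trans _ _ (2 * (h * x) ^+ 2 * i)); first exact: ler_wpM2r.
rewrite exprMn vx; have : v ^+ 2 * i <= N ^+ 2.
  have [->|i_neq0] := eqVneq i 0; first by rewrite mulr0 sqr_ge0.
  have i_eq1 : i = 1.
    by move: i_neq0; rewrite /i /I; case: leP; rewrite ?eqxx.
  by move: vN; rewrite i_eq1 !mulr1 => vN; rewrite ler_pXn2r// nnegrE.
set p := v ^+ 2 * i => pN.
have -> : 2 * (h ^+ 2 * v ^+ 2) * i = 2 * h ^+ 2 * p by rewrite /p; ring.
have -> : 2 * N ^+ 2 * h ^+ 2 = 2 * h ^+ 2 * N ^+ 2 by ring.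
by apply: ler_wpM2l => //; rewrite mulr_ge0// sqr_ge0.
Qed.

(* Integration by parts against the density, truncated to [-N, N]. *)
Let S_eq N b t : 0 < N -> S N b t =
  s ^+ 2 * (t * C N b t - (sin (t * N + b) - sin (t * - N + b)) * pdf N).
Proof.
move=> N0; have N0' := ltW N0.
pose F x := sin (t * x + b) * pdf x.
pose f x := - x / s ^+ 2 * sin (t * x + b) + t * cos (t * x + b).
have Fd (x : R) : is_derive x (1 : R) F (f x * pdf x).
  have := is_derive_normal_pdf x => ?; rewrite /F; apply: is_derive_eq.
  by rewrite /GRing.scale/= /f; ring.
have fc : continuous f.
  move=> x; apply: differentiable_continuous; apply/derivable1_diffP.
  exact: ex_derive.
have Fint := @RintegralFTC F (fun x => f x * pdf x) (- N) N.
have NN : - N < N by rewrite gt0_cp.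
have fpc : continuous (fun x => f x * pdf x).
  by move=> x; apply: cvgM; [exact: fc|exact: continuous_normal_pdf0].
have {}Fint := Fint NN Fd fpc.
have bf : bounded_rv (fun x : measurableTypeR R => f x * I N x).
  rewrite (_ : (fun x => _) = (fun x => - (s ^+ 2)^-1 * (sin (t * x + b) * (x * I N x)) +
     t * (cos (t * x + b) * I N x))).
    by bounded.
  by apply/funext => x; rewrite /f; ring.
have mf : measurable_fun setT f by exact: continuous_measurable_fun.
rewrite -IE in bf; have := mean_normal_indic mf (continuous_subspaceT fc) bf.
rewrite IE Fint {1}(_ : (fun x => _) = (fun x => - (s ^+ 2)^-1 * (sin (t * x + b) * (x * I N x)) +
     t * (cos (t * x + b) * I N x))); last first.
  by apply/funext => x; rewrite /f; ring.
rewrite meanD; [|by apply: brvM; [exact: brv_cst|exact: S_brv]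
               |by apply: brvM; [exact: brv_cst|exact: C_brv]].
rewrite !meanZ; try by [exact: C_brv|exact: S_brv].
rewrite -/(S N b t) -/(C N b t) /F normal_pdfN => h.
have -> : S N b t = s ^+ 2 * ((s ^+ 2)^-1 * S N b t) by rewrite mulrA divff ?mul1r// expf_neq0.
congr (_ * _); move: h; lra.
Qed.

(** Derivative and integration by parts give [C' = - s^2 t C + s^2 r] with [|r| <= 2 pdf N]. The
    integrating factor [expR (s^2 t^2 / 2)] leaves only the boundary term [r], and the mean value
    theorem between 0 and [a] bounds its effect. *)
Let char_trunc N b a : 0 < N ->
  `|expR (s ^+ 2 * a ^+ 2 / 2) * C N b a - C N b 0| <=
  `|a| * (expR (s ^+ 2 * a ^+ 2 / 2) * s ^+ 2 * (2 * pdf N)).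
Proof.
move=> N0; pose D t := expR (s ^+ 2 * t ^+ 2 / 2) * C N b t.
pose r t := (sin (t * N + b) - sin (t * - N + b)) * pdf N.
have Dd (t : R) : is_derive t (1 : R) D (expR (s ^+ 2 * t ^+ 2 / 2) * s ^+ 2 * r t).
  have := is_derive_C b t (ltW N0) => ?.
  have gd : is_derive t (1 : R) (fun t => s ^+ 2 * t ^+ 2 / 2) (s ^+ 2 * t).
    by apply: is_derive_eq; rewrite /GRing.scale/=; field.
  have ed : is_derive t (1 : R) (expR \o (fun t => s ^+ 2 * t ^+ 2 / 2))
    (s ^+ 2 * t * expR (s ^+ 2 * t ^+ 2 / 2)).
    by apply: is_derive_eq; rewrite /GRing.scale/= mulrC.
  rewrite (_ : D = fun t => (expR \o (fun t => s ^+ 2 * t ^+ 2 / 2)) t * C N b t)//.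
  apply: is_derive_eq; rewrite S_eq// /GRing.scale/= /r; ring.
have rN t : `|r t| <= 2 * pdf N.
  rewrite /r normrM (ger0_norm (normal_pdf_ge0 _ _ _)) ler_wpM2r ?normal_pdf_ge0//.
  rewrite (le_trans (ler_normB _ _))//.
  by have := sin_max (t * N + b); have := sin_max (t * - N + b); lra.
have -> : C N b 0 = D 0 by rewrite /D expr0n/= mulr0 mul0r expR0 mul1r.
rewrite -/(D a).
have Dbound t : t ^+ 2 <= a ^+ 2 -> `|expR (s ^+ 2 * t ^+ 2 / 2) * s ^+ 2 * r t| <=
    expR (s ^+ 2 * a ^+ 2 / 2) * s ^+ 2 * (2 * pdf N).
  move=> ta; rewrite normrM; apply: ler_pM => //.
  rewrite normrM (ger0_norm (expR_ge0 _)) (ger0_norm (sqr_ge0 s)).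
  apply: ler_wpM2r; first exact: sqr_ge0.
  by rewrite ler_expR ler_wpM2r// ler_wpM2l// sqr_ge0.
have [a0|/ltW a0] := leP 0 a.
  have [c /andP[c0 ca] ->] := MVT_is_derive Dd a0.
  rewrite subr0 normrM mulrC; apply: ler_wpM2l => //; apply: Dbound.
  by rewrite ler_pXn2r// nnegrE.
have [c /andP[c0 ca] DE] := MVT_is_derive Dd a0.
rewrite distrC DE sub0r normrM normrN mulrC; apply: ler_wpM2l => //; apply: Dbound.
by rewrite -(sqrrN c) -(sqrrN a) ler_pXn2r ?nnegrE ?oppr_ge0// lerN2.
Qed.

Lemma mean_normal_cos (a b : R) :
  mean nu (fun x => cos (a * x + b)) = expR (- (s ^+ 2 * a ^+ 2 / 2)) * cos b.
Proof.
set E := expR (s ^+ 2 * a ^+ 2 / 2).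
have E0 : 0 < E by exact: expR_gt0.
have bcos t : bounded_rv (fun x : measurableTypeR R => cos (t * x + b)).
  by bounded.
suff key : E * mean nu (fun x => cos (a * x + b)) = cos b.
  by rewrite expRN -/E -key mulKf// gt_eqF.
apply/eqP; rewrite -subr_eq0 -normr_le0; apply/ler_addgt0Pl => e e0.
(* The summands are the costs of truncating at frequency [a], of truncating at frequency 0, and of
   the boundary term. *)
pose K := E + 1 + `|a| * (E * s ^+ 2 * 2).
have K0 : 0 < K.
  have := sqr_ge0 s; have := normr_ge0 a; rewrite /K => a0 s20.
  have : 0 <= `|a| * (E * s ^+ 2 * 2) by rewrite mulr_ge0// mulr_ge0// mulr_ge0// ltW.
  by move: E0; lra.
have eK0 : 0 < e / K by rewrite divr_gt0.
have [L L0 tailL] := prob_tail_small nu eK0.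
pose p := normal_peak s; have p0 : 0 < p by exact: normal_peak_gt0.
(* [L] handles the tail; the last entry makes [pdf N <= e / K] through [expR (- y) <= 1 / y], with
   [N >= 1] giving [N <= N^2]. *)
pose N := Num.max L (Num.max 1 (p * (2 * s ^+ 2) / (e / K))).
have N0 : 0 < N by rewrite lt_max L0.
have N1 : 1 <= N by rewrite !le_max lexx orbT.
have Ntail : mean nu (fun x => `|1 - I N x|) <= e / K.
  apply: le_trans tailL; rewrite -mean_natr; last first.
    exact: (@measurable_set_le _ (measurableTypeR R)).
  apply: mean_le.
  - by bounded.
  - by apply: brv_natr; exact: (@measurable_set_le _ (measurableTypeR R)).
  move=> x; rewrite /I; case: (leP `|x| N) => xN; first by rewrite subrr normr0.
  rewrite subr0 normr1 ler1n lt0b (le_trans _ (ltW xN))//.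
  by rewrite le_max lexx.
have pdfN : pdf N <= e / K.
  have Np : p * (2 * s ^+ 2) / (e / K) <= N by rewrite !le_max lexx !orbT.
  rewrite normal_pdfE// -/p /normal_fun subr0 mulNr.
  set y := N ^+ 2 / (s ^+ 2 *+ 2).
  have s20 : 0 < s ^+ 2 by rewrite exprn_even_gt0.
  have y0 : 0 < y by rewrite divr_gt0 ?exprn_gt0// pmulrn_lgt0.
  have : expR (- y) <= y^-1.
    rewrite expRN lef_pV2 ?posrE ?expR_gt0//.
    by rewrite (le_trans _ (expR_ge1Dx _))// lerDr.
  move=> /(ler_wpM2l (ltW p0)) /le_trans; apply.
  rewrite /y invf_div.
  move: Np; rewrite ler_pdivrMr// => Np.
  rewrite mulrA ler_pdivrMr ?exprn_gt0// -mulr_natr (mulrC (s ^+ 2)).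
  apply: (le_trans Np); rewrite mulrC expr2; apply: ler_wpM2l; first exact: ltW.
  by rewrite ler_peMr// ltW.
have close t : `|mean nu (fun x => cos (t * x + b)) - C N b t| <= e / K.
  rewrite -meanB//; apply: le_trans Ntail; apply: (le_trans (mean_normr _ _)).
    by apply: brvB.
  apply: mean_le.
  - by bounded.
  - by bounded.
  move=> x; rewrite -{1}(mulr1 (cos _)) -mulrBr normrM ler_piMl//.
  by rewrite ler_norml cos_geN1 cos_le1.
have := close a; have := close 0; have := char_trunc b a N0; rewrite -/E.
have -> : mean nu (fun x => cos (0 * x + b)) = cos b.
  by rewrite -[RHS](mean_cst nu); congr mean; apply/funext => x; rewrite mul0r add0r.
set c0 := C N b 0; set ca := C N b a; set m := mean _ _ => h1 h2 h3.
rewrite addr0.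
have -> : E * m - cos b = E * (m - ca) + (E * ca - c0) - (cos b - c0) by ring.
have h4 : `|E * (m - ca)| <= E * (e / K).
  by rewrite normrM gtr0_norm// ler_wpM2l// ltW.
have h5 : `|E * ca - c0| <= `|a| * (E * s ^+ 2 * 2) * (e / K).
  apply: (le_trans h1).
  have -> : `|a| * (E * s ^+ 2 * (2 * pdf N)) = `|a| * (E * s ^+ 2 * 2) * pdf N by ring.
  apply: ler_wpM2l => //; rewrite mulr_ge0// mulr_ge0// mulr_ge0 ?sqr_ge0//.
  exact: ltW.
apply: (le_trans (ler_normB _ _)).
have -> : e = (E + `|a| * (E * s ^+ 2 * 2) + 1) * (e / K).
  by rewrite (_ : _ + 1 = K); [field; rewrite gt_eqF|rewrite /K; ring].
rewrite [leRHS]mulrDl mul1r lerD//.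
rewrite (le_trans (ler_normD _ _))// mulrDl lerD//.
Qed.

End normal_char.

(** * Identification of laws and means under product measures *)

Section laws.
Context (R : realType).

Lemma prob_rays_unique (mu1 mu2 : probability (measurableTypeR R) R) :
  (forall x : R, mu1 `]-oo, x]%classic = mu2 `]-oo, x]%classic) ->
  forall B, measurable B -> mu1 B = mu2 B.
Proof.
move=> mu12 B mB.
have ray x : mu1 `]x, +oo[%classic = mu2 `]x, +oo[%classic.
  by rewrite -[X in mu1 X]setCitvl -[X in mu2 X]setCitvl !probability_setC// mu12.
apply: (@measure_unique _ R (measurableTypeR R) (@RGenOInfty.G R)
  (fun n => `](- n%:R : R), +oo[%classic)) => //.
- exact: RGenOInfty.measurableE.
- move=> _ _ [x ->] [y ->]; exists (Num.max x y).
  by apply/seteqP; split => z /=; rewrite !in_itv/= !andbT gt_max => /andP.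
- by move=> n; exists (- n%:R).
- apply/seteqP; split => // x _; exists (Num.truncn `|x|).+1 => //=.
  by rewrite in_itv/= andbT ltrNl (le_lt_trans (ler_norm _))// normrN truncnS_gt.
- by move=> _ [x ->]; exact: ray.
- by move=> n; rewrite (le_lt_trans (probability_le1 _ _))// ltry.
Qed.

Lemma mean_law d (T : measurableType d) (P : probability T R) (Y : T -> R)
  (mu : probability (measurableTypeR R) R) (f : measurableTypeR R -> R) :
  measurable_fun setT Y ->
  (forall B, measurable B -> P (Y @^-1` B) = mu B) -> bounded_rv f ->
  mean P (fun w => f (Y w)) = mean mu f.
Proof.
move=> mY lY bf; have mx := isMeasurableFun.Build _ _ _ (measurableTypeR R) Y mY.
pose Y' : {mfun T >-> measurableTypeR R} := HB.pack Y mx.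
rewrite /mean /Rintegral; congr fine.
have iP : P.-integrable setT ((EFin \o f) \o Y').
  apply: (brv_integrable P (f := fun w => f (Y w))).
  case: bf => mf [M fM]; split; first exact: measurableT_comp.
  by exists M => w; exact: fM.
have := @integral_distribution _ _ _ _ _ P Y' (EFin \o f).
have mf : measurable_fun setT (EFin \o f) by apply/measurable_EFinP; have [] := bf.
move=> /(_ mf iP) /= <-.
by apply: eq_measure_integral => B mB _; exact: lY.
Qed.

(** The convergence theorem applied to a constant sequence: the limit is both the law of [Y] and
    [mu]. As [mu] has no atoms, this identifies the mass of every ray. *)
Lemma law_of_char d (T : measurableType d) (P : probability T R) (Y : T -> R)
  (mu : probability (measurableTypeR R) R) :
  measurable_fun setT Y -> (forall x, mu [set x] = 0%E) ->
  (forall a b : R, mean P (fun w => cos (a * Y w + b)) =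
                   mean mu (fun y => cos (a * y + b))) ->
  forall B, measurable B -> P (Y @^-1` B) = mu B.
Proof.
move=> mY mu0 ch B mB; have mx := isMeasurableFun.Build _ _ _ (measurableTypeR R) Y mY.
pose Y' : {mfun T >-> measurableTypeR R} := HB.pack Y mx.
pose muY : probability (measurableTypeR R) R := distribution P Y'.
change (muY B = mu B); apply: prob_rays_unique => // x.
have -> : muY `]-oo, x]%classic = P [set w | Y w <= x].
  by congr (P _); apply/seteqP; split => w /=; rewrite in_itv.
suff h : P [set w | Y w <= x] @[_ --> \oo] --> mu `]-oo, x]%classic.
  by rewrite -(cvg_lim _ h)// lim_cst.
apply: (@levy_slutsky R (fun=> d) (fun=> T) (fun=> P) (fun=> Y) (fun=> Y) mu
  (fun=> mY) (fun=> mY) _ _ _ x (mu0 x)).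
- move=> e e0; have [L L0 muL] := prob_tail_small muY e0.
  by exists L => //; apply: nearW => m; exact: muL.
- by move=> a b; rewrite -ch; exact: cvg_cst.
- move=> e e0; rewrite (_ : (fun m => _) = fun=> 0); first exact: cvg_cst.
  apply/funext => m; rewrite (_ : [set w | _] = set0) /prob ?measure0//.
  by apply/seteqP; split => w //=; rewrite subrr normr0 leNgt e0.
Qed.

Lemma mean_prod d1 (T1 : measurableType d1) (P1 : probability T1 R)
  d2 (T2 : measurableType d2) (P2 : probability T2 R) (f : T1 * T2 -> R) :
  bounded_rv f ->
  mean (P1 \x P2)%E f = mean P1 (fun x => mean P2 (fun y => f (x, y))).
Proof.
move=> bf; have [mf [M fM]] := bf.
have bfx x : bounded_rv (fun y => f (x, y)).
  split; last by exists M => y; exact: fM.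
  exact: measurableT_comp mf (measurable_pair1 x).
rewrite /mean {1}/Rintegral -integral12_prod_meas1; last first.
  exact: brv_integrable bf.
congr fine; apply: eq_integral => x _.
rewrite /fubini_F /Rintegral fineK//; apply: integrable_fin_num => //.
exact: brv_integrable (bfx x).
Qed.

End laws.

(** * The standard normal tail function and its shifts *)

Section normal_distribution_function.
Context (R : realType).
Local Notation leb := (@lebesgue_measure R).
Local Notation nu := (normal_prob 0 1 : probability (measurableTypeR R) R).
Local Notation pdf := (normal_pdf 0 (1 : R)).
Implicit Types x y z t : R.

Let one_neq0 : (1 : R) != 0. Proof. exact: oner_neq0. Qed.

Lemma normal_pdf_gt0 x : 0 < pdf x.
Proof. by rewrite normal_pdfE// mulr_gt0 ?normal_peak_gt0 ?expR_gt0. Qed.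

Lemma normal_prob_set1 s x : s != 0 -> normal_prob 0 s [set x] = 0%E.
Proof.
move=> s0; rewrite /normal_prob integral_set1//.
Qed.

Lemma Phi_EFin x : Phi x%:E = prob nu [set y | y <= x].
Proof. by rewrite /Phi /prob; congr (fine (nu _)); apply/seteqP; split. Qed.

Lemma is_derive_Phi x : is_derive x (1 : R) (fun x => Phi x%:E) (pdf x).
Proof.
have ipdf : leb.-integrable [set` Interval -oo%O (BRight (x + 1))] (EFin \o pdf).
  by apply: (integrableS _ _ (@subsetT _ _)) => //; exact: integrable_normal_pdf.
have xx1 : x < x + 1 by rewrite ltrDl.
have [dF F'] := @continuous_FTC1 _ pdf -oo%O x _ xx1 ipdf (ltNyr _)
  (continuous_normal_pdf (m := 0) one_neq0 (x := x)).
have -> : (fun x => Phi x%:E) = (fun x => \int[leb]_(t in `]-oo, x]) pdf t).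
  apply/funext => y; rewrite Phi_EFin /prob /Rintegral.
  have -> : [set z | z <= y] = `]-oo, y]%classic.
    by apply/seteqP; split => z /=; rewrite in_itv.
  by [].
by apply: DeriveDef; [exact: dF|rewrite -F' derive1E].
Qed.

Lemma is_derive_Phibar x : is_derive x (1 : R) (fun x => Phibar x%:E) (- pdf x).
Proof.
have := is_derive_Phi x => ?; rewrite /Phibar.
by apply: is_derive_eq; rewrite add0r mul1r.
Qed.

Lemma continuous_Phibar : continuous (fun x => Phibar x%:E).
Proof. exact: (@continuous_is_derive _ _ (fun x => - pdf x) is_derive_Phibar). Qed.

Lemma Phibar_prob x : Phibar x%:E = prob nu [set y | x <= y].
Proof.
have mle c : measurable [set y : measurableTypeR R | y <= c].
  exact: (@measurable_set_le _ (measurableTypeR R)).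
have mlt c : measurable [set y : measurableTypeR R | y < c].
  exact: (@measurable_set_lt _ (measurableTypeR R)).
rewrite /Phibar Phi_EFin.
have -> : [set y : R | x <= y] = ~` [set y : R | y < x].
  by apply/seteqP; split => y /=; rewrite leNgt => /negP.
rewrite prob_setC//; congr (_ - _); rewrite /prob; congr fine.
have -> : [set y : R | y <= x] = [set y : R | y < x] `|` [set x].
  apply/seteqP; split => y /=; last by move=> [/ltW|->].
  by rewrite le_eqVlt => /predU1P[->|]; [right|left].
rewrite measureU//.
- by rewrite [X in (_ + X)%E](normal_prob_set1 x one_neq0) adde0.
- by apply/seteqP; split => y //= [] /[swap] ->; rewrite ltxx.
Qed.

Lemma Phibar_decreasing x y : x < y -> Phibar y%:E < Phibar x%:E.
Proof.
move=> xy; have [c _ fE] := MVT_is_derive is_derive_Phibar (ltW xy).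
by rewrite -subr_lt0 fE mulNr oppr_lt0 mulr_gt0 ?normal_pdf_gt0 ?subr_gt0.
Qed.

Lemma Phibar_le x y : (Phibar y%:E <= Phibar x%:E) = (x <= y).
Proof.
apply/idP/idP => [|]; last first.
  by rewrite le_eqVlt => /predU1P[->//|/Phibar_decreasing/ltW].
by apply: contraTT; rewrite -!ltNge; exact: Phibar_decreasing.
Qed.

Lemma Phibar_gt0 x : 0 < Phibar x%:E.
Proof.
apply: (@le_lt_trans _ _ (Phibar (x + 1)%:E)).
  by rewrite Phibar_prob prob_ge0.
by apply: Phibar_decreasing; rewrite ltrDl.
Qed.

Lemma Phibar_lt1 x : Phibar x%:E < 1.
Proof.
apply: (@lt_le_trans _ _ (Phibar (x - 1)%:E)).
  by apply: Phibar_decreasing; rewrite gtrBl.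
by rewrite /Phibar Phi_EFin lerBlDr lerDl prob_ge0.
Qed.

Lemma Phibar_pinfty : Phibar (+oo%E : \bar R) = 0.
Proof.
rewrite /Phibar /Phi (_ : [set z : R | _] = setT).
  by rewrite [X in fine X]probability_setT subrr.
by apply/seteqP; split => z //= _; exact: leey.
Qed.

Lemma Phibar_ninfty : Phibar (-oo%E : \bar R) = 1.
Proof.
rewrite /Phibar /Phi (_ : [set z : R | _] = set0).
  by rewrite [X in fine X]measure0 subr0.
by apply/seteqP; split => z //=; rewrite leeNy_eq.
Qed.

(** The value tells the kinds of argument apart: 0 at [+oo], 1 at [-oo], strictly between on the
    reals, where [Phibar] decreases strictly. Injectivity is what turns the choice made in
    [Phibar_inv] into an inverse. *)
Lemma Phibar_inj : injective (Phibar : \bar R -> R).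
Proof.
have fin_infty x (y : \bar R) : Phibar x%:E = Phibar y -> y \is a fin_num.
  have := Phibar_gt0 x; have := Phibar_lt1 x.
  case: y => [//||] + + xy; first by rewrite (etrans xy Phibar_pinfty) ltxx.
  by rewrite (etrans xy Phibar_ninfty) ltxx.
have infty : Phibar (+oo%E : \bar R) <> Phibar (-oo%E : \bar R).
  move=> h; have := oner_neq0 R; apply/negP; rewrite negbK; apply/eqP.
  exact: etrans (esym Phibar_ninfty) (etrans (esym h) Phibar_pinfty).
move=> [x| |] [y| |] //.
- move=> xy; congr EFin; apply/eqP; rewrite eq_le; apply/andP; split.
    by rewrite -Phibar_le xy.
  by rewrite -Phibar_le xy.
- by move/fin_infty.
- by move/fin_infty.
- by move/esym/fin_infty.
- by move/esym/fin_infty.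
- by move/esym/infty.
Qed.

Lemma Phibar_tail e : 0 < e -> exists2 L : R, 0 < L &
  Phibar L%:E <= e /\ 1 - e <= Phibar (- L)%:E.
Proof.
move=> e0; have [L L0 tL] := prob_tail_small nu e0; exists L => //.
have mL : measurable [set y : measurableTypeR R | L <= `|y|].
  exact: (@measurable_set_le _ (measurableTypeR R)).
split.
  rewrite Phibar_prob; apply: le_trans tL; apply: le_prob => //.
    exact: (@measurable_set_le _ (measurableTypeR R)).
  by move=> y /= Ly; rewrite (le_trans Ly)// ler_norm.
rewrite /Phibar Phi_EFin lerB//; apply: le_trans tL; apply: le_prob => //.
  exact: (@measurable_set_le _ (measurableTypeR R)).
by move=> y /= yL; rewrite -normrN (le_trans _ (ler_norm _))// lerNr.
Qed.

Lemma Phibar_surj t : 0 < t < 1 -> exists z : R, Phibar z%:E = t.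
Proof.
move=> /andP[t0 t1].
have [L1 L10 [h1 _]] := Phibar_tail t0.
have t1' : 0 < 1 - t by rewrite subr_gt0.
have [L2 L20 [_ h2]] := Phibar_tail t1'.
have LL : - L2 <= L1 by rewrite (le_trans (y := 0))// ?oppr_le0 ltW.
have [||c _ cE] := @IVT R (fun x => Phibar x%:E) (- L2) L1 t LL.
- by apply: continuous_subspaceT; exact: continuous_Phibar.
- rewrite ge_min le_max; apply/andP; split; first by rewrite h1 orbT.
  by apply/orP; left; move: h2; lra.
by exists c.
Qed.

Lemma Phibar_inv_eq (x : \bar R) : Phibar_inv (Phibar x) = x.
Proof.
rewrite /Phibar_inv; case: xgetP => [y _ /= /Phibar_inj //|].
by move=> /(_ x) /(_ erefl).
Qed.

Lemma Phibar_inv_fin t : 0 < t < 1 ->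
  exists2 z : R, Phibar_inv t = z%:E & Phibar z%:E = t.
Proof. by move=> /Phibar_surj[z <-]; exists z => //; exact: Phibar_inv_eq. Qed.

(** Concavity of [t |-> Phibar (Phibar_inv t - m)] without differentiating the inverse: the slope of
    a chord lies between the likelihood ratios [expR (m z - m^2 / 2)] at its ends. The mean value
    theorem is applied to [Phibar (z - m) - c Phibar z], with [c] the ratio at one end. *)
Lemma Phibar_shift_chord (m z1 z2 : R) : 0 <= m -> z1 <= z2 ->
  expR (m * z1 - m ^+ 2 / 2) * (Phibar z1%:E - Phibar z2%:E)
    <= Phibar (z1 - m)%:E - Phibar (z2 - m)%:E
    <= expR (m * z2 - m ^+ 2 / 2) * (Phibar z1%:E - Phibar z2%:E).
Proof.
move=> m0 z12.
have pdfE z : pdf (z - m) = expR (m * z - m ^+ 2 / 2) * pdf z.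
  rewrite normal_pdfE// mulrCA /normal_fun -expRD; congr (_ * expR _).
  by rewrite expr1n; field.
have key c : exists2 z, z1 <= z <= z2 &
    (Phibar (z2 - m)%:E - c * Phibar z2%:E) - (Phibar (z1 - m)%:E - c * Phibar z1%:E) =
    (c - expR (m * z - m ^+ 2 / 2)) * pdf z * (z2 - z1).
  have fd z : is_derive z (1 : R) (fun z => Phibar (z - m)%:E - c * Phibar z%:E)
      ((c - expR (m * z - m ^+ 2 / 2)) * pdf z).
    have sd : is_derive z (1 : R) (fun z : R => z - m) 1.
      by apply: is_derive_eq; rewrite subr0.
    have d1 := @is_derive1_comp _ (fun x : R => Phibar x%:E) (fun z => z - m) _ _ _
      (is_derive_Phibar (z - m)) sd.
    have d2 := is_deriveB d1 (is_deriveZ c (is_derive_Phibar z)).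
    apply: (is_derive_eq d2).
    by rewrite pdfE /GRing.scale/=; ring.
  exact: MVT_is_derive fd z12.
have z0 : 0 <= z2 - z1 by rewrite subr_ge0.
apply/andP; split.
  have [z /andP[z1z zz2] zE] := key (expR (m * z1 - m ^+ 2 / 2)).
  suff : (expR (m * z1 - m ^+ 2 / 2) - expR (m * z - m ^+ 2 / 2)) * pdf z * (z2 - z1) <= 0.
    by rewrite -zE; lra.
  rewrite mulr_le0_ge0// mulr_le0_ge0// ?normal_pdf_ge0// subr_le0 ler_expR.
  by rewrite lerD2r ler_wpM2l.
have [z /andP[z1z zz2] zE] := key (expR (m * z2 - m ^+ 2 / 2)).
suff : 0 <= (expR (m * z2 - m ^+ 2 / 2) - expR (m * z - m ^+ 2 / 2)) * pdf z * (z2 - z1).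
  by rewrite -zE; lra.
rewrite mulr_ge0// mulr_ge0// ?normal_pdf_ge0// subr_ge0 ler_expR.
by rewrite lerD2r ler_wpM2l.
Qed.

(** The lower chord bound with the right end sent to infinity, where both tails vanish: the chord
    from the origin is at least as steep as the ratio at [z]. *)
Lemma Phibar_shift_ge (m z : R) : 0 <= m ->
  expR (m * z - m ^+ 2 / 2) * Phibar z%:E <= Phibar (z - m)%:E.
Proof.
move=> m0; apply/ler_addgt0Pl => e e0; set E := expR _.
have E0 : 0 < E by exact: expR_gt0.
have [L L0 [hL _]] := Phibar_tail (divr_gt0 e0 E0).
have zL : z <= Num.max z L by rewrite le_max lexx.
have /andP[h _] := Phibar_shift_chord m0 zL; move: h; rewrite -/E => h.
have hm : Phibar (Num.max z L)%:E <= e / E.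
  by apply: le_trans hL; rewrite Phibar_le le_max lexx orbT.
have h2 : E * Phibar (Num.max z L)%:E <= e by rewrite mulrC -ler_pdivlMr.
have := Phibar_gt0 (Num.max z L - m); move: h; rewrite mulrBr; lra.
Qed.

End normal_distribution_function.

(** * The bivariate normal law *)

Section bivariate_normal.
Context (R : realType).
Local Notation nu := (normal_prob 0 1 : probability (measurableTypeR R) R).
Local Notation nu2 := (nu \x nu)%E.

Let one_neq0 : (1 : R) != 0. Proof. exact: oner_neq0. Qed.

Lemma mean_std_normal_cos (a b : R) :
  mean nu (fun x => cos (a * x + b)) = expR (- (a ^+ 2 / 2)) * cos b.
Proof. by rewrite mean_normal_cos// expr1n mul1r. Qed.

Let mlin2 (a b c : R) :
  measurable_fun setT (fun u : measurableTypeR R * measurableTypeR R => a * u.1 + b * u.2 + c).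
Proof.
by apply: measurable_funD => //; apply: measurable_funD; apply: measurable_funM.
Qed.

Lemma mean_normal2_cos (a b c : R) :
  mean nu2 (fun u => cos (a * u.1 + b * u.2 + c)) =
  expR (- ((a ^+ 2 + b ^+ 2) / 2)) * cos c.
Proof.
rewrite mean_prod; last by bounded.
rewrite (_ : (fun x => _) = (fun x : R => expR (- (b ^+ 2 / 2)) * cos (a * x + c))).
  rewrite meanZ ?mean_std_normal_cos.
    by rewrite mulrA -expRD; congr (expR _ * _); field.
  by apply: brv_cos; apply: measurable_funD => //; exact: measurable_funM.
apply/funext => x; rewrite -mean_std_normal_cos; congr mean; apply/funext => y /=.
by congr cos; ring.
Qed.

Variables (d : measure_display) (T : measurableType d) (P : probability T R).
Variables (X Y : T -> R) (rho : R).
Hypotheses (mX : measurable_fun setT X) (mY : measurable_fun setT Y).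
Hypothesis rho1 : rho ^+ 2 <= 1.
Hypothesis gauss : forall a b c : R,
  mean P (fun w => cos (a * X w + b * Y w + c)) =
  expR (- ((a ^+ 2 + 2 * a * b * rho + b ^+ 2) / 2)) * cos c.

(** The pair [(U, rho U + s V)] has the same means of cosines as [(X, Y)]. A zero coefficient
    identifies the marginals, which are standard normal and hence atomless even when [|rho| = 1]
    makes the pair degenerate; the uniqueness on quadrants applies. *)
Lemma prob_quadrant_gaussian (z : R) :
  prob P [set w | z <= X w /\ z <= Y w] =
  fine (bivariate_normal rho [set u | (z%:E <= u.1%:E)%E /\ (z%:E <= u.2%:E)%E]).
Proof.
pose s := Num.sqrt (1 - rho ^+ 2).
have s2 : s ^+ 2 = 1 - rho ^+ 2 by rewrite sqr_sqrtr// subr_ge0.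
pose Y2 (u : measurableTypeR R * measurableTypeR R) : R := rho * u.1 + s * u.2.
pose X2 (u : measurableTypeR R * measurableTypeR R) : R := u.1.
have mX2 : measurable_fun setT X2 by exact: measurable_fst.
have mY2 : measurable_fun setT Y2.
  have := mlin2 rho s 0; apply: eq_measurable_fun => u _.
  by rewrite /Y2 addr0.
have ch2 (a b c : R) : mean nu2 (fun u => cos (a * X2 u + b * Y2 u + c)) =
    expR (- ((a ^+ 2 + 2 * a * b * rho + b ^+ 2) / 2)) * cos c.
  rewrite (_ : (fun u => _) =
     (fun u : R * R => cos ((a + b * rho) * u.1 + (b * s) * u.2 + c))).
    rewrite mean_normal2_cos; congr (expR (- (_ / 2)) * _).
    by rewrite exprMn s2; ring.
  by apply/funext => u; rewrite /X2 /Y2; congr cos; ring.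
have laws d' (T' : measurableType d') (P' : probability T' R)
   (X' Y' : T' -> R) : measurable_fun setT X' -> measurable_fun setT Y' ->
   (forall a b c : R, mean P' (fun w => cos (a * X' w + b * Y' w + c)) =
     expR (- ((a ^+ 2 + 2 * a * b * rho + b ^+ 2) / 2)) * cos c) ->
   (forall B, measurable B -> P' (X' @^-1` B) = nu B) /\
   (forall B, measurable B -> P' (Y' @^-1` B) = nu B).
  move=> mX' mY' ch; split; apply: law_of_char => //.
  - by move=> x; exact: normal_prob_set1.
  - move=> a b; rewrite mean_std_normal_cos.
    rewrite (_ : (fun w => _) = (fun w => cos (a * X' w + 0 * Y' w + b))).
      by rewrite ch; congr (expR (- _) * _); ring.
    by apply/funext => w; rewrite mul0r addr0.
  - by move=> x; exact: normal_prob_set1.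
  - move=> a b; rewrite mean_std_normal_cos.
    rewrite (_ : (fun w => _) = (fun w => cos (0 * X' w + a * Y' w + b))).
      by rewrite ch; congr (expR (- _) * _); ring.
    by apply/funext => w; rewrite mul0r add0r.
have [lX lY] := laws _ _ _ _ _ mX mY gauss.
have [lX2 lY2] := laws _ _ _ _ _ mX2 mY2 ch2.
rewrite (prob_quadrant_unique mX mY mX2 mY2 lX lY lX2 lY2).
- by [].
- exact: normal_prob_set1.
- by move=> a b c; rewrite gauss ch2.
Qed.

End bivariate_normal.

(** * From mixing of events to covariances of bounded functions *)

Section covariance_inequality.
Context d (T : measurableType d) (R : realType) (P : probability T R).

(* Layer-cake discretisation: f is the average of the indicators of its level
   sets up to 1/n, which extends the mixing inequality from events to functions. *)
Lemma count_levels (n : nat) (y : R) : 0 <= y <= n%:R ->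
  `|y - \sum_(k < n) (k.+1%:R <= y)%R%:R| <= 1.
Proof.
elim: n => [|n IH] /andP[y0 yn].
  by rewrite big_ord0 subr0 ger0_norm// (le_trans yn).
rewrite big_ord_recr/=; have [yn'|ny] := leP y n%:R.
  have -> : (n.+1%:R <= y) = false.
    by apply/negbTE; rewrite -ltNge (le_lt_trans yn')// ltr_nat.
  by rewrite addr0; apply: IH; rewrite y0.
rewrite (eq_bigr (fun=> 1)); last first.
  move=> k _; suff -> : (k.+1%:R <= y) by [].
  by rewrite (le_trans _ (ltW ny))// ler_nat.
rewrite sumr_const card_ord; move: yn; rewrite -natr1 => yn.
by case: (n%:R + 1 <= y)%R => /=; rewrite ler_norml; lra.
Qed.

Definition layers (n : nat) (f : T -> R) (w : T) : R :=
  n%:R^-1 * \sum_(k < n) (k.+1%:R <= n%:R * f w)%R%:R.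

Lemma layers_close n f w : (0 < n)%N -> 0 <= f w <= 1 ->
  `|f w - layers n f w| <= n%:R^-1.
Proof.
move=> n0 /andP[f0 f1]; have nR : 0 < n%:R :> R by rewrite ltr0n.
have -> : f w - layers n f w =
    n%:R^-1 * (n%:R * f w - \sum_(k < n) (k.+1%:R <= n%:R * f w)%R%:R).
  by rewrite /layers mulrBr mulKf// gt_eqF.
have nV : 0 <= n%:R^-1 :> R by rewrite invr_ge0 ltW.
rewrite normrM (ger0_norm nV); apply: ler_piMr => //.
by apply: count_levels; rewrite mulr_ge0//= ler_piMr.
Qed.

Lemma layers01 n f w : (0 < n)%N -> 0 <= layers n f w <= 1.
Proof.
move=> n0; have nR : 0 < n%:R :> R by rewrite ltr0n.
have nV : 0 <= n%:R^-1 :> R by rewrite invr_ge0 ltW.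
rewrite /layers mulr_ge0 ?sumr_ge0//= ler_pdivrMl// mulr1.
by rewrite -natr_sum ler_nat -[leqRHS]card_ord -sum1_card leq_sum// => k _; exact: leq_b1.
Qed.

Section two_sigma_algebras.
Variables (G1 G2 : set (set T)) (al : R).
Hypotheses (mG1 : G1 `<=` measurable) (mG2 : G2 `<=` measurable).
Hypothesis mix : forall A1 A2, <<s G1 >> A1 -> <<s G2 >> A2 ->
  `|prob P (A1 `&` A2) - prob P A1 * prob P A2| <= al.

Lemma sub_sigma_measurable (G : set (set T)) : G `<=` measurable ->
  <<s G >> `<=` (measurable : set (set T)).
Proof. by move=> mG; apply: smallest_sub => //; exact: sigma_algebra_measurable. Qed.

Lemma sub_measurable_fun (G : set (set T)) (f : T -> R) : G `<=` measurable ->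
  measurable_fun setT (f : g_sigma_algebraType G -> R) -> measurable_fun setT f.
Proof.
move=> mG mf _ B mB; apply: (sub_sigma_measurable mG).
exact: (mf measurableT B mB).
Qed.

Let level_set (G : set (set T)) n k (f : T -> R) :
  measurable_fun setT (f : g_sigma_algebraType G -> R) ->
  <<s G >> [set w | k.+1%:R <= n%:R * f w].
Proof.
move=> mf; apply: (@measurable_set_le _ (g_sigma_algebraType G)) => //.
exact: measurable_funM.
Qed.

Let mean_layers (G : set (set T)) n (f : T -> R) : (0 < n)%N -> G `<=` measurable ->
  measurable_fun setT (f : g_sigma_algebraType G -> R) -> (forall w, 0 <= f w <= 1) ->
  [/\ bounded_rv f, bounded_rv (layers n f), `|mean P f - mean P (layers n f)| <= n%:R^-1 &
   mean P (layers n f) = n%:R^-1 * \sum_(k < n) prob P [set w | k.+1%:R <= n%:R * f w]].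
Proof.
move=> n0 mG mf f01.
have mA k : measurable [set w : T | k.+1%:R <= n%:R * f w].
  by apply: (sub_sigma_measurable mG); exact: level_set.
have bA k : bounded_rv (fun w => (k.+1%:R <= n%:R * f w)%R%:R : R) by exact: brv_natr.
have bf : bounded_rv f.
  split; first exact: sub_measurable_fun mf.
  by exists 1 => w; rewrite ger0_norm; have /andP[] := f01 w.
have bF : bounded_rv (layers n f) by apply: brvM; [exact: brv_cst|exact: brv_sum].
split => //; first by apply: mean_dist => // w; exact: layers_close.
rewrite meanZ ?mean_sum//; last exact: brv_sum.
by congr (_ * _); apply: eq_bigr => k _; rewrite mean_natr.
Qed.

(** The covariance of two layer sums is the average of [n^2] covariances of level sets, each at most
    [al]; replacing [f] and [g] by their layer sums costs [O(1 / n)]. *)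
Lemma cov_mixing01 (f g : T -> R) :
  measurable_fun setT (f : g_sigma_algebraType G1 -> R) ->
  measurable_fun setT (g : g_sigma_algebraType G2 -> R) ->
  (forall w, 0 <= f w <= 1) -> (forall w, 0 <= g w <= 1) ->
  `|mean P (fun w => f w * g w) - mean P f * mean P g| <= al.
Proof.
move=> mf mg f01 g01; apply/ler_addgt0Pl => e e0.
have [n n0 ne] : exists2 n, (0 < n)%N & n%:R^-1 <= e / 4.
  have e4 : 0 < e / 4 by rewrite divr_gt0.
  have [n ne] := ltr_add_invr e4; exists n.+1 => //.
  by rewrite add0r in ne; exact: ltW.
have nR : 0 < n%:R :> R by rewrite ltr0n.
pose A k := [set w | k.+1%:R <= n%:R * f w].
pose B k := [set w | k.+1%:R <= n%:R * g w].
have sA k : <<s G1 >> (A k) by exact: level_set.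
have sB k : <<s G2 >> (B k) by exact: level_set.
have mA k : measurable (A k) by exact: (sub_sigma_measurable mG1).
have mB k : measurable (B k) by exact: (sub_sigma_measurable mG2).
pose F := layers n f; pose H := layers n g.
have [bf bF nF meanF] := mean_layers n0 mG1 mf f01.
have [bg bH nH meanH] := mean_layers n0 mG2 mg g01.
have meanFH : mean P (fun w => F w * H w) =
    n%:R^-1 ^+ 2 * \sum_(k < n) \sum_(l < n) prob P (A k `&` B l).
  have bAB k l : bounded_rv (\1_(A k `&` B l) : T -> R).
    by apply: brv_indic; exact: measurableI.
  rewrite (_ : (fun w => _) = (fun w => n%:R^-1 ^+ 2 *
     \sum_(k < n) \sum_(l < n) \1_(A k `&` B l) w)).
    rewrite meanZ; last by apply: brv_sum => k _; apply: brv_sum => l _.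
    rewrite mean_sum; last by move=> k _; apply: brv_sum => l _.
    congr (_ * _); apply: eq_bigr => k _; rewrite mean_sum//.
    by apply: eq_bigr => l _; rewrite mean_indic//; exact: measurableI.
  apply/funext => w; rewrite /F /H /layers mulrACA -expr2; congr (_ * _).
  rewrite mulr_suml; apply: eq_bigr => k _; rewrite mulr_sumr; apply: eq_bigr => l _.
  rewrite -natrM mulnb indicE; congr ((_ : bool)%:R).
  by apply/idP/idP; rewrite inE => /andP.
have covFH : `|mean P (fun w => F w * H w) - mean P F * mean P H| <= al.
  rewrite meanFH meanF meanH mulrACA -expr2 -mulrBr mulr_suml -sumrB.
  have nV : 0 <= n%:R^-1 ^+ 2 :> R by exact: sqr_ge0.
  rewrite normrM (ger0_norm nV).
  rewrite exprVn ler_pdivrMl ?exprn_gt0//.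
  apply: (le_trans (ler_norm_sum _ _ _)).
  apply: (@le_trans _ _ (\sum_(k < n) \sum_(l < n) al)); last first.
    by rewrite !sumr_const !card_ord -mulrnA -[leLHS]mulr_natl natrM expr2.
  apply: ler_sum => k _; rewrite mulr_sumr -sumrB.
  by apply: (le_trans (ler_norm_sum _ _ _)); apply: ler_sum => l _; exact: mix.
have clF : `|mean P f - mean P F| <= e / 4 := le_trans nF ne.
have clH : `|mean P g - mean P H| <= e / 4 := le_trans nH ne.
have clFH : `|mean P (fun w => f w * g w) - mean P (fun w => F w * H w)| <= e / 2.
  apply: mean_dist; [exact: brvM|exact: brvM|move=> w].
  apply: (le_trans (@dist_mul01 R (f w) (g w) (F w) (H w) (f01 w) (layers01 g w n0))).
  have := le_trans (layers_close n0 (f01 w)) ne.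
  have := le_trans (layers_close n0 (g01 w)) ne; rewrite -/F -/H; lra.
have mean01 h : bounded_rv h -> (forall w, 0 <= h w <= 1) -> 0 <= mean P h <= 1.
  move=> bh h01; rewrite mean_ge0/=; last by move=> w; have /andP[] := h01 w.
  rewrite -[leRHS](mean_cst P); apply: mean_le => //; first exact: brv_cst.
  by move=> w; have /andP[] := h01 w.
have clP : `|mean P f * mean P g - mean P F * mean P H| <= e / 2.
  have := @dist_mul01 R (mean P f) (mean P g) (mean P F) (mean P H)
    (mean01 _ bf f01) (mean01 _ bH (fun w => layers01 g w n0)).
  by move=> /le_trans; apply; move: clF clH; lra.
move: covFH clFH clP.
by rewrite !ler_norml; lra.
Qed.

(** The map [x |-> (x + 1) / 2] sends [-1, 1] to [0, 1] and divides covariances by 4. *)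
Lemma cov_mixing (f g : T -> R) :
  measurable_fun setT (f : g_sigma_algebraType G1 -> R) ->
  measurable_fun setT (g : g_sigma_algebraType G2 -> R) ->
  (forall w, `|f w| <= 1) -> (forall w, `|g w| <= 1) ->
  `|mean P (fun w => f w * g w) - mean P f * mean P g| <= 4 * al.
Proof.
move=> mf mg f1 g1.
pose f' w := (f w + 1) * 2^-1; pose g' w := (g w + 1) * 2^-1.
have half01 (x : R) : `|x| <= 1 -> 0 <= (x + 1) * 2^-1 <= 1.
  by rewrite ler_norml; lra.
have bf : bounded_rv f by split; [exact: sub_measurable_fun mf|exists 1].
have bg : bounded_rv g by split; [exact: sub_measurable_fun mg|exists 1].
have := @cov_mixing01 f' g' _ _ (fun w => half01 _ (f1 w)) (fun w => half01 _ (g1 w)).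
have mf' : measurable_fun setT (f' : g_sigma_algebraType G1 -> R).
  by apply: measurable_funM => //; exact: measurable_funD.
have mg' : measurable_fun setT (g' : g_sigma_algebraType G2 -> R).
  by apply: measurable_funM => //; exact: measurable_funD.
move=> /(_ mf' mg').
have bc c h : bounded_rv h -> bounded_rv (fun w => c * h w : R).
  by move=> ?; apply: brvM => //; exact: brv_cst.
have half h : bounded_rv h -> mean P (fun w => (h w + 1) * 2^-1) = 2^-1 * mean P h + 2^-1.
  move=> bh; rewrite -meanZ// -[X in _ + X](mean_cst P) -meanD; [|exact: bc|exact: brv_cst].
  by congr mean; apply/funext => w; ring.
rewrite (half f)// (half g)//.
have -> : mean P (fun w => f' w * g' w) = 4^-1 * mean P (fun w => f w * g w) +
    (4^-1 * mean P f + (4^-1 * mean P g + 4^-1)).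
  have bfg := brvM bf bg.
  rewrite -!meanZ// -[X in _ + (_ + (_ + X))](mean_cst P) -!meanD//; last first.
  all: try by do ?[apply: brvD | apply: bc | exact: brv_cst].
  by congr mean; apply/funext => w; rewrite /f' /g'; field.
set u := mean P _; set v := mean P f; set z := mean P g.
rewrite !ler_norml; lra.
Qed.

End two_sigma_algebras.
End covariance_inequality.

(** * Characteristic function of a mixing sum by big blocks and gaps *)

Section blocks.
Context d (T : measurableType d) (R : realType) (P : probability T R) (m : nat).
Variables (X : 'I_m -> T -> R) (GP GF : nat -> set (set T)) (al : nat -> R) (C : R).
Hypotheses (mGP : forall n, GP n `<=` measurable) (mGF : forall n, GF n `<=` measurable).
Hypothesis XP : forall n (i : 'I_m), (i < n)%N ->
  measurable_fun setT (X i : g_sigma_algebraType (GP n) -> R).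
Hypothesis XF : forall n (i : 'I_m), (n <= i)%N ->
  measurable_fun setT (X i : g_sigma_algebraType (GF n) -> R).
(** [GP n] carries the indices below [n] and [GF (n + k)] those from [n + k] on: the nearest two
    differ by [k + 1], hence [al k.+1]. *)
Hypothesis mix : forall n k A1 A2, (0 < n)%N -> <<s GP n >> A1 -> <<s GF (n + k) >> A2 ->
  `|prob P (A1 `&` A2) - prob P A1 * prob P A2| <= al k.+1.
Hypotheses (X1 : forall i w, `|X i w| <= 1) (X0 : forall i, mean P (X i) = 0).
Hypothesis XC : forall i, \sum_j `|mean P (fun w => X i w * X j w)| <= C.
Hypothesis m0 : (0 < m)%N.

Let bX i : bounded_rv (X i).
Proof.
split; last by exists 1.
by apply: (sub_measurable_fun (@mGP i.+1)); exact: XP.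
Qed.

Let C0 : 0 <= C.
Proof. by apply: le_trans (XC (Ordinal m0)); apply: sumr_ge0. Qed.

Let mR : 0 < m%:R :> R. Proof. by rewrite ltr0n. Qed.

(** Each row of the covariance matrix sums to at most [C] in absolute value. As [D] is arbitrary,
    the bound serves for a block, for the union of the gaps and for the whole sum. *)
Lemma mean_sqr_sum_le (D : pred 'I_m) (n : nat) : (#|D| <= n)%N ->
  mean P (fun w => (\sum_(i | D i) X i w) ^+ 2) <= n%:R * C.
Proof.
move=> Dn; rewrite (_ : (fun w => _) =
   (fun w => \sum_(i | D i) \sum_(j | D j) X i w * X j w)); last first.
  apply/funext => w; rewrite expr2 mulr_suml; apply: eq_bigr => i _.
  by rewrite mulr_sumr.
have bXX i j : bounded_rv (fun w => X i w * X j w) by exact: brvM.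
rewrite mean_sum; last by move=> i _; exact: brv_sum.
apply: (@le_trans _ _ (\sum_(i | D i) C)); last first.
  by rewrite sumr_const -[leLHS]mulr_natl ler_wpM2r// ler_nat.
apply: ler_sum => i _; rewrite mean_sum//.
apply: (le_trans (ler_norm _)); apply: (le_trans (ler_norm_sum _ _ _)).
apply: le_trans (XC i); rewrite [leRHS](bigID D)/= lerDl.
exact: sumr_ge0.
Qed.

Variables p g : nat.
Hypothesis p0 : (0 < p)%N.
Local Notation L := (p + g)%N.

(** The quotient by [L] numbers the period of an index; remainders below [p] form the block, the
    other [g] remainders the gap after it. *)
Let blk k (i : 'I_m) := (i %/ L == k)%N && (i %% L < p)%N.
Let upto k (i : 'I_m) := (i %/ L < k)%N && (i %% L < p)%N.
Let B k w := \sum_(i | blk k i) X i w.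
Let S k w := \sum_(i | upto k i) X i w.

Let L0 : (0 < L)%N. Proof. by rewrite addn_gt0 p0. Qed.

Let SS k w : S k.+1 w = S k w + B k w.
Proof.
rewrite /S (bigID (fun i : 'I_m => i %/ L == k)%N)/= addrC; congr (_ + _);
  apply: eq_bigl => i; rewrite /upto /blk ltnS.
  by rewrite andbAC [in RHS]ltn_neqAle; congr (_ && _); exact: andbC.
by rewrite andbAC; congr (_ && _); case: eqP => [->|]; rewrite ?leqnn ?andbF.
Qed.

Let S0 w : S 0 w = 0.
Proof. by rewrite /S big1// => i; rewrite /upto ltn0. Qed.

Let card_blk k : (#|[pred i | blk k i]| <= p)%N.
Proof.
rewrite cardE -(size_map (fun i : 'I_m => i %% L)%N) -[leqRHS](size_iota 0).
apply: uniq_leq_size.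
  rewrite map_inj_in_uniq ?enum_uniq// => i j; rewrite !mem_enum !inE.
  move=> /andP[/eqP ik _] /andP[/eqP jk _] ij; apply: ord_inj.
  by rewrite (divn_eq i L) (divn_eq j L) ik jk ij.
move=> _ /mapP[i + ->]; rewrite mem_enum inE mem_iota => /andP[_].
by rewrite leq0n add0n.
Qed.

Let card_gap : (#|[pred i : 'I_m | (p <= i %% L)%N]| <= (m %/ L).+1 * g)%N.
Proof.
rewrite cardE -(size_map (fun i : 'I_m => (i %/ L, i %% L)%N)).
rewrite -[X in (_ <= X * g)%N](size_iota 0) -[X in (_ <= _ * X)%N](size_iota p).
rewrite -(size_allpairs pair); apply: uniq_leq_size.
  rewrite map_inj_uniq ?enum_uniq// => i j [ij1 ij2]; apply: ord_inj.
  by rewrite (divn_eq i L) (divn_eq j L) ij1 ij2.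
move=> _ /mapP[i + ->]; rewrite mem_enum inE => pi.
apply: allpairs_f; rewrite mem_iota.
  by rewrite leq0n add0n ltnS leq_div2r// ltnW.
by rewrite pi/= ltn_pmod.
Qed.

Let bB k : bounded_rv (B k). Proof. exact: brv_sum. Qed.
Let bS k : bounded_rv (S k). Proof. exact: brv_sum. Qed.

Let norm_sum_le (D : pred 'I_m) n w : (#|D| <= n)%N -> `|\sum_(i | D i) X i w| <= n%:R.
Proof.
move=> Dn; apply: (le_trans (ler_norm_sum _ _ _)).
apply: (@le_trans _ _ (\sum_(i | D i) 1)); first exact: ler_sum.
by rewrite sumr_const ler_nat.
Qed.

Let B_le k w : `|B k w| <= p%:R. Proof. exact: norm_sum_le (card_blk k). Qed.

Let S_le k w : `|S k w| <= m%:R.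
Proof. by apply: norm_sum_le; rewrite -[leqRHS]card_ord max_card. Qed.

Let V k := mean P (fun w => B k w ^+ 2).

Let V0 k : 0 <= V k. Proof. by apply: mean_ge0 => w; exact: sqr_ge0. Qed.

Let V_le k : V k <= p%:R * C. Proof. exact: mean_sqr_sum_le (card_blk k). Qed.

Let meanB0 k : mean P (B k) = 0.
Proof. by rewrite mean_sum// big1. Qed.

Let al0 k : 0 <= al k.+1.
Proof.
have s0 G : <<s G >> (set0 : set T) by exact: (@measurable0 _ (g_sigma_algebraType G)).
by apply: le_trans (@mix 1 k set0 set0 isT _ _) => //.
Qed.

(* The blocks S k and B k are separated by a gap of g indices. *)
Let cov_block k (f h : R -> R) : continuous f -> continuous h ->
  (forall w, `|f (S k w)| <= 1) -> (forall w, `|h (B k w)| <= 1) ->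
  `|mean P (fun w => f (S k w) * h (B k w)) -
    mean P (fun w => f (S k w)) * mean P (fun w => h (B k w))| <= 4 * al g.+1.
Proof.
move=> cf ch f1 h1.
have mf : measurable_fun setT f by exact: continuous_measurable_fun.
have mh : measurable_fun setT h by exact: continuous_measurable_fun.
have bh : bounded_rv (fun w => h (B k w)).
  split; last by exists 1.
  by apply: measurableT_comp => //; have [] := bB k.
(* Before the first block the partial sum is the constant 0 and there is nothing to decouple; the
   mixing bound requires a nonempty past. *)
case: k f1 h1 bh => [|k] f1 h1 bh.
  have -> : (fun w => f (S 0 w) * h (B 0 w)) = (fun w => f 0 * h (B 0 w)).
    by apply/funext => w; rewrite S0.
  have -> : (fun w => f (S 0 w)) = (fun w => f 0).
    by apply/funext => w; rewrite S0.
  by rewrite meanZ// mean_cst subrr normr0 mulr_ge0.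
(* The first index after block [k]; block [k.+1] starts at [n + g]. *)
pose n := (k * L + p)%N.
apply: (@cov_mixing _ _ _ P (GP n) (GF (n + g))) => //.
- by move=> A1 A2; apply: mix; rewrite addn_gt0 p0 orbT.
- apply: measurableT_comp => //.
  have [] : bounded_rv (S k.+1 : g_sigma_algebraType (GP n) -> R) => //.
  apply: brv_sum => i /andP[ik ip]; split; last by exists 1.
  apply: XP; rewrite (divn_eq i L) /n -addnS leq_add// leq_mul2r.
  by rewrite -ltnS ik orbT.
- apply: measurableT_comp => //.
  have [] : bounded_rv (B k.+1 : g_sigma_algebraType (GF (n + g)) -> R) => //.
  apply: brv_sum => i /andP[/eqP ik ip]; split; last by exists 1.
  by apply: XF; rewrite [leqRHS](divn_eq i L) ik /n mulSn -addnA addnC leq_addr.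
Qed.

(** Decoupling applied to linear functions, scaled by [m] and [p] so that both are bounded by 1; the
    block has mean 0. *)
Let cov_SB k : `|mean P (fun w => S k w * B k w)| <= 4 * al g.+1 * (m%:R * p%:R).
Proof.
have pR : 0 < p%:R :> R by rewrite ltr0n.
have c1 (c : R) : continuous (fun x : R => c * x) by exact: mulrl_continuous.
have b1 (c x : R) : 0 < c -> `|x| <= c -> `|c^-1 * x| <= 1.
  by move=> c0 xc; rewrite normrM normfV (gtr0_norm c0) ler_pdivrMl// mulr1.
have := @cov_block k _ _ (c1 m%:R^-1) (c1 p%:R^-1)
  (fun w => b1 _ _ mR (S_le k w)) (fun w => b1 _ _ pR (B_le k w)).
rewrite [mean P (fun w => _ * B k w)]meanZ// meanB0 mulr0 mulr0 subr0.
rewrite (_ : (fun w => _) = (fun w => (m%:R * p%:R)^-1 * (S k w * B k w))); last first.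
  by apply/funext => w; rewrite mulrACA -invfM.
rewrite meanZ; last exact: brvM.
have mp0 : 0 < m%:R * p%:R :> R by exact: mulr_gt0.
by rewrite normrM normfV (gtr0_norm mp0) ler_pdivrMl// mulrC.
Qed.

Section step.
Variables (c : R).

(** The cost of peeling off one block: twice [4 * al g.+1] for decoupling a cosine and a sine
    product, then the remainders of the block's cosine (order 4), of its sine (order 3) and of
    [expR] (order 2). In each, [p%:R * C] bounds the variance of a block, and the separate powers of
    [p%:R] bound the block itself. *)
Definition block_error : R :=
  8 * al g.+1 + c ^+ 4 * p%:R ^+ 2 * (p%:R * C) + `|c| ^+ 3 * p%:R * (p%:R * C) +
  (c ^+ 2 * (p%:R * C)) ^+ 2.

Let bcosS k th : bounded_rv (fun w => cos (c * S k w + th)).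
Proof.
apply: brv_cos; apply: measurable_funD => //; apply: measurable_funM => //.
by have [] := bS k.
Qed.

Let bsinS k th : bounded_rv (fun w => sin (c * S k w + th)).
Proof.
apply: brv_sin; apply: measurable_funD => //; apply: measurable_funM => //.
by have [] := bS k.
Qed.

Let mcB k : measurable_fun setT (fun w => c * B k w).
Proof. by apply: measurable_funM => //; have [] := bB k. Qed.

Let bB2 k : bounded_rv (fun w => B k w ^+ 2). Proof. exact: brvX. Qed.

Let cosB_mean k : `|mean P (fun w => cos (c * B k w)) - expR (- (c ^+ 2 * V k / 2))| <=
  c ^+ 4 * p%:R ^+ 2 * (p%:R * C) + (c ^+ 2 * (p%:R * C)) ^+ 2.
Proof.
have x0 : 0 <= c ^+ 2 * V k / 2 by rewrite divr_ge0// mulr_ge0// sqr_ge0.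
have h1 : `|mean P (fun w => cos (c * B k w)) - (1 - c ^+ 2 * V k / 2)| <=
    c ^+ 4 * p%:R ^+ 2 * (p%:R * C).
  have -> : 1 - c ^+ 2 * V k / 2 = mean P (fun w => 1 - (c ^+ 2 / 2) * B k w ^+ 2).
    rewrite meanB; [|exact: brv_cst|by apply: brvM => //; exact: brv_cst].
    by rewrite mean_cst meanZ// -/(V k); congr (_ - _); ring.
  have bq : bounded_rv (fun w => 1 - (c ^+ 2 / 2) * B k w ^+ 2).
    by bounded.
  rewrite -meanB//; last exact: brv_cos.
  apply: (le_trans (mean_normr _ _)); first by bounded.
  apply: (@le_trans _ _ (c ^+ 4 * p%:R ^+ 2 * V k)); last first.
    apply: ler_wpM2l; last exact: V_le.
    by rewrite mulr_ge0 ?sqr_ge0// exprn_even_ge0.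
  rewrite /V -meanZ//; apply: mean_le => [||w].
  - by bounded.
  - by bounded.
  have := cos_taylor (c * B k w); rewrite exprMn mulrAC => /le_trans; apply.
  rewrite exprMn -mulrA ler_wpM2l ?exprn_even_ge0//.
  rewrite -[4%N]/(2 + 2)%N exprD ler_wpM2r ?sqr_ge0//.
  by rewrite -real_normK ?num_real// ler_pXn2r// nnegrE.
have h2 := expRN_taylor x0.
have h3 : (c ^+ 2 * V k / 2) ^+ 2 <= (c ^+ 2 * (p%:R * C)) ^+ 2.
  have e1 : 0 <= c ^+ 2 * (p%:R * C).
    by apply: mulr_ge0; [exact: sqr_ge0|exact: mulr_ge0].
  rewrite ler_pXn2r ?nnegrE//.
  rewrite -[leLHS]mulrA ler_wpM2l ?sqr_ge0//; have := V_le k; have := V0 k; lra.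
have -> : mean P (fun w => cos (c * B k w)) - expR (- (c ^+ 2 * V k / 2)) =
  (mean P (fun w => cos (c * B k w)) - (1 - c ^+ 2 * V k / 2)) -
  (expR (- (c ^+ 2 * V k / 2)) - (1 - c ^+ 2 * V k / 2)) by ring.
rewrite (le_trans (ler_normB _ _))// lerD//.
exact: le_trans h2 h3.
Qed.

(** A block has mean 0, so [sin x] may be replaced by [sin x - x], which is of third order. *)
Let sinB_mean k : `|mean P (fun w => sin (c * B k w))| <= `|c| ^+ 3 * p%:R * (p%:R * C).
Proof.
have bcB : bounded_rv (fun w => c * B k w) by bounded.
have -> : mean P (fun w => sin (c * B k w)) = mean P (fun w => sin (c * B k w) - c * B k w).
  rewrite meanB//; last exact: brv_sin.
  by rewrite meanZ// meanB0 mulr0 subr0.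
apply: (le_trans (mean_normr _ _)); first by bounded.
apply: (@le_trans _ _ (`|c| ^+ 3 * p%:R * V k)); last first.
  by apply: ler_wpM2l; [rewrite mulr_ge0// exprn_ge0|exact: V_le].
rewrite /V -meanZ//; apply: mean_le => [||w].
- by bounded.
- by bounded.
apply: (le_trans (sin_taylor _)); rewrite normrM exprMn -[leRHS]mulrA.
apply: ler_wpM2l; first exact: exprn_ge0.
rewrite -[B k w ^+ 2]real_normK ?num_real// exprS.
by apply: ler_wpM2r; [exact: sqr_ge0|exact: B_le].
Qed.

Let clin th : continuous (fun x : R => c * x + th).
Proof.
by move=> x; apply: cvgD; [exact: mulrl_continuous|exact: cvg_cst].
Qed.

(** The addition formula splits the cosine of [S k + B k] into two products, each factorised by
    mixing; the product of sines is negligible and the block's cosine is close to a Gaussian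
    factor. *)
Let char_step k th : `|mean P (fun w => cos (c * S k.+1 w + th)) -
  expR (- (c ^+ 2 * V k / 2)) * mean P (fun w => cos (c * S k w + th))| <= block_error.
Proof.
have ccos (th' : R) : continuous (fun x => cos (c * x + th')).
  move=> x; apply: (@continuous_comp _ _ _ (fun x => c * x + th') cos).
    exact: clin.
  exact: continuous_cos.
have csin (th' : R) : continuous (fun x => sin (c * x + th')).
  move=> x; apply: (@continuous_comp _ _ _ (fun x => c * x + th') sin).
    exact: clin.
  exact: continuous_sin.
have covc := @cov_block k _ _ (ccos th) (ccos 0) (fun w => cos_max _) (fun w => cos_max _).
have covs := @cov_block k _ _ (csin th) (csin 0) (fun w => sin_max _) (fun w => sin_max _).
have e0 f : (fun w : T => f (c * B k w + 0)) = (fun w => f (c * B k w)) :> (T -> R).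
  by apply/funext => w; rewrite addr0.
have e0' h f : (fun w : T => h w * f (c * B k w + 0)) = (fun w => h w * f (c * B k w)) :> (T -> R).
  by apply/funext => w; rewrite addr0.
rewrite !e0 !e0' in covc covs.
have -> : mean P (fun w => cos (c * S k.+1 w + th)) =
    mean P (fun w => cos (c * S k w + th) * cos (c * B k w)) -
    mean P (fun w => sin (c * S k w + th) * sin (c * B k w)).
  rewrite -meanB; [|by apply: brvM => //; exact: brv_cos|by apply: brvM => //; exact: brv_sin].
  congr mean; apply/funext => w; rewrite SS -cosD; congr cos; ring.
have hc := cosB_mean k; have hs := sinB_mean k.
have u1 : `|mean P (fun w => cos (c * S k w + th))| <= 1.
  by apply: mean_bound => // w; exact: cos_max.
have v1 : `|mean P (fun w => sin (c * S k w + th))| <= 1.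
  by apply: mean_bound => // w; exact: sin_max.
rewrite /block_error; move: covc covs hc hs u1 v1.
set cc := mean P (fun w => _ * cos _); set ss := mean P (fun w => _ * sin _).
set u := mean P (fun w => cos (_ + _)); set v := mean P (fun w => sin (_ + _)).
set cb := mean P (fun w => cos (c * B k w)); set sb := mean P (fun w => sin (c * B k w)).
set E := expR _ => covc covs hc hs u1 v1.
have -> : cc - ss - E * u = (cc - u * cb) - (ss - v * sb) + (u * (cb - E) - v * sb) by ring.
apply: (le_trans (ler_normD _ _)).
have -> : forall a b c' : R, 8 * al g.+1 + a + b + c' =
  (4 * al g.+1 + 4 * al g.+1) + ((a + c') + b) by move=> *; ring.
rewrite lerD//; first by rewrite (le_trans (ler_normB _ _))// lerD.
rewrite (le_trans (ler_normB _ _))// lerD//.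
  by rewrite normrM (le_trans _ hc)// ler_piMl.
by rewrite normrM (le_trans _ hs)// ler_piMl.
Qed.

(** Each Gaussian factor is at most 1, so earlier errors are not amplified and the total is linear
    in [K]. *)
Lemma char_blocks K th : `|mean P (fun w => cos (c * S K w + th)) -
  expR (- (c ^+ 2 * (\sum_(k < K) V k) / 2)) * cos th| <= K%:R * block_error.
Proof.
elim: K => [|K IH].
  rewrite big_ord0 mulr0 mul0r oppr0 expR0 !mul1r mul0r.
  rewrite (_ : (fun w => _) = (fun=> cos th)) ?mean_cst ?subrr ?normr0//.
  by apply/funext => w; rewrite S0 mulr0 add0r.
rewrite big_ord_recr/= mulrDr mulrDl opprD expRD.
have := char_step K th; move: IH.
set u := mean P _; set u' := mean P (fun w => cos (c * S K.+1 w + th)).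
set E := expR _; set E' := expR (- (c ^+ 2 * V K / 2)) => IH st.
have -> : u' - E * E' * cos th = (u' - E' * u) + E' * (u - E * cos th) by ring.
rewrite (le_trans (ler_normD _ _))// -natr1 mulrDl mul1r addrC lerD//.
rewrite normrM (le_trans _ IH)// ler_piMl// ger0_norm ?expR_ge0//.
by rewrite -expR0 ler_expR oppr_le0 divr_ge0// mulr_ge0// sqr_ge0.
Qed.

End step.

Let K := (m %/ L).+1.
Let W w := \sum_i X i w.
Let Dl w := \sum_(i : 'I_m | (p <= i %% L)%N) X i w.

Let W_decomp w : W w = S K w + Dl w.
Proof.
rewrite /W (bigID (fun i : 'I_m => i %% L < p)%N)/=; congr (_ + _); apply: eq_bigl => i.
  by rewrite /upto ltnS leq_div2r// ltnW.
by rewrite -leqNgt.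
Qed.

Let bW : bounded_rv W. Proof. exact: brv_sum. Qed.
Let bD : bounded_rv Dl. Proof. exact: brv_sum. Qed.

Let meanD2 : mean P (fun w => Dl w ^+ 2) <= (K * g)%:R * C.
Proof. exact: mean_sqr_sum_le card_gap. Qed.

Let meanS2 k : `|mean P (fun w => S k w ^+ 2) - \sum_(j < k) V j| <=
  k%:R * (8 * al g.+1 * (m%:R * p%:R)).
Proof.
elim: k => [|k IH].
  rewrite big_ord0 mul0r (_ : (fun w => _) = (fun=> 0)) ?mean_cst ?subrr ?normr0//.
  by apply/funext => w; rewrite S0 expr0n.
have -> : mean P (fun w => S k.+1 w ^+ 2) = mean P (fun w => S k w ^+ 2) +
   2 * mean P (fun w => S k w * B k w) + V k.
  have b1 : bounded_rv (fun w => S k w * B k w) by exact: brvM.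
  have b2 := brvX 2 (bS k); have b3 := brvX 2 (bB k).
  have b4 : bounded_rv (fun w => 2 * (S k w * B k w)).
    by bounded.
  rewrite -meanZ// -!meanD//; last exact: brvD.
  by congr mean; apply/funext => w; rewrite SS; ring.
rewrite big_ord_recr/=.
rewrite -[k.+1%:R]natr1 [(k%:R + 1) * _]mulrDl [1 * _]mul1r.
set u := mean P _; set v := mean P _; set s := \sum_(_ < _) _.
have -> : u + 2 * v + V k - (s + V k) = (u - s) + 2 * v by ring.
rewrite (le_trans (ler_normD _ _))// lerD//.
have := cov_SB k; rewrite -/v normrM ger0_norm//; lra.
Qed.

Let meanW2 : mean P (fun w => W w ^+ 2) <= m%:R * C.
Proof. by apply: mean_sqr_sum_le; rewrite -[leqRHS]card_ord max_card. Qed.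

Let meanS2_le : mean P (fun w => S K w ^+ 2) <= m%:R * C.
Proof. by apply: mean_sqr_sum_le; rewrite -[leqRHS]card_ord max_card. Qed.

(** Cauchy-Schwarz on [W^2 - S^2 = Dl (W + S)]: the factor [Dl] collects only gap indices, at most
    [K * g] of them. *)
Let meanW2S2 : `|mean P (fun w => W w ^+ 2) - mean P (fun w => S K w ^+ 2)| <=
  Num.sqrt ((K * g)%:R * C * (4 * (m%:R * C))).
Proof.
have bWS : bounded_rv (fun w => W w + S K w) by exact: brvD.
have -> : mean P (fun w => W w ^+ 2) - mean P (fun w => S K w ^+ 2) =
    mean P (fun w => Dl w * (W w + S K w)).
  rewrite -meanB; [|exact: brvX|exact: brvX].
  by congr mean; apply/funext => w; rewrite W_decomp; ring.
rewrite -ler_sqr ?nnegrE ?sqrtr_ge0// real_normK ?num_real//.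
rewrite sqr_sqrtr; last by rewrite !mulr_ge0.
apply: (le_trans (mean_mul_sqr _ bD bWS)).
apply: ler_pM => //; try by apply: mean_ge0 => w; exact: sqr_ge0.
have b1 := brvX 2 bW; have b2 := brvX 2 (bS K).
apply: (@le_trans _ _ (mean P (fun w => 2 * W w ^+ 2 + 2 * S K w ^+ 2))).
  apply: mean_le => [||w]; first exact: brvX.
    by bounded.
  by have := sqr_ge0 (W w - S K w); rewrite sqrrB sqrrD; lra.
rewrite meanD ?meanZ//; try by bounded.
by move: meanW2 meanS2_le; lra.
Qed.

(** Three errors, in the order of the right-hand side: the block recursion; dropping the gaps inside
    the cosine, which is Lipschitz; and replacing the sum of block variances by the variance of [W],
    where [expR] is Lipschitz on the negative axis. *)
Lemma char_mixing_bound (t th : R) :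
  `|mean P (fun w => cos (t * ((Num.sqrt m%:R)^-1 * W w) + th)) -
    expR (- (t ^+ 2 * (mean P (fun w => W w ^+ 2) / m%:R) / 2)) * cos th| <=
  K%:R * block_error (t / Num.sqrt m%:R) +
  `|t / Num.sqrt m%:R| * Num.sqrt ((K * g)%:R * C) +
  t ^+ 2 / m%:R * (Num.sqrt ((K * g)%:R * C * (4 * (m%:R * C))) +
    K%:R * (8 * al g.+1 * (m%:R * p%:R))).
Proof.
set c := t / Num.sqrt m%:R.
have c2 : c ^+ 2 = t ^+ 2 / m%:R by rewrite exprMn exprVn sqr_sqrtr// ltW.
have -> : (fun w => cos (t * ((Num.sqrt m%:R)^-1 * W w) + th)) =
   (fun w => cos (c * W w + th)) by apply/funext => w; rewrite mulrA.
have bc Y : bounded_rv Y -> bounded_rv (fun w => cos (c * Y w + th)).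
  move=> [mY _]; apply: brv_cos; apply: measurable_funD => //; exact: measurable_funM.
have h1 : `|mean P (fun w => cos (c * W w + th)) - mean P (fun w => cos (c * S K w + th))|
    <= `|c| * Num.sqrt ((K * g)%:R * C).
  rewrite -meanB; [|exact: bc|exact: bc].
  apply: (le_trans (mean_normr _ _)); first by bounded.
  apply: (@le_trans _ _ (mean P (fun w => `|c| * `|Dl w|))).
    apply: mean_le => [||w]; first by bounded.
      by bounded.
    rewrite (le_trans (lipschitz_cos _ _))// -normrM W_decomp.
    by rewrite (_ : _ - _ = c * Dl w)//; ring.
  rewrite meanZ; last exact: brv_norm.
  apply: ler_wpM2l => //; rewrite -ler_sqr ?nnegrE ?sqrtr_ge0//; last exact: mean_ge0.
  rewrite sqr_sqrtr; last by rewrite mulr_ge0.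
  exact: le_trans (mean_norm_sqr _ bD) meanD2.
have h2 := char_blocks c K th.
pose sV := \sum_(k < K) V k.
have sV0 : 0 <= sV by apply: sumr_ge0.
have h3 : `|expR (- (c ^+ 2 * sV / 2)) -
    expR (- (t ^+ 2 * (mean P (fun w => W w ^+ 2) / m%:R) / 2))| <=
  t ^+ 2 / m%:R * (Num.sqrt ((K * g)%:R * C * (4 * (m%:R * C))) +
    K%:R * (8 * al g.+1 * (m%:R * p%:R))).
  have mW0 : 0 <= mean P (fun w => W w ^+ 2) by apply: mean_ge0 => w; exact: sqr_ge0.
  apply: (le_trans (expRN_lipschitz _ _)).
  - by rewrite divr_ge0// mulr_ge0// sqr_ge0.
  - by rewrite divr_ge0// mulr_ge0 ?sqr_ge0// divr_ge0// ltW.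
  rewrite c2.
  have -> : t ^+ 2 / m%:R * sV / 2 - t ^+ 2 * (mean P (fun w => W w ^+ 2) / m%:R) / 2 =
    t ^+ 2 / m%:R * ((sV - mean P (fun w => W w ^+ 2)) / 2) by ring.
  have tm0 : 0 <= t ^+ 2 / m%:R by rewrite divr_ge0// ?sqr_ge0// ltW.
  rewrite normrM (ger0_norm tm0) ler_wpM2l//.
  have := meanS2 K; have := meanW2S2; rewrite -/sV.
  set u := mean P _; set v := mean P _ => q1 q2.
  apply: (@le_trans _ _ `|sV - u|).
    by rewrite normrM normfV (@ger0_norm _ 2)// ler_pdivrMr// ler_peMr// ler1n.
  have -> : sV - u = - ((u - v) + (v - sV)) by ring.
  rewrite normrN (le_trans (ler_normD _ _))// lerD//.
move: h1 h2 h3; rewrite -/sV.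
set a := mean P _; set b := mean P _; set E := expR _; set E' := expR _ => h1 h2 h3.
have -> : a - E' * cos th = (a - b) + (b - E * cos th) + (E - E') * cos th by ring.
rewrite (le_trans (ler_normD _ _))// lerD//.
  by rewrite (le_trans (ler_normD _ _))// addrC lerD.
by rewrite normrM (le_trans _ h3)// ler_piMr// ler_norml cos_geN1 cos_le1.
Qed.

End blocks.

(** * Choice of block and gap lengths *)

Ltac nonneg := repeat lazymatch goal with
  | |- is_true (@Order.le _ _ _ (@GRing.mul _ _ _)) => apply: mulr_ge0
  | |- is_true (@Order.le _ _ _ (@GRing.add _ _ _)) => apply: addr_ge0
  | |- is_true (@Order.le _ _ _ (@GRing.exp _ _ _)) =>
      first [by apply: exprn_even_ge0 | apply: exprn_ge0]
  | |- is_true (@Order.le _ _ _ (@GRing.inv _ _)) => rewrite invr_ge0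
  | |- is_true (@Order.le _ _ _ (@Num.norm _ _ _)) => exact: normr_ge0
  | |- is_true (@Order.le _ _ _ (@GRing.natmul _ _ _)) => exact: ler0n
  | |- _ => first [assumption | by apply: ltW | exact: sqrtr_ge0 | done]
  end.

Section rate.
Context (R : realType).
Implicit Types (al : nat -> R) (t C M : R).

(** The right-hand side of [char_mixing_bound], isolated so that [p] and [g] can be optimised by
    pure estimation. *)
Definition mixing_error (m p g : nat) al C t : R :=
  let K := (m %/ (p + g)).+1 in
  K%:R * block_error al C p g (t / Num.sqrt m%:R) +
  `|t / Num.sqrt m%:R| * Num.sqrt ((K * g)%:R * C) +
  t ^+ 2 / m%:R * (Num.sqrt ((K * g)%:R * C * (4 * (m%:R * C))) +
    K%:R * (8 * al g.+1 * (m%:R * p%:R))).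

(* Block length n^8 and gap n^6 for m between n^20 and (2n)^20. *)
Lemma mixing_error_le (m n : nat) al C t M : (0 < n)%N ->
  (n ^ 20 <= m)%N -> (m <= 2 ^ 20 * n ^ 20)%N -> 0 <= C -> 0 <= M ->
  0 <= al (n ^ 6).+1 <= M / (n ^ 6).+1%:R ^+ 4 ->
  mixing_error m (n ^ 8) (n ^ 6) al C t <=
  (2 ^+ 24 * M + 2 * t ^+ 4 * C + 2 * `|t| ^+ 3 * C + 2 * t ^+ 4 * C ^+ 2 +
   `|t| * Num.sqrt (2 * C) + 2 * t ^+ 2 * C * Num.sqrt 2 + 2 ^+ 24 * M * t ^+ 2)
  / n%:R.
Proof.
move=> n0 nm mn C0 M0 /andP[a0 aM]; set p := (n ^ 8)%N; set g := (n ^ 6)%N.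
rewrite /mixing_error /block_error; set K := (m %/ (p + g)).+1.
set a := al _ in a0 aM *.
(* Everything is measured in powers of [u]: [p] is [u^-8], [g] is [u^-6], [r] is at most [u^10], [K]
   is at most [2^21 u^-12], and [a] is at most [M u^24] by the fourth-power decay. *)
set u := n%:R^-1 : R.
have nR : 0 < n%:R :> R by rewrite ltr0n.
have u0 : 0 < u by rewrite invr_gt0.
have u1 : u <= 1 by rewrite invf_le1// ler1n.
have nE : n%:R = u^-1 by rewrite invrK.
have pE : p%:R = u^-1 ^+ 8 :> R by rewrite natrX nE.
have gE : g%:R = u^-1 ^+ 6 :> R by rewrite natrX nE.
have m0 : (0 < m)%N by rewrite (leq_trans _ nm)// expn_gt0 n0.
have mR : 0 < m%:R :> R by rewrite ltr0n.
set r := (Num.sqrt m%:R)^-1 : R.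
have r0 : 0 < r by rewrite invr_gt0 sqrtr_gt0.
have r2 : r ^+ 2 = m%:R^-1 by rewrite exprVn sqr_sqrtr// ltW.
have ru : r <= u ^+ 10.
  rewrite -[leRHS]invrK lef_pV2 ?posrE ?invr_gt0 ?exprn_gt0 ?sqrtr_gt0//.
  rewrite -exprVn -nE -ler_sqr ?nnegrE ?exprn_ge0 ?sqrtr_ge0//.
  by rewrite (sqr_sqrtr (ltW mR)) -exprM -natrX ler_nat.
have Kp : (K * p <= 2 * m)%N.
  rewrite /K mulSn mul2n -addnn leq_add//.
    by apply: leq_trans nm; rewrite /p leq_pexp2l.
  by apply: leq_trans (leq_trunc_div m (p + g)); rewrite leq_mul2l leq_addr orbT.
have Kr : K%:R * r ^+ 2 <= 2 * u ^+ 8.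
  have KpR : K%:R * u^-1 ^+ 8 <= 2 * m%:R by rewrite -pE -!natrM ler_nat.
  rewrite r2 ler_pdivrMr//.
  have -> : K%:R = u ^+ 8 * (K%:R * u^-1 ^+ 8) by field; rewrite gt_eqF.
  have -> : 2 * u ^+ 8 * m%:R = u ^+ 8 * (2 * m%:R) by ring.
  by apply: ler_wpM2l => //; rewrite exprn_ge0// ltW.
have KN : K%:R <= 2 ^+ 21 * u^-1 ^+ 12.
  have h : m%:R <= 2 ^+ 20 * u^-1 ^+ 20 :> R.
    by rewrite -nE -!natrX -natrM ler_nat.
  have : K%:R <= 2 * u ^+ 8 * m%:R by rewrite -ler_pdivrMr// -r2.
  move=> /le_trans; apply; apply: (le_trans (ler_wpM2l _ h)).
    by rewrite mulr_ge0// exprn_ge0// ltW.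
  suff -> : 2 * u ^+ 8 * (2 ^+ 20 * u^-1 ^+ 20) = 2 ^+ 21 * u^-1 ^+ 12 by [].
  by field; rewrite gt_eqF.
have aM' : a <= M * u ^+ 24.
  apply: (le_trans aM); rewrite ler_wpM2l// -[leRHS]invrK lef_pV2 ?posrE ?exprn_gt0 ?invr_gt0//; last first.
    by rewrite exprn_gt0.
  rewrite -exprVn -nE -!natrX ler_nat (_ : n ^ 24 = (n ^ 6) ^ 4)%N ?leq_exp2r//.
  by rewrite -expnM.
have K0 : 0 <= K%:R :> R by [].
have ui k : (0 < k)%N -> u ^+ k <= u.
  by case: k => // k _; rewrite exprS; apply: ler_piMr; [exact: ltW|apply: exprn_ile1 => //; exact: ltW].
have T1 : K%:R * (8 * a) <= 2 ^+ 24 * M * u.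
  apply: (@le_trans _ _ (2 ^+ 21 * u^-1 ^+ 12 * (8 * (M * u ^+ 24)))).
    by apply: ler_pM => //; [exact: mulr_ge0|exact: ler_wpM2l].
  have -> : 2 ^+ 21 * u^-1 ^+ 12 * (8 * (M * u ^+ 24)) = 2 ^+ 24 * M * u ^+ 12.
    by field; rewrite gt_eqF.
  by apply: ler_wpM2l; [by nonneg|exact: ui].
(* The powers of [p] supply [u^-k], the factor [K r^2] supplies [u^8] and every further [r] supplies
   [u^10]: a positive surplus leaves at least one [u]. *)
have mono A (k l : nat) : 0 <= A -> (k < 8 + 10 * l)%N ->
    A * u^-1 ^+ k * (K%:R * r ^+ 2 * r ^+ l) <= 2 * A * u.
  move=> A0 kl; apply: (@le_trans _ _ (A * u^-1 ^+ k * (2 * u ^+ 8 * (u ^+ 10) ^+ l))).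
    apply: ler_wpM2l; first by nonneg.
    apply: ler_pM => //; [by nonneg|by nonneg|].
    by apply: lerXn2r => //; rewrite nnegrE; nonneg.
  rewrite [leLHS](_ : _ = 2 * A * (u^-1 ^+ k * u ^+ (8 + 10 * l))); last first.
    by rewrite exprD exprM; ring.
  rewrite [u^-1 ^+ k * _]mulrC exprVn -expfB//; apply: ler_wpM2l; first by nonneg.
  by apply: ui; rewrite subn_gt0.
have T2 : K%:R * ((t * r) ^+ 4 * p%:R ^+ 2 * (p%:R * C)) <= 2 * t ^+ 4 * C * u.
  have := mono (t ^+ 4 * C) 24%N 2%N (ltac:(by nonneg)) isT.
  by apply: etrans; congr (_ <= _); rewrite ?pE; ring.
have T3 : K%:R * (`|t * r| ^+ 3 * p%:R * (p%:R * C)) <= 2 * `|t| ^+ 3 * C * u.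
  have := mono (`|t| ^+ 3 * C) 16%N 1%N (ltac:(by nonneg)) isT.
  by apply: etrans; congr (_ <= _); rewrite ?pE ?normrM ?(gtr0_norm r0); ring.
have T4 : K%:R * ((t * r) ^+ 2 * (p%:R * C)) ^+ 2 <= 2 * t ^+ 4 * C ^+ 2 * u.
  have := mono (t ^+ 4 * C ^+ 2) 16%N 2%N (ltac:(by nonneg)) isT.
  by apply: etrans; congr (_ <= _); rewrite ?pE; ring.
have Kg : K%:R * r ^+ 2 * u^-1 ^+ 6 <= 2 * u ^+ 2.
  apply: (@le_trans _ _ (2 * u ^+ 8 * u^-1 ^+ 6)).
    by apply: ler_wpM2r => //; rewrite exprn_ge0// invr_ge0 ltW.
  suff -> : 2 * u ^+ 8 * u^-1 ^+ 6 = 2 * u ^+ 2 by [].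
  by field; rewrite gt_eqF.
have Kg0 : 0 <= K%:R * r ^+ 2 * u^-1 ^+ 6.
  by nonneg.
have sq2 : Num.sqrt (2 * u ^+ 2) = Num.sqrt 2 * u.
  by rewrite sqrtrM// sqrtr_sqr gtr0_norm.
(* The gap terms give the rate: gaps fill a fraction of order [g / p = u^2] of the indices, and a
   square root is taken. *)
have T5 : `|t * r| * Num.sqrt ((K * g)%:R * C) <= `|t| * Num.sqrt (2 * C) * u.
  rewrite normrM (gtr0_norm r0) -!mulrA; apply: ler_wpM2l => //.
  have -> : r * Num.sqrt ((K * g)%:R * C) = Num.sqrt (K%:R * r ^+ 2 * u^-1 ^+ 6 * C).
    rewrite -{1}(gtr0_norm r0) -sqrtr_sqr -sqrtrM ?sqr_ge0// natrM gE.
    by congr Num.sqrt; ring.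
  have -> : Num.sqrt (2 * C) * u = Num.sqrt (2 * u ^+ 2 * C).
    rewrite -{1}(gtr0_norm u0) -sqrtr_sqr -sqrtrM ; last by nonneg.
    by congr Num.sqrt; ring.
  by rewrite ler_wsqrtr// ler_wpM2r.
have T6 : t ^+ 2 / m%:R * Num.sqrt ((K * g)%:R * C * (4 * (m%:R * C))) <=
    2 * t ^+ 2 * C * Num.sqrt 2 * u.
  have -> : t ^+ 2 / m%:R * Num.sqrt ((K * g)%:R * C * (4 * (m%:R * C))) =
     2 * t ^+ 2 * C * Num.sqrt (K%:R * r ^+ 2 * u^-1 ^+ 6).
    have -> : (K * g)%:R * C * (4 * (m%:R * C)) =
        (2 * m%:R * C) ^+ 2 * (K%:R * r ^+ 2 * u^-1 ^+ 6).
      by rewrite natrM gE r2; field; rewrite ?gt_eqF// ?ltr0n.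
    rewrite sqrtrM ?sqr_ge0// sqrtr_sqr ger0_norm; last by nonneg.
    by field; rewrite gt_eqF.
  rewrite -[leRHS]mulrA; apply: ler_wpM2l; first by nonneg.
  by rewrite -sq2 ler_wsqrtr.
have T7 : t ^+ 2 / m%:R * (K%:R * (8 * a * (m%:R * p%:R))) <= 2 ^+ 24 * M * t ^+ 2 * u.
  have tC : 0 <= 8 * t ^+ 2 * u^-1 ^+ 8.
    by nonneg.
  have -> : t ^+ 2 / m%:R * (K%:R * (8 * a * (m%:R * p%:R))) =
    8 * t ^+ 2 * u^-1 ^+ 8 * (K%:R * a).
    by rewrite pE; field; rewrite !gt_eqF.
  have Ka : K%:R * a <= 2 ^+ 21 * u^-1 ^+ 12 * (M * u ^+ 24) by exact: ler_pM.
  apply: (le_trans (ler_wpM2l tC Ka)).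
  have -> : 8 * t ^+ 2 * u^-1 ^+ 8 * (2 ^+ 21 * u^-1 ^+ 12 * (M * u ^+ 24)) =
    2 ^+ 24 * M * t ^+ 2 * u ^+ 4 by field; rewrite gt_eqF.
  by apply: ler_wpM2l; [by nonneg|exact: ui].
rewrite -/r -/u.
have := lerD (lerD (lerD (lerD (lerD (lerD T1 T2) T3) T4) T5) T6) T7.
by apply: etrans; congr (_ <= _); ring.
Qed.

(** Take [n] maximal with [n^20 <= m]; then [m < (n + 1)^20 <= (2 n)^20]. *)
Lemma root20_window (n0 m : nat) : (n0 ^ 20 <= m)%N -> (0 < n0)%N ->
  exists2 n, (n0 <= n)%N & (n ^ 20 <= m <= 2 ^ 20 * n ^ 20)%N.
Proof.
move=> nm n00.
have ub n : (n ^ 20 <= m)%N -> (n <= m)%N.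
  move=> /(leq_trans _); apply; case: n => // n.
  by rewrite -{1}[n.+1]expn1 leq_pexp2l.
have [n nP nmax] := ex_maxnP (ex_intro (fun n => n ^ 20 <= m)%N n0 nm) ub.
exists n; first exact: nmax.
rewrite nP /= -expnMn; have nn : (0 < n)%N by exact: leq_trans n00 (nmax _ nm).
have : ~~ (n.+1 ^ 20 <= m)%N by apply/negP => /nmax; rewrite ltnn.
rewrite -ltnNge => /ltnW /leq_trans; apply; rewrite leq_exp2r//.
by rewrite mul2n -addnn -addn1 leq_add2l.
Qed.

Lemma mixing_error_cvg0 al C t M : 0 <= C -> 0 <= M ->
  (forall k, 0 <= al k.+1 <= M / k.+1%:R ^+ 4) ->
  forall e, 0 < e -> exists m0, forall m, (m0 <= m)%N ->
    exists p g, (0 < p)%N /\ mixing_error m p g al C t <= e.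
Proof.
move=> C0 M0 alM e e0.
pose B := 2 ^+ 24 * M + 2 * t ^+ 4 * C + 2 * `|t| ^+ 3 * C + 2 * t ^+ 4 * C ^+ 2 +
   `|t| * Num.sqrt (2 * C) + 2 * t ^+ 2 * C * Num.sqrt 2 + 2 ^+ 24 * M * t ^+ 2.
have B0 : 0 <= B by rewrite /B; nonneg.
pose n0 := (Num.truncn (B / e)).+1.
exists (n0 ^ 20)%N => m n0m.
have [//|n n0n /andP[nm mn]] := root20_window n0m.
have n_gt0 : (0 < n)%N by exact: leq_trans n0n.
exists (n ^ 8)%N, (n ^ 6)%N; split; first by rewrite expn_gt0 n_gt0.
apply: (le_trans (mixing_error_le t n_gt0 nm mn C0 M0 (alM _))).
rewrite -/B ler_pdivrMr ?ltr0n// mulrC -ler_pdivrMr//.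
have := @truncnS_gt R (B / e); rewrite -/n0 => /ltW/le_trans; apply.
by rewrite ler_nat.
Qed.

End rate.

(** * Counts of mixing events: variance and characteristic function *)

(** Subtraction being truncated, [(i - j) + (j - i)] is the distance of [i] and [j]; each distance
    occurs at most once on either side of [i]. *)
Lemma sum_dist_le (R : realType) (bt : nat -> R) (A : R) (m : nat) (i : 'I_m) :
  (forall N, \sum_(k < N) bt k.+1 <= A) ->
  \sum_(j < m | j != i) bt ((i - j) + (j - i))%N <= A + A.
Proof.
move=> btA; rewrite (bigID (fun j : 'I_m => (j < i)%N))/= lerD//.
  apply: le_trans (btA i).
  rewrite le_eqVlt; apply/orP; left; apply/eqP.
  transitivity (\sum_(0 <= j < i) bt (i - j)%N); last first.
    rewrite big_nat_rev/= big_mkord; apply: eq_bigr => k _; rewrite add0n.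
    by congr bt; rewrite subKn.
  rewrite (@big_nat_widen _ _ _ 0 i m)//; last exact: ltnW.
  rewrite big_mkord; apply: eq_big => [j|j /andP[_ ji]].
    by rewrite -(inj_eq val_inj) neq_ltn/=; case: ltngtP.
  by rewrite (eqP (ltnW ji : j - i == 0)%N) addn0.
apply: le_trans (btA (m - i.+1)%N).
rewrite le_eqVlt; apply/orP; left; apply/eqP.
transitivity (\sum_(i.+1 <= j < m) bt (j - i)%N).
  rewrite [RHS](@big_nat_widenl _ _ _ i.+1 0)// big_mkord.
  apply: eq_big => [j|j /andP[_]].
    by rewrite -(inj_eq val_inj) neq_ltn/= -leqNgt; case: ltngtP.
  by rewrite -leqNgt => ij; rewrite (eqP (ij : i - j == 0)%N).
rewrite -{1}[i.+1]add0n big_addn big_mkord; apply: eq_bigr => k _.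
by congr bt; rewrite addnS subSn ?leq_addl// addnK.
Qed.

Section events.
Context d (T : measurableType d) (R : realType) (P : probability T R) (m : nat).
Variables (A : 'I_m -> set T) (GP GF : nat -> set (set T)) (al bt : nat -> R) (s B : R).
Hypotheses (mGP : forall n, GP n `<=` measurable) (mGF : forall n, GF n `<=` measurable).
Hypothesis AP : forall n (i : 'I_m), (i < n)%N -> <<s GP n>> (A i).
Hypothesis AF : forall n (i : 'I_m), (n <= i)%N -> <<s GF n>> (A i).
Hypothesis mix : forall n k A1 A2, (0 < n)%N -> <<s GP n >> A1 -> <<s GF (n + k) >> A2 ->
  `|prob P (A1 `&` A2) - prob P A1 * prob P A2| <= al k.+1.
Hypothesis As : forall i, prob P (A i) = s.
Hypotheses (bt0 : forall k, 0 <= bt k) (albt : forall k, al k.+1 <= bt k.+1 ^+ 2).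
Hypothesis btB : forall N, \sum_(k < N) bt k.+1 <= B.
Hypothesis m0 : (0 < m)%N.

Let X i (w : T) : R := \1_(A i) w - s.

Let mA i : measurable (A i).
Proof. by apply: sub_sigma_measurable (AP (ltnSn i)); exact: mGP. Qed.

Let s01 : 0 <= s <= 1.
Proof. by rewrite -(As (Ordinal m0)) prob_ge0 prob_le1. Qed.

Let bX i : bounded_rv (X i).
Proof. by apply: brvB; [exact: brv_indic|exact: brv_cst]. Qed.

Let X1 i w : `|X i w| <= 1.
Proof.
have /andP[s0 s1] := s01; rewrite /X indicE; case: (_ \in _) => /=.
  by rewrite ger0_norm ?subr_ge0// lerBlDr lerDl.
by rewrite sub0r normrN ger0_norm.
Qed.

Let X0 i : mean P (X i) = 0.
Proof.
by rewrite meanB ?mean_cst ?mean_indic ?As ?subrr//; [exact: brv_indic|exact: brv_cst].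
Qed.

Let mX (G : set (set T)) i : <<s G>> (A i) ->
  measurable_fun setT (X i : g_sigma_algebraType G -> R).
Proof.
move=> GA; apply: measurable_funB; last exact: measurable_cst.
exact: measurable_indic.
Qed.

Lemma mean_centered_indic2 i j :
  mean P (fun w => X i w * X j w) = prob P (A i `&` A j) - s ^+ 2.
Proof.
rewrite (_ : (fun w => _) = (fun w => \1_(A i `&` A j) w - s * \1_(A i) w - s * \1_(A j) w + s ^+ 2)); last first.
  by apply/funext => w; rewrite /X indicI/=; ring.
have bI D : measurable D -> bounded_rv (fun w => \1_D w : R) by exact: brv_indic.
have bZ i' : bounded_rv (fun w => s * \1_(A i') w : R).
  by bounded.
have mI := measurableI _ _ (mA i) (mA j).
rewrite meanD ?meanB ?meanZ ?mean_cst ?mean_indic ?As//; try exact: bI; try exact: brv_cst.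
- by ring.
- by bounded.
- by bounded.
Qed.

Let cov_al (i j : 'I_m) : (i < j)%N -> `|mean P (fun w => X i w * X j w)| <= al (j - i)%N.
Proof.
move=> ij; rewrite mean_centered_indic2 expr2 -{1}(As i) -(As j).
have -> : (j - i)%N = (j - i.+1).+1 by rewrite subnSK.
by apply: (mix (n := i.+1)) => //; [exact: AP|apply: AF; rewrite subnKC].
Qed.

Let cov_s i j : `|mean P (fun w => X i w * X j w)| <= s.
Proof.
have /andP[s0 s1] := s01; rewrite mean_centered_indic2.
have h : prob P (A i `&` A j) <= s.
  by rewrite -(As i) le_prob//; exact: measurableI.
have h0 := prob_ge0 P (A i `&` A j).
have ss : s ^+ 2 <= s by rewrite expr2 ler_piMr.
have := sqr_ge0 s; rewrite ler_norml; lra.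
Qed.

(* The covariance is at most min(alpha, s), hence at most sqrt (s * alpha): this
   makes the variance small with s and is what controls the oscillations. *)
Let cov_bt (i j : 'I_m) : j != i ->
  `|mean P (fun w => X i w * X j w)| <= Num.sqrt s * bt ((i - j) + (j - i))%N.
Proof.
move=> ji; have /andP[s0 s1] := s01; set c := `|_|.
have c0 : 0 <= c by exact: normr_ge0.
have cs : c <= s by exact: cov_s.
have cb : c <= bt ((i - j) + (j - i))%N ^+ 2.
  case: (ltngtP i j) => [ij|ij|/val_inj ij]; last by rewrite ij eqxx in ji.
    rewrite (eqP (ltnW ij : i - j == 0)%N) add0n -(subnSK ij).
    by apply: le_trans (albt _); rewrite subnSK//; exact: cov_al.
  rewrite (eqP (ltnW ij : j - i == 0)%N) addn0 -(subnSK ij).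
  apply: le_trans (albt _); rewrite subnSK// /c.
  by under eq_fun do rewrite mulrC; exact: cov_al.
rewrite -ler_sqr ?nnegrE ?mulr_ge0 ?sqrtr_ge0// exprMn (sqr_sqrtr s0) expr2.
by apply: ler_pM.
Qed.

(** The diagonal term is at most [s <= sqrt s], and each side of [i] contributes at most
    [sqrt s * B]. *)
Lemma sum_cov_le i : \sum_j `|mean P (fun w => X i w * X j w)| <=
  Num.sqrt s * (1 + (B + B)).
Proof.
have /andP[s0 s1] := s01; rewrite (bigD1 i)//= mulrDr lerD// ?mulr1.
  apply: (le_trans (cov_s _ _)); rewrite -ler_sqr ?nnegrE ?sqrtr_ge0//.
  by rewrite (sqr_sqrtr s0) expr2 ler_piMr.
apply: (@le_trans _ _ (\sum_(j < m | j != i) Num.sqrt s * bt ((i - j) + (j - i))%N)).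
  by apply: ler_sum => j; exact: cov_bt.
by rewrite -mulr_sumr ler_wpM2l ?sqrtr_ge0// sum_dist_le.
Qed.

Let mean_sqr_normalized : mean P (fun w => ((Num.sqrt m%:R)^-1 * \sum_i X i w) ^+ 2) =
  mean P (fun w => (\sum_i X i w) ^+ 2) / m%:R.
Proof.
rewrite (_ : (fun w => _) = (fun w => m%:R^-1 * (\sum_i X i w) ^+ 2)); last first.
  by apply/funext => w; rewrite exprMn exprVn sqr_sqrtr.
by rewrite meanZ 1?mulrC//; apply: brvX; exact: brv_sum.
Qed.

Let XP n (i : 'I_m) : (i < n)%N -> measurable_fun setT (X i : g_sigma_algebraType (GP n) -> R).
Proof. by move=> ni; apply: mX; exact: AP. Qed.

Lemma mean_sqr_events_le :
  mean P (fun w => ((Num.sqrt m%:R)^-1 * \sum_i X i w) ^+ 2) <= Num.sqrt s * (1 + (B + B)).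
Proof.
rewrite mean_sqr_normalized ler_pdivrMr ?ltr0n// mulrC.
have Dm : (#|(xpredT : pred 'I_m)| <= m)%N by rewrite -[leqRHS]card_ord max_card.
exact: (mean_sqr_sum_le mGP XP X1 sum_cov_le m0 Dm).
Qed.

Lemma char_events (p g : nat) (t th : R) : (0 < p)%N ->
  `|mean P (fun w => cos (t * ((Num.sqrt m%:R)^-1 * \sum_i X i w) + th)) -
    expR (- (t ^+ 2 * mean P (fun w => ((Num.sqrt m%:R)^-1 * \sum_i X i w) ^+ 2) / 2)) * cos th| <=
  mixing_error m p g al (1 + (B + B)) t.
Proof.
move=> p0; rewrite mean_sqr_normalized; have /andP[s0 s1] := s01.
have B0 : 0 <= B by have := btB 0; rewrite big_ord0.
have XF n (i : 'I_m) : (n <= i)%N -> measurable_fun setT (X i : g_sigma_algebraType (GF n) -> R).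
  by move=> ni; apply: mX; exact: AF.
have XC i : \sum_j `|mean P (fun w => X i w * X j w)| <= 1 + (B + B).
  apply: (le_trans (sum_cov_le i)); rewrite ler_piMl ?addr_ge0//.
  by rewrite -ler_sqr ?nnegrE ?sqrtr_ge0// (sqr_sqrtr s0) expr1n.
exact: (char_mixing_bound mGP mGF XP XF mix X1 X0 XC m0 g p0 t th).
Qed.

End events.

(* The hypothesis on gamma and Q forces gamma < Q - 2, so the exponent
   gamma / (Q + gamma) is below 1/2; and Q is at least 4. *)
Lemma mixing_rates (R : realType) (al : nat -> R) (Q : nat) (gamma : R) :
  (forall k, 0 <= al k <= 1) ->
  ~~ odd Q -> (2 < Q)%N -> 0 < gamma -> gamma / (2 + gamma) + 2 / Q%:R < 1 ->
  (\sum_(1 <= k <oo) (k%:R ^+ (Q - 2) * al k `^ (gamma / (Q%:R + gamma)))%:E < +oo)%E ->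
  exists (bt : nat -> R) (M : R), [/\ 0 <= M, forall k, 0 <= bt k,
    forall k, al k.+1 <= bt k.+1 ^+ 2,
    forall N, \sum_(k < N) bt k.+1 <= M &
    forall k, 0 <= al k.+1 <= M ^+ 2 / k.+1%:R ^+ 4].
Proof.
move=> al01 oQ Q2 g0 gQ; set th := gamma / _ => sfin.
have Q0 : 0 < Q%:R :> R by rewrite ltr0n (leq_trans _ Q2).
have Q4 : (4 <= Q)%N by case: Q oQ Q2 {gQ th sfin Q0} => [|[|[|[|]]]].
have th0 : 0 < th by rewrite divr_gt0// addr_gt0.
have gQ' : gamma <= Q%:R.
  have h : 0 < (2 + gamma) * Q%:R by rewrite mulr_gt0// addr_gt0.
  have := gQ; rewrite addf_div ?gt_eqF ?addr_gt0// ltr_pdivrMr//; nra.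
have th2 : th * 2 <= 1.
  rewrite /th mulrAC ler_pdivrMr ?addr_gt0//; lra.
(* Since [th <= 1/2] and [al <= 1], [bt] dominates the square root of [al], while the series
   hypothesis bounds its weighted sum. *)
pose bt k := al k `^ th.
pose u k : R := k%:R ^+ (Q - 2) * bt k.
have bt0 k : 0 <= bt k by exact: powR_ge0.
have u0 k : 0 <= u k by rewrite mulr_ge0// exprn_ge0.
pose S := (\sum_(1 <= k <oo) (u k)%:E)%E.
have S0 : (0 <= S)%E by apply: nneseries_ge0 => k _ _; rewrite lee_fin.
have Sf : S \is a fin_num by rewrite ge0_fin_numE.
pose M := fine S.
have uM N : \sum_(k < N) u k.+1 <= M.
  rewrite -lee_fin fineK// (_ : \sum_(k < N) u k.+1 = \sum_(1 <= k < N.+1) u k); last first.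
    by rewrite big_add1 /= big_mkord.
  rewrite -sumEFin; apply: nneseries_lim_ge => k _.
  by rewrite lee_fin.
have k1 k : 1 <= k.+1%:R ^+ 2 :> R by rewrite -natrX ler1n expn_gt0.
have ku k : k.+1%:R ^+ 2 * bt k.+1 <= u k.+1.
  rewrite ler_wpM2r// -!natrX ler_nat leq_pexp2l//.
  by rewrite leq_subRL// ltnW.
have ab k : al k <= bt k ^+ 2.
  have /andP[a0 a1] := al01 k.
  have [->|an] := eqVneq (al k) 0; first exact: sqr_ge0.
  have ap : 0 < al k <= 1 by rewrite lt_neqAle eq_sym an a0.
  by rewrite -powR_mulrn// -powRrM; exact: ger1_powR.
have btu k : bt k.+1 <= u k.+1 by apply: le_trans (ku k); rewrite ler_peMl.
exists bt, M; split => //.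
- by rewrite fine_ge0.
- by move=> N; apply: le_trans (uM N); apply: ler_sum => k _; exact: btu.
(* As [Q - 2 >= 2], the product of [k.+1%:R ^+ 2] and [bt k.+1] is at most one term of the series,
   hence at most [M]; squaring gives the decay of order 4. *)
- move=> k; have /andP[a0 a1] := al01 k.+1; rewrite a0/=.
  apply: (le_trans (ab _)).
  have k0 : 0 < k.+1%:R ^+ 4 :> R by rewrite exprn_gt0.
  rewrite ler_pdivlMr// (_ : bt _ ^+ 2 * _ = (k.+1%:R ^+ 2 * bt k.+1) ^+ 2); last by ring.
  have kb0 : 0 <= k.+1%:R ^+ 2 * bt k.+1 by rewrite mulr_ge0// sqr_ge0.
  have M0 : 0 <= M by rewrite fine_ge0.
  rewrite ler_sqr ?nnegrE//; apply: (le_trans (ku k)); apply: le_trans (uM k.+1).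
  by rewrite big_ord_recr/= lerDr sumr_ge0.
Qed.

(** * The Benjamini-Hochberg procedure through counts *)

Section bh.
Context (R : realType) (m : nat).
Implicit Types (p : 'I_m -> R) (h : 'I_m -> bool) (q c t : R).

Definition count_le p c : nat := #|[pred i | p i <= c]|.

Lemma order_stat_le p c j : (0 < j <= m)%N ->
  (order_stat p j <= c) = (j <= count_le p c)%N.
Proof.
case: j => // j /= jm; rewrite /order_stat/=; set s := sort _ _.
have ss : sorted <=%R s by exact: sort_le_sorted.
have sz : size s = m by rewrite size_sort size_map size_enum_ord.
have -> : count_le p c = count (<= c) s.
  by rewrite count_sort count_map /count_le cardE size_filter enumT; exact: eq_count.
apply/idP/idP => [|jc]; last exact: nth_count_le.
apply: contraLR; rewrite -leqNgt -ltNge => cj.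
by apply: nth_count_gt => //; rewrite cj sz.
Qed.

Lemma leq_count_le p c t : c <= t -> (count_le p c <= count_le p t)%N.
Proof.
move=> ct; apply: subset_leq_card; apply/fintype.subsetP => i;
by rewrite !inE => /le_trans; apply.
Qed.

Lemma count_le_max p c : (count_le p c <= m)%N.
Proof. by rewrite -[leqRHS]card_ord max_card. Qed.

(** Counts in place of order statistics make the number of rejections a function of the events
    [p i <= j q / m], which serves the maximality arguments and measurability alike. *)
Lemma BH_rejectionsE q p : BH_rejections q p =
  (\max_(j < m.+1 | (j <= count_le p (j%:R * q / m%:R))%N) j)%N.
Proof.
apply: eq_bigl => -[[|j] jm]/=; first by rewrite /order_stat/= !mul0r lexx.
by rewrite order_stat_le.
Qed.

Lemma BH_rejections_ge q p j : (j <= m)%N -> (j <= count_le p (j%:R * q / m%:R))%N ->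
  (j <= BH_rejections q p)%N.
Proof.
move=> jm jN; rewrite BH_rejectionsE.
by rewrite (@leq_bigmax_cond _ _ (fun j : 'I_m.+1 => j : nat) (Ordinal (jm : j < m.+1)%N)).
Qed.

(** If the count at this cut-off exceeded the number of rejections, the count would be an admissible
    rank itself, as its critical value is larger still. *)
Lemma BH_rejections_fix q p : 0 <= q ->
  count_le p ((BH_rejections q p)%:R * q / m%:R) = BH_rejections q p.
Proof.
move=> q0; set r := BH_rejections q p; apply/eqP; rewrite eqn_leq; apply/andP.
have rN : (r <= count_le p (r%:R * q / m%:R))%N.
  rewrite /r BH_rejectionsE.
  have [|j jP ->] := @eq_bigmax_cond _ [pred j : 'I_m.+1 | (j <= count_le p (j%:R * q / m%:R))%N] (fun j => j : nat).
    by apply/card_gt0P; exists ord0; rewrite !inE.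
  by [].
split=> //; apply: BH_rejections_ge; first exact: count_le_max.
apply: leq_count_le; rewrite ler_wpM2r ?invr_ge0// ler_wpM2r//.
by rewrite ler_nat.
Qed.

(** The hypothesis says that [t] is at most the critical value of the rank [count_le p t]; that rank
    is therefore admissible. *)
Lemma BH_rejections_ge_count q p t : (0 < m)%N -> 0 < q ->
  t * m%:R / q <= (count_le p t)%:R -> t <= (BH_rejections q p)%:R * q / m%:R.
Proof.
move=> m0 q0 tN; have mR : 0 < m%:R :> R by rewrite ltr0n.
have tc : t <= (count_le p t)%:R * q / m%:R by rewrite ler_pdivlMr// -ler_pdivrMr.
apply: (le_trans tc); rewrite ler_wpM2r ?invr_ge0// ler_wpM2r ?ler_nat// ?ltW//.
by apply: BH_rejections_ge; [exact: count_le_max|exact: leq_count_le].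
Qed.

(** The threshold in the definition is the largest rejected p-value, not [R q / m]; both select the
    same hypotheses, since one selection contains the other and each has [R] elements. *)
Lemma FDPE q p h : (0 < m)%N -> 0 < q -> FDP q p h =
  #|[pred i | (p i <= (BH_rejections q p)%:R * q / m%:R) && ~~ h i]|%:R /
  (maxn (BH_rejections q p) 1)%:R.
Proof.
move=> m0 q0; rewrite /FDP; congr (_%:R / _); apply: eq_card => i; rewrite !inE.
congr (_ && _); rewrite /BH_threshold; set r := BH_rejections q p.
have fixr : count_le p (r%:R * q / m%:R) = r := BH_rejections_fix p (ltW q0).
have rm : (r <= m)%N by rewrite -fixr count_le_max.
(* Without rejections both cut-offs equal 0, by the convention on the order statistic of rank 0. *)
have [r0|r0] := posnP r; first by rewrite r0 !mul0r.
have rle : order_stat p r <= r%:R * q / m%:R.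
  by rewrite order_stat_le ?r0// fixr.
have : [pred i | p i <= order_stat p r] \subset [pred i | p i <= r%:R * q / m%:R].
  by apply/fintype.subsetP => k; rewrite !inE => /le_trans; apply.
have cE : #|[pred i | p i <= order_stat p r]| = #|[pred i | p i <= r%:R * q / m%:R]|.
  rewrite -!/(count_le _ _); apply/eqP; rewrite eqn_leq leq_count_le//= fixr.
  by rewrite -order_stat_le// r0.
by move=> /(subset_cardP cE)/(_ i); rewrite !inE.
Qed.

End bh.

(** * Measurability of the false discovery proportion *)

Section measurable_finite.
Context d (T : measurableType d) (R : realType).

Lemma measurable_fun_finite (I : finType) (b : I -> T -> bool) (F : {ffun I -> bool} -> R) :
  (forall i, measurable [set w | b i w]) ->
  measurable_fun setT (fun w => F [ffun i => b i w]).
Proof.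
move=> mb _ B mB; rewrite setTI.
rewrite (_ : _ @^-1` _ = \bigcup_(v in [set v | B (F v)])
    \bigcap_(i in [set: I]) [set w | b i w = v i]); last first.
  apply/seteqP; split => [w /= Bw|w [v /= Bv vw]].
    by exists [ffun i => b i w] => // i _ /=; rewrite ffunE.
  by rewrite /= (_ : [ffun i => _] = v)//; apply/ffunP => i; rewrite ffunE; exact: vw.
apply: fin_bigcup_measurable => // v _; apply: fin_bigcap_measurable => // i _.
have [vi|vi] := boolP (v i); first by apply: mb.
rewrite (_ : mkset _ = ~` [set w | b i w]); first exact: measurableC.
by apply/seteqP; split => w /=; [move=> ->|move/negP/negbTE].
Qed.

(** The proportion depends on the data through finitely many booleans only: the comparisons
    [p i <= j q / m] and the labels [h i]. *)
Lemma measurable_FDP (m : nat) (q : R) (p : T -> 'I_m -> R) (h : T -> 'I_m -> bool) :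
  0 < q ->
  (forall i c, measurable [set w | p w i <= c]) ->
  (forall i, measurable [set w | h w i]) ->
  measurable_fun setT (fun w => FDP q (p w) (h w)).
Proof.
case: m p h => [|m] p h q0 mp mh.
  have -> : (fun w => FDP q (p w) (h w)) = fun=> 0.
    apply/funext => w; rewrite /FDP /BH_false_rejections (_ : #|_| = 0%N) ?mul0r//.
    by apply: eq_card0 => -[].
  exact: measurable_cst.

pose I := ('I_m.+2 * 'I_m.+1 + 'I_m.+1)%type.
pose b (x : I) w := match x with
  | inl ji => p w ji.2 <= ji.1%:R * q / m.+1%:R | inr i => h w i end.
pose r (v : {ffun I -> bool}) := (\max_(j < m.+2 | (j <= #|[pred i | v (inl (j, i))]|)%N) j)%N.
pose F (v : {ffun I -> bool}) : R :=
  #|[pred i | v (inl (inord (r v), i)) && ~~ v (inr i)]|%:R / (maxn (r v) 1)%:R.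
rewrite (_ : (fun w => _) = (fun w => F [ffun x => b x w])).
  by apply: measurable_fun_finite => -[[j i]|i]; [exact: mp|exact: mh].
apply/funext => w; rewrite FDPE//.
have rE : r [ffun x => b x w] = BH_rejections q (p w).
  rewrite BH_rejectionsE; apply: eq_bigl => j; congr (_ <= _)%N.
  by apply: eq_card => i; rewrite !inE ffunE.
rewrite /F rE; congr (_%:R / _); apply: eq_card => i; rewrite !inE !ffunE/= inordK//.
by rewrite ltnS -(BH_rejections_fix (p w) (ltW q0)) count_le_max.
Qed.

End measurable_finite.

(** * Transversal crossing of the rejection curve at [tau] *)

Section rejection_curve.
Context (R : realType) (q muA pi1 tau : R).
Hypotheses (muA0 : 0 < muA) (pi10 : 0 < pi1) (tau01 : 0 < tau < 1).
Hypothesis tauE : tau / q =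
  (1 - pi1) * tau + pi1 * Phibar (Phibar_inv tau - muA%:E)%E.

(* With [t = Phibar z], the likelihood ratio of the alternative to the null is
   [expR (muA z - muA^2 / 2)], increasing in [z]: the curve is strictly concave. *)
Lemma rejection_curve_slopes : exists c s0, [/\ 0 < c, 0 < s0 < tau,
  forall t, tau <= t < 1 ->
    (1 - pi1) * t + pi1 * Phibar (Phibar_inv t - muA%:E)%E - t / q <= - c * (t - tau) &
  forall t, s0 <= t <= tau ->
    c * (tau - t) <= (1 - pi1) * t + pi1 * Phibar (Phibar_inv t - muA%:E)%E - t / q].
Proof.
have [z0 z0E z0t] := Phibar_inv_fin tau01.
pose E z := expR (muA * z - muA ^+ 2 / 2).
pose F z := Phibar (z - muA)%:E.
have E0 z : 0 < E z by exact: expR_gt0.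
have FE : F z0 = Phibar (Phibar_inv tau - muA%:E)%E by rewrite z0E.
pose k := q^-1 - (1 - pi1).
have kE : pi1 * F z0 = k * tau by rewrite /k mulrBl [q^-1 * _]mulrC tauE FE; ring.
have mu0 := ltW muA0.
(* Strict concavity: the slope at [tau] is below that of the chord from the origin. The strictness
   is gained on the part beyond [z0 + 1], where the ratio is at least [E (z0 + 1) > E z0]. *)
have Elt : E z0 * tau < F z0.
  have h1 := Phibar_shift_ge (z0 + 1) mu0.
  have z01 : z0 <= z0 + 1 by lra.
  have /andP[h2 _] := Phibar_shift_chord mu0 z01.
  have h3 : E z0 < E (z0 + 1) by rewrite ltr_expR ltrD2r ltr_pM2l// ltrDl.
  have h4 := Phibar_gt0 (z0 + 1).
  move: h1 h2; rewrite -!/(E _) -!/(F _) z0t [E z0 * (_ - _)]mulrBr.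
  have := h3; rewrite -(ltr_pM2r h4).
  set v1 := E z0 * Phibar _; set v2 := E _ * Phibar _; lra.
have t0 : 0 < tau by have /andP[] := tau01.
have kE0 : pi1 * E z0 < k.
 by rewrite -(ltr_pM2r t0) -kE -mulrA ltr_pM2l.
(* Chosen so that [pi1 * E z1] is midway between [pi1 * E z0] and [k], that is [k - c]. Chords then
   have slope at most [- 2 c] right of [tau] and at most [- c] from [Phibar z1] up to [tau]. *)
pose r := (1 + k / (pi1 * E z0)) / 2.
have pE0 : 0 < pi1 * E z0 by exact: mulr_gt0.
have kr : 1 < k / (pi1 * E z0) by rewrite ltr_pdivlMr// mul1r.
have r1 : 1 < r by rewrite /r; lra.
pose z1 := z0 + ln r / muA.
have z01 : z0 < z1 by rewrite ltrDl divr_gt0// ln_gt0.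
have Ez1 : E z1 = E z0 * r.
  rewrite /E /z1 -[r in RHS]lnK ?posrE ?(lt_trans _ r1)// -expRD; congr expR.
  by field; rewrite gt_eqF.
have pEz1 : pi1 * E z1 = (pi1 * E z0 + k) / 2.
  by rewrite Ez1 /r; field; rewrite !gt_eqF.
pose c := (k - pi1 * E z0) / 2.
have c0 : 0 < c by rewrite /c; lra.
have s0t : Phibar z1%:E < tau by rewrite -z0t Phibar_decreasing.
exists c, (Phibar z1%:E); split => //; first by rewrite Phibar_gt0.
- move=> t /andP[tt t1].
  have t01 : 0 < t < 1 by rewrite t1 andbT (lt_le_trans t0).
  have [z zE zt] := Phibar_inv_fin t01.
  have zz0 : z <= z0 by rewrite -Phibar_le zt z0t.
  rewrite zE -/(F z).
  have /andP[_ h] := Phibar_shift_chord mu0 zz0.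
  move: h; rewrite -/(E z0) -!/(F _) zt z0t => h.
  have : pi1 * (F z - F z0) <= pi1 * (E z0 * (t - tau)) by rewrite ler_pM2l.
  have : 0 <= c * (t - tau) by rewrite mulr_ge0// ?subr_ge0// ltW.
  move: kE; rewrite /c /k; nra.
- move=> t /andP[st tt].
  have t01 : 0 < t < 1.
    by rewrite (lt_le_trans (Phibar_gt0 _) st)/= (le_lt_trans tt)//; have /andP[] := tau01.
  have [z zE zt] := Phibar_inv_fin t01.
  have zz0 : z0 <= z by rewrite -Phibar_le zt z0t.
  have zz1 : z <= z1 by rewrite -Phibar_le zt.
  rewrite zE -/(F z).
  have /andP[_ h] := Phibar_shift_chord mu0 zz0.
  move: h; rewrite -/(E z) -!/(F _) zt z0t => h.
  have Ezz : E z <= E z1 by rewrite ler_expR lerD2r ler_pM2l.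
  have tt0 : 0 <= tau - t by rewrite subr_ge0.
  have h' : F z0 - F z <= E z1 * (tau - t) by apply: (le_trans h); rewrite ler_wpM2r.
  have h2 : pi1 * (F z0 - F z) <= pi1 * E z1 * (tau - t).
    by rewrite -mulrA ler_pM2l.
  have cE : pi1 * E z1 = k - c by rewrite pEz1 /c; lra.
  move: h2 kE; rewrite cE /k => h2 kE; nra.
Qed.

End rejection_curve.

(** * Probabilities of one and two p-values in the two-group model *)

Lemma delta_quad (R : comNzRingType) (m : nat) (G : 'M[R]_m) i j :
  ((delta_mx 0 i : 'rV[R]_m) *m G *m (delta_mx j 0 : 'cV[R]_m)) 0 0 = G i j.
Proof. by rewrite -rowE -colE !mxE. Qed.

Lemma quad_lincomb2 (R : comNzRingType) (m : nat) (G : 'M[R]_m) i j (a b : R) : G^T = G ->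
  let v := a *: delta_mx 0 i + b *: delta_mx 0 j : 'rV[R]_m in
  (v *m G *m v^T) 0 0 = a ^+ 2 * G i i + 2 * a * b * G i j + b ^+ 2 * G j j.
Proof.
move=> Gsym /=; have Gji : G j i = G i j by rewrite -[in LHS]Gsym mxE.
rewrite linearD/= !linearZ/= !trmx_delta mulmxDr !mulmxDl -!scalemxAr -!scalemxAl.
have DE (A B : 'M[R]_1) : (A + B) 0 0 = A 0 0 + B 0 0 by rewrite mxE.
have ZE c (A : 'M[R]_1) : (c *: A) 0 0 = c * A 0 0 by rewrite mxE.
by rewrite !DE !ZE !delta_quad Gji; ring.
Qed.

(** Variance 0 is included: combinations of perfectly correlated errors, as well as the limit law of
    the theorem, may be point masses. *)
Lemma mean_normal_law_cos (R : realType) (v : R) : 0 <= v ->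
  exists2 mu : probability (measurableTypeR R) R,
    forall B, mu B = normal_law 0 v B &
    forall a b : R, mean mu (fun x => cos (a * x + b)) = expR (- (a ^+ 2 * v / 2)) * cos b.
Proof.
move=> v0; rewrite /normal_law; have [->|vn] := eqVneq v 0.
  exists (\d_(0 : measurableTypeR R) : probability _ _) => // a b.
  rewrite mulr0 mul0r oppr0 expR0 mul1r /mean /Rintegral integral_dirac//.
    by rewrite diracT mul1e/= mulr0 add0r.
  apply/measurable_EFinP; apply: (brv_cos _).1.
  by apply: measurable_funD => //; exact: measurable_funM.
exists (normal_prob 0 (Num.sqrt v) : probability (measurableTypeR R) R) => // a b.
have sn : Num.sqrt v != 0 by rewrite gt_eqF// sqrtr_gt0 lt_neqAle eq_sym vn.
by rewrite mean_normal_cos// sqr_sqrtr// [v * _]mulrC.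
Qed.

Section model_probabilities.
Context d (T : measurableType d) (R : realType) (P : probability T R) (m : nat).
Variables (pi1 : R) (H : 'I_m -> {RV P >-> bool}) (eps : 'I_m -> {RV P >-> R}) (G : 'M[R]_m).
Hypothesis pi101 : 0 < pi1 < 1.
Hypothesis model : two_group_model pi1 H eps G.

Let prior (b : bool) : R := if b then pi1 else 1 - pi1.

Let Hev i b : set T := [set w | H i w = b].
Let tail i z : set T := [set w | z <= eps i w].

Let mHev i b : measurable (Hev i b).
Proof.
have := @measurable_funPTI _ _ _ _ (H i) [set b] I.
by congr measurable.
Qed.

Let mtail i z : measurable (tail i z).
Proof.
have := @measurable_funPTI _ _ _ _ (eps i) `[z, +oo[%classic (measurable_itv _).
by congr measurable; apply/seteqP; split => w; rewrite /= in_itv/= andbT.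
Qed.

Let gen_H i b : sigma_generated H setT (Hev i b).
Proof. by apply: sub_gen_smallest; exists i => //; exists [set b] => //; rewrite setTI. Qed.

Let gen_tail i z : sigma_generated eps setT (tail i z).
Proof.
apply: sub_gen_smallest; exists i => //; exists `[z, +oo[%classic => //.
by rewrite setTI; apply/seteqP; split => w; rewrite /= in_itv/= andbT.
Qed.

Let prob_prior i b : P (Hev i b) = (prior b)%:E.
Proof.
have [dH _ _ _ _] := model.
have -> : P (Hev i b) = distribution P (H i) [set b] by [].
have p01 : 0 <= pi1 <= 1 by have /andP[/ltW -> /ltW ->] := pi101.
have tE : (true \in [set b]) = b by case: b; [exact: mem_set|exact: memNset].
have fE : (false \in [set b]) = ~~ b by case: b {tE}; [exact: memNset|exact: mem_set].
rewrite dH bernoulli_probE// !diracE tE fE /prior; case: b {tE fE} => /=.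
  by rewrite mule1 mule0 adde0.
by rewrite mule1 mule0 add0e.
Qed.

Lemma gauss_lincomb2 i j a b c : i != j ->
  mean P (fun w => cos (a * eps i w + b * eps j w + c)) =
  expR (- ((a ^+ 2 + 2 * a * b * G i j + b ^+ 2) / 2)) * cos c.
Proof.
move=> ij; have [_ _ _ [Gsym Gdiag Gpos] gauss] := model.
pose v : 'rV[R]_m := a *: delta_mx 0 i + b *: delta_mx 0 j.
have vE : (v *m G *m v^T) 0 0 = a ^+ 2 + 2 * a * b * G i j + b ^+ 2.
  by rewrite quad_lincomb2// !Gdiag !mulr1.
have sumE w : \sum_k v 0 k * eps k w = a * eps i w + b * eps j w.
  rewrite (bigD1 i)//= (bigD1 j)/=; last by rewrite eq_sym.
  rewrite big1 => [|k /andP[ki kj]].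
    rewrite addr0 !mxE !eqxx/= (negbTE ij) eq_sym (negbTE ij).
    by rewrite !mulr1 !mulr0 addr0 add0r.
  by rewrite !mxE eqxx/= (negbTE ki) (negbTE kj) !mulr0 addr0 mul0r.
have [mu muE muc] := mean_normal_law_cos (Gpos v).
have := @mean_law R _ T P (fun w => a * eps i w + b * eps j w) mu (fun x => cos (1 * x + c)).
rewrite (_ : (fun w => cos (1 * _ + _)) = (fun w => cos (a * eps i w + b * eps j w + c))); last first.
  by apply/funext => w; rewrite mul1r.
move=> ->.
- by rewrite muc vE expr1n mul1r.
- by apply: measurable_funD; apply: measurable_funM => //; exact: measurable_cst.
- move=> B mB; rewrite muE -gauss//; congr (P _).
  by rewrite (_ : (fun w => \sum_k v 0 k * eps k w) = (fun w => a * eps i w + b * eps j w))//; apply/funext.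
- by apply: brv_cos; apply: measurable_funD => //; exact: measurable_funM.
Qed.

Lemma prob_gauss_tail i z : prob P (tail i z) = Phibar z%:E.
Proof.
have [_ _ _ [Gsym Gdiag Gpos] gauss] := model.
have vE : ((delta_mx 0 i : 'rV[R]_m) *m G *m (delta_mx 0 i : 'rV[R]_m)^T) 0 0 = 1.
  by rewrite trmx_delta delta_quad Gdiag.
have sumE w : \sum_k (delta_mx 0 i : 'rV[R]_m) 0 k * eps k w = eps i w.
  rewrite (bigD1 i)//= big1 => [|k ki].
    by rewrite addr0 !mxE !eqxx mul1r.
  by rewrite !mxE eqxx/= (negbTE ki) mul0r.
rewrite Phibar_prob /prob; congr fine.
have := gauss (delta_mx 0 i) `[z, +oo[%classic (measurable_itv _).
rewrite vE /normal_law oner_eq0 sqrtr1 => h.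
transitivity (P ((fun w => \sum_k (delta_mx 0 i : 'rV[R]_m) 0 k * eps k w) @^-1` `[z, +oo[%classic)).
  congr (P _); apply/seteqP; split => w; by rewrite /= in_itv/= andbT sumE.
by rewrite h; congr normal_prob; apply/seteqP; split => w; rewrite /= in_itv/= andbT.
Qed.

Lemma prob_prior_tail i b z : prob P [set w | H i w = b /\ z <= eps i w] =
  (if b then pi1 else 1 - pi1) * Phibar z%:E.
Proof.
have [_ _ ind _ _] := model.
rewrite -(prob_gauss_tail i) -/(prior b) /prob.
have -> : [set w | H i w = b /\ z <= eps i w] = Hev i b `&` tail i z by [].
by rewrite ind// fineM ?fin_num_measure// prob_prior.
Qed.

Lemma prob_null_tail2 i j z : i != j ->
  prob P ([set w | H i w = false /\ z <= eps i w] `&` [set w | H j w = false /\ z <= eps j w]) =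
  (1 - pi1) ^+ 2 * (rho_tilde (Phibar z%:E) (Phibar z%:E) (G i j) + Phibar z%:E ^+ 2).
Proof.
move=> ij; have [_ mut ind [Gsym Gdiag Gpos] gauss] := model.
have -> : [set w | H i w = false /\ z <= eps i w] `&` [set w | H j w = false /\ z <= eps j w] =
    (Hev i false `&` Hev j false) `&` (tail i z `&` tail j z).
  by apply/seteqP; split => w [[? ?] [? ?]].
have PH : P (Hev i false `&` Hev j false) = ((1 - pi1) ^+ 2)%:E.
  (* The full set at all other indices extracts the pair from joint independence. *)
  pose B k : set bool := if (k == i) || (k == j) then [set false] else setT.
  have -> : Hev i false `&` Hev j false = \bigcap_k (H k @^-1` B k).
    apply/seteqP; split => [w [hi hj] k _|w h].
      by rewrite /B/=; case: eqVneq => [->//|_]; case: eqVneq => [->|].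
    split; first by have := h i Logic.I; rewrite /B eqxx.
    by have := h j Logic.I; rewrite /B eqxx orbT.
  rewrite mut//.
  rewrite (bigD1 i)//= (bigD1 j)/=; last by rewrite eq_sym.
  rewrite big1 => [|k /andP[ki kj]].
    rewrite mule1 /B !eqxx orbT/= expr2 EFinM.
    by congr (_ * _)%E; [exact: (prob_prior i false)|exact: (prob_prior j false)].
  by rewrite /B (negbTE ki) (negbTE kj)/= preimage_setT probability_setT.
have gH : sigma_generated H setT (Hev i false `&` Hev j false).
  exact: (@measurableI _ (g_sigma_algebraType (\bigcup_(i in setT) preimage_set_system setT (H i) measurable)) _ _ (gen_H i false) (gen_H j false)).
have ge : sigma_generated eps setT (tail i z `&` tail j z).
  exact: (@measurableI _ (g_sigma_algebraType (\bigcup_(i in setT) preimage_set_system setT (eps i) measurable)) _ _ (gen_tail i z) (gen_tail j z)).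
rewrite /prob ind// PH fineM ?fin_num_measure//; last by exact: measurableI.
congr (_ * _); rewrite /rho_tilde !Phibar_inv_eq expr2 subrK.
(* The form [G] takes the value [1 - (G i j)^2] at the vector [e_i - (G i j) e_j]. *)
have rho1 : G i j ^+ 2 <= 1.
  have := Gpos (1 *: delta_mx 0 i + - G i j *: delta_mx 0 j).
  by rewrite quad_lincomb2// !Gdiag; nra.
rewrite -(@prob_quadrant_gaussian _ _ _ P (eps i) (eps j))//.
by move=> a b c; exact: gauss_lincomb2.
Qed.

End model_probabilities.

(** * Localisation of the threshold and oscillation near it *)

Section chebyshev_union.
Context d (T : measurableType d) (R : realType) (P : probability T R).

Lemma chebyshev_union (n : nat) (p : pred nat) (f : nat -> T -> R) (e v : nat -> R) :
  (forall k, p k -> 0 < e k) -> (forall k, p k -> bounded_rv (f k)) ->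
  (forall k, p k -> mean P (fun w => f k w ^+ 2) <= v k) ->
  exists2 D : set T, measurable D /\ prob P D <= \sum_(k < n | p k) v k / e k ^+ 2 &
    forall w, ~ D w -> forall k, (k < n)%N -> p k -> `|f k w| < e k.
Proof.
move=> e0 bf fv; pose A k : set T := if p k then [set w | e k <= `|f k w|] else set0.
have mA k : measurable (A k).
  rewrite /A; case: ifP => // pk; by apply: measurable_set_le => //; have [] := brv_norm (bf k pk).
exists (\big[setU/set0]_(k < n | p k) A k).
  split; first exact: bigsetU_measurable.
  apply: (le_trans (prob_bigU _ _ _ _)) => //; apply: ler_sum => k pk.
  rewrite /A pk; apply: (le_trans (chebyshev_sqr P (e0 _ pk) (bf _ pk))).
  by rewrite ler_wpM2r ?fv// invr_ge0 sqr_ge0.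
move=> w nD k kn pk; rewrite ltNge; apply/negP => ek; apply: nD.
rewrite (bigD1 (Ordinal kn))//=; left; rewrite /A pk; exact: ek.
Qed.

End chebyshev_union.

(** Telescoping, from [1 / (x + 1)^2 <= 1 / x - 1 / (x + 1)]. The bound does not see [n], so the
    union bound may run over a grid whose size grows with [m]. *)
Lemma sum_inv_sqr_le (R : realType) (J n : nat) : (0 < J)%N ->
  \sum_(k < n) (J + k.+1)%:R ^- 2 <= J%:R^-1 :> R.
Proof.
move=> J0; suff : \sum_(k < n) (J + k.+1)%:R ^- 2 <= J%:R^-1 - (J + n)%:R^-1 :> R.
  by move=> /le_trans; apply; rewrite lerBlDr lerDl invr_ge0.
elim: n => [|n IH]; first by rewrite big_ord0 addn0 subrr.
rewrite big_ord_recr/=; apply: (le_trans (lerD IH (lexx _))).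
set x := (J + n)%:R : R; have x0 : 0 < x by rewrite ltr0n addn_gt0 J0.
have -> : (J + n.+1)%:R = x + 1 :> R by rewrite addnS -natr1.
have x1 : 0 < x + 1 by rewrite addr_gt0.
rewrite -subr_ge0; move: (J%:R^-1) {IH} => y; clearbody x.
have -> : y - (x + 1)^-1 - (y - x^-1 + (x + 1) ^- 2) = (x * (x + 1) ^+ 2)^-1.
  by field; rewrite !gt_eqF.
by rewrite invr_ge0 mulr_ge0// ?sqr_ge0// ltW.
Qed.

Section localisation.
Context d (T : measurableType d) (R : realType) (P : probability T R).
Variables (m : nat) (N : R -> T -> R) (G : R -> R) (that : T -> R).
Variables (q tau s0 c K : R).
Hypotheses (m0 : (0 < m)%N) (q0 : 0 < q) (tau01 : 0 < tau < 1) (c0 : 0 < c) (s00 : 0 < s0).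
Hypothesis N_mono : forall s t w, s <= t -> N s w <= N t w.

Let U t w := (Num.sqrt m%:R)^-1 * (N t w - m%:R * G t).

Hypothesis bU : forall t, 0 < t < 1 -> bounded_rv (U t).
Hypothesis U2 : forall t, 0 < t < 1 -> mean P (fun w => U t w ^+ 2) <= K.
Hypothesis that_q : forall w, that w <= q.
Hypothesis that_fix : forall w, N (that w) w = m%:R * that w / q.
Hypothesis that_ge : forall t w, t * m%:R / q <= N t w -> t <= that w.
Hypothesis slope_right : forall t, tau <= t < 1 -> G t - t / q <= - c * (t - tau).
Hypothesis slope_left : forall t, s0 <= t <= tau -> c * (tau - t) <= G t - t / q.

(** On the left one grid point is enough: a large count there already puts [that] to its right. On
    the right [that] may be anywhere, and a whole grid of mesh [1 / sqrt m] is examined;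
    monotonicity of [N] carries the fixed-point equation from [that] to the next grid point. The
    factor 5 is 1 for the left point and 4 for the halved thresholds on the right. *)
Lemma threshold_localisation (J : nat) : (0 < J)%N ->
  s0 <= tau - J%:R / Num.sqrt m%:R -> q + (Num.sqrt m%:R)^-1 < 1 ->
  q^-1 <= c * J%:R / 2 ->
  exists2 D : set T, measurable D /\ prob P D <= K * 5 / (c ^+ 2 * J%:R) &
    forall w, ~ D w -> `|that w - tau| <= J%:R / Num.sqrt m%:R.
Proof.
move=> J0 s0J qm qJ; set r := Num.sqrt m%:R in s0J qm *.
have mR : 0 < m%:R :> R by rewrite ltr0n.
have r0 : 0 < r by rewrite sqrtr_gt0.
have rr : r * r = m%:R by rewrite -expr2 sqr_sqrtr// ltW.
have rV0 : 0 < r^-1 by rewrite invr_gt0.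
have JR : 0 < J%:R :> R by rewrite ltr0n.
have /andP[t0 t1] := tau01.
have K0 : 0 <= K by apply: le_trans (U2 tau01); apply: mean_ge0 => w; exact: sqr_ge0.
pose tl := tau - J%:R / r.
pose tr k := tau + (J + k.+1)%:R / r.
have tl01 : 0 < tl < 1.
  by rewrite (lt_le_trans s00 s0J)/= /tl ltrBlDr (lt_le_trans t1)// lerDl divr_ge0// ltW.
have tr0 k : tau <= tr k by rewrite lerDl divr_ge0// ltW.
have trp k : 0 < tr k by exact: lt_le_trans (tr0 k).
have cJ0 : 0 < c * J%:R by exact: mulr_gt0.
have [D1 [mD1 pD1] nD1] := @chebyshev_union _ _ _ P 1 predT (fun=> U tl) (fun=> c * J%:R) (fun=> K)
  (fun _ _ => cJ0) (fun _ _ => bU tl01) (fun _ _ => U2 tl01).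
(* Half of the drift at the grid point; the other half absorbs the [1 / q] lost in moving from
   [that] to the grid. *)
pose e k := c * (J + k.+1)%:R / 2.
have e0 k : 0 < e k by rewrite /e divr_gt0// mulr_gt0// ltr0n addn_gt0 J0.
have [D2 [mD2 pD2] nD2] := @chebyshev_union _ _ _ P (m + m) (fun k => tr k < 1) (fun k => U (tr k)) e (fun=> K)
  (fun k _ => e0 k) (fun k tk => bU (introT andP (conj (trp k) tk)))
  (fun k tk => U2 (introT andP (conj (trp k) tk))).
exists (D1 `|` D2).
  split; first exact: measurableU.
  apply: (le_trans (prob_setU P mD1 mD2)).
  have h1 : prob P D1 <= K / (c ^+ 2 * J%:R).
    apply: (le_trans pD1); rewrite big_ord1 exprMn ler_wpM2l// lef_pV2 ?posrE ?mulr_gt0 ?exprn_gt0//.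
    rewrite ler_wpM2l ?sqr_ge0// expr2 ler_peMr// ?ler1n// ltW.
  have h2 : prob P D2 <= 4 * K / (c ^+ 2 * J%:R).
    apply: (le_trans pD2); apply: (@le_trans _ _ (\sum_(k < m + m) 4 * K / c ^+ 2 * (J + k.+1)%:R ^- 2)).
      rewrite big_mkcond; apply: ler_sum => k _.
      have jk : 0 < (J + k.+1)%:R :> R by rewrite ltr0n addn_gt0 J0.
      have -> : K / e k ^+ 2 = 4 * K / c ^+ 2 * (J + k.+1)%:R ^- 2.
        by rewrite /e; field; rewrite !gt_eqF.
      case: ifP => // _.
      by apply: mulr_ge0; [apply: divr_ge0; [exact: mulr_ge0|exact: sqr_ge0]|rewrite invr_ge0 sqr_ge0].
    rewrite -mulr_sumr.
    have h : 0 <= 4 * K / c ^+ 2 by apply: divr_ge0; [exact: mulr_ge0|exact: sqr_ge0].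
    apply: (le_trans (ler_wpM2l h (sum_inv_sqr_le R (m + m) J0))).
    by rewrite [(c ^+ 2 * _)^-1]invfM mulrA.
  rewrite (_ : K * 5 / _ = K / (c ^+ 2 * J%:R) + 4 * K / (c ^+ 2 * J%:R)) ?lerD//.
  by field; rewrite !gt_eqF.
move=> w nD; have n1 : ~ D1 w by move=> h; apply: nD; left.
have n2 : ~ D2 w by move=> h; apply: nD; right.
rewrite ler_distl; apply/andP; split.
  apply: that_ge; rewrite leNgt; apply/negP => Nt.
  have := nD1 w n1 0%N isT isT; apply/negP; rewrite -leNgt -normrN.
  apply: (le_trans _ (ler_norm _)).
  rewrite /U -mulrN opprB -ler_pdivrMl ?invrK ?rV0//.
  have sl : c * (J%:R / r) <= G tl - tl / q.
    apply: le_trans (slope_left _); last by rewrite s0J lerBlDr lerDl divr_ge0// ltW.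
    by rewrite /tl opprB addrC subrK.
  have h : m%:R * (c * (J%:R / r)) <= m%:R * (G tl - tl / q) by rewrite ler_wpM2l// ltW.
  have -> : r * (c * J%:R) = m%:R * (c * (J%:R / r)) by rewrite -rr; field; rewrite gt_eqF.
  apply: (le_trans h); rewrite mulrBr lerD2l lerNl opprK.
  have -> : m%:R * (tl / q) = (tau - J%:R / r) * m%:R / q by rewrite /tl; ring.
  exact: ltW.
rewrite leNgt; apply/negP => Jt.
pose x := (that w - tau) * r - J%:R.
have x0 : 0 < x.
  by rewrite subr_gt0 -ltr_pdivrMr// ltrBrDl.
pose k := Num.truncn x.
have /andP[kx xk] : k%:R <= x < k.+1%:R by apply: truncn_itv; exact: ltW.
have thatE : that w = tau + (J%:R + x) / r by rewrite /x; field; rewrite gt_eqF.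
have tk1 : that w <= tr k.
  by rewrite thatE lerD2l ler_wpM2r ?(ltW rV0)// natrD lerD2l ltW.
have tk0 : tr k - r^-1 <= that w.
  rewrite thatE /tr -addrA lerD2l -[X in _ - X]mul1r -mulrBl ler_wpM2r ?(ltW rV0)//.
  by rewrite natrD -natr1 addrA addrK lerD2l.
(* As [that <= q], the next grid point is at most [q + 1 / sqrt m], within the range of the variance
   bound. *)
have trk1 : tr k < 1.
  by apply: le_lt_trans qm; rewrite -lerBlDr (le_trans tk0).
have km : (k < m + m)%N.
  have xr : x < r.
    have : (that w - tau) * r < r.
      rewrite gtr_pMl// ltrBlDr (le_lt_trans (that_q w))//.
      by rewrite (lt_trans _ (lt_trans qm _)) ?ltrDl.
    by move=> /(le_lt_trans _); apply; rewrite lerBlDr lerDl ltW.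
  rewrite -(ltr_nat R) (le_lt_trans kx)// (lt_le_trans xr)//.
  rewrite natrD -rr; have : r * r >= 1 by rewrite rr ler1n.
  nra.
have := nD2 w n2 k km trk1; apply/negP; rewrite -leNgt.
apply: (le_trans _ (ler_norm _)); rewrite /U -ler_pdivrMl ?invrK ?rV0//.
have sr := slope_right (introT andP (conj (tr0 k) trk1)).
have Nk : m%:R * (tr k - r^-1) / q <= N (tr k) w.
  apply: (@le_trans _ _ (N (that w) w)); last exact: N_mono.
  by rewrite that_fix ler_wpM2r ?invr_ge0 ?(ltW q0)// ler_wpM2l// ltW.
have h : m%:R * G (tr k) <= m%:R * (tr k / q - c * (tr k - tau)).
  by rewrite ler_wpM2l ?(ltW mR)//; move: sr; rewrite mulNr; lra.
apply: (@le_trans _ _ (m%:R * (tr k - r^-1) / q - m%:R * (tr k / q - c * (tr k - tau)))).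
  have -> : m%:R * (tr k - r^-1) / q - m%:R * (tr k / q - c * (tr k - tau)) =
      r * (c * (J + k.+1)%:R - q^-1).
    by rewrite /tr -rr; field; rewrite !gt_eqF.
  rewrite ler_pM2l// lerBrDr /e; set y := (J + k.+1)%:R.
  have cy : c * J%:R <= c * y by rewrite ler_pM2l// ler_nat leq_addr.
  lra.
by rewrite lerB.
Qed.

End localisation.

Section oscillation.
Context d (T : measurableType d) (R : realType) (P : probability T R).
Variables (m : nat) (V : R -> T -> R) (pi0 tau K : R).
Hypotheses (m0 : (0 < m)%N) (pi001 : 0 <= pi0 <= 1).
Hypothesis V_mono : forall (s t : R) w, s <= t -> V s w <= V t w.

Let W (t : R) (w : T) : R := (Num.sqrt m%:R)^-1 * (V t w - m%:R * (pi0 * t)).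

Hypothesis bW : forall t : R, 0 < t < 1 -> bounded_rv (W t).
Hypothesis W2 : forall s t : R, 0 < s -> s <= t -> t < 1 ->
  mean P (fun w => (W t w - W s w) ^+ 2) <= Num.sqrt (t - s) * K.

(** The count increases, so [W] can fall only through its centring, whose slope is at most
    [sqrt m]. *)
Lemma centered_count_increment (s t : R) w : s <= t ->
  W s w - W t w <= Num.sqrt m%:R * (t - s).
Proof.
move=> st; set r := Num.sqrt m%:R.
have mR : 0 < m%:R :> R by rewrite ltr0n.
have r0 : 0 < r by rewrite sqrtr_gt0.
have rr : r * r = m%:R by rewrite -expr2 sqr_sqrtr// ltW.
rewrite /W -mulrBr ler_pdivrMl// [leRHS]mulrA rr.
have /andP[p0 p1] := pi001; have := V_mono w st.
have : m%:R * (pi0 * (t - s)) <= m%:R * (t - s).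
  by rewrite ler_pM2l// ler_piMl// subr_ge0.
rewrite !mulrBr; lra.
Qed.

(** The window has [2 L + 1] points with spacing [dl / sqrt m], a number free of [m]. Between
    neighbours [W] falls by at most [dl], which bounds [W t] below by the left neighbour and above
    by the right one. *)
Lemma oscillation_bound (L : nat) (dl eta : R) : 0 < dl -> dl <= eta ->
  0 < tau - L%:R * dl / Num.sqrt m%:R -> tau + L%:R * dl / Num.sqrt m%:R < 1 ->
  exists2 D : set T, measurable D /\
    prob P D <= (L + L).+1%:R * (Num.sqrt (L%:R * dl / Num.sqrt m%:R) * K / eta ^+ 2) &
    forall w, ~ D w -> forall t, `|t - tau| <= L%:R * dl / Num.sqrt m%:R ->
      `|W t w - W tau w| <= 2 * eta.
Proof.
move=> dl0 dle tl tr; set r := Num.sqrt m%:R in tl tr *.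
have mR : 0 < m%:R :> R by rewrite ltr0n.
have r0 : 0 < r by rewrite sqrtr_gt0.
have rV0 : 0 < r^-1 by rewrite invr_gt0.
have eta0 : 0 < eta by exact: lt_le_trans dle.
have dr0 : 0 < dl / r by exact: mulr_gt0.
have Ldr : 0 <= L%:R * dl / r by rewrite -mulrA mulr_ge0// ltW.
have tau01 : 0 < tau < 1.
  by rewrite (lt_le_trans tl) ?lerBlDr ?lerDl// (le_lt_trans _ tr)// lerDl.
have K0 : 0 <= K.
  have /andP[t0 t1] := tau01.
  pose s := tau / 2.
  have s0 : 0 < s by rewrite divr_gt0.
  have st : s < tau by rewrite /s; lra.
  have h := W2 s0 (ltW st) t1.
  have sq : 0 < Num.sqrt (tau - s) by rewrite sqrtr_gt0 subr_gt0.
  rewrite -(pmulr_rge0 _ sq); apply: le_trans h; apply: mean_ge0 => w; exact: sqr_ge0.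
pose s k := tau + (k%:R - L%:R) * (dl / r).
have sB k : (k <= L + L)%N -> `|s k - tau| <= L%:R * dl / r.
  move=> kL; rewrite /s addrC addKr normrM (gtr0_norm dr0) -mulrA ler_wpM2r ?(ltW dr0)//.
  rewrite ler_norml lerBrDl subrr ler0n/= lerBlDl -natrD ler_nat//.
have s01 k : (k <= L + L)%N -> 0 < s k < 1.
  move=> kL; have := sB k kL; rewrite ler_distl => /andP[h1 h2].
  by rewrite (lt_le_trans tl h1) (le_lt_trans h2 tr).
have var k : (k <= L + L)%N -> mean P (fun w => (W (s k) w - W tau w) ^+ 2) <=
    Num.sqrt (L%:R * dl / r) * K.
  move=> kL; have /andP[sk0 sk1] := s01 k kL; have := sB k kL => skB.
  have /andP[t0 t1] := tau01.
  have [st|ts] := leP tau (s k).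
    apply: (le_trans (W2 t0 st sk1)); rewrite ler_wpM2r// ler_wsqrtr//.
    by apply: le_trans skB; exact: ler_norm.
  under eq_fun do rewrite -sqrrN opprB.
  apply: (le_trans (W2 sk0 (ltW ts) t1)); rewrite ler_wpM2r// ler_wsqrtr//.
  by apply: le_trans skB; rewrite distrC; exact: ler_norm.
have bD k : (k <= L + L)%N -> bounded_rv (fun w => W (s k) w - W tau w).
  by move=> kL; apply: brvB; apply: bW => //; exact: s01.
have [D [mD pD] nD] := @chebyshev_union _ _ _ P (L + L).+1 (fun k => k <= L + L)%N
  (fun k w => W (s k) w - W tau w) (fun=> eta) _ (fun _ _ => eta0) bD var.
exists D.
  split => //; apply: (le_trans pD); rewrite (eq_bigl xpredT); last first.
    by move=> k; rewrite -ltnS ltn_ord.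
  by rewrite sumr_const card_ord -[leLHS]mulr_natl.
move=> w /nD{}nD t tB.
pose x := (t - tau) / (dl / r) + L%:R.
have tE : t = tau + (x - L%:R) * (dl / r).
  by rewrite /x addrK divfK ?gt_eqF// addrC subrK.
have xB : 0 <= x <= (L + L)%:R.
  have : `|(t - tau) / (dl / r)| <= L%:R.
    by rewrite normrM normfV (gtr0_norm dr0) ler_pdivrMr// mulrA.
  rewrite ler_norml /x natrD => /andP[]; lra.
have /andP[x0 xL] := xB.
(* The cap covers [t] at the right end of the window, which has no neighbour further right. *)
pose k := Num.truncn x; pose k' := minn k.+1 (L + L).
have /andP[kx xk] : k%:R <= x < k.+1%:R by apply: truncn_itv.
have kL : (k <= L + L)%N by rewrite -(ler_nat R) (le_trans kx).
have k'L : (k' <= L + L)%N by rewrite geq_minr.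
have xk' : x <= k'%:R by rewrite /k' /minn; case: ifP => // _; exact: ltW.
have k'x : k'%:R <= x + 1.
  by rewrite (@le_trans _ _ k.+1%:R) ?ler_nat ?geq_minl// -natr1 lerD2r.
have st : s k <= t by rewrite tE lerD2l ler_wpM2r ?(ltW dr0)// lerD2r.
have ts : t <= s k' by rewrite tE lerD2l ler_wpM2r ?(ltW dr0)// lerD2r.
have st1 : r * (t - s k) <= dl.
  rewrite tE /s opprD addrACA subrr add0r -mulrBl opprB addrA subrK.
  have -> : r * ((x - k%:R) * (dl / r)) = (x - k%:R) * dl by field; rewrite gt_eqF.
  by rewrite ler_piMl ?(ltW dl0)// lerBlDl natr1 ltW.
have ts1 : r * (s k' - t) <= dl.
  rewrite tE /s opprD addrACA subrr add0r -mulrBl opprB addrA subrK.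
  have -> : r * ((k'%:R - x) * (dl / r)) = (k'%:R - x) * dl by field; rewrite gt_eqF.
  by rewrite ler_piMl ?(ltW dl0)// lerBlDl.
have := nD k kL kL; have := nD k' k'L k'L; rewrite !ltr_norml.
have := centered_count_increment w st; have := centered_count_increment w ts.
rewrite -/r ler_norml; lra.
Qed.

End oscillation.

(** * Algebra of the centred false discovery proportion *)

Lemma sum_indic_card (R : pzRingType) (T : Type) (I : finType) (A : I -> set T) (a : pred I) (w : T) :
  (forall i, A i w <-> a i) -> \sum_i \1_(A i) w = #|a|%:R :> R.
Proof.
move=> Aa; rewrite -sum1_card natr_sum [RHS]big_mkcond/=; apply: eq_bigr => i _.
rewrite indicE -[i \in a]/(a i); case: ifPn => ai; first by rewrite mem_set//; apply/Aa.
by rewrite memNset// => /Aa; rewrite (negbTE ai).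
Qed.

Lemma near_mul_invr_sqrt (R : realType) (u v : R) : 0 < u -> 0 < v ->
  \forall m \near \oo, u * (Num.sqrt m%:R)^-1 < v.
Proof.
move=> u0 v0; exists (Num.truncn ((u / v) ^+ 2)).+1 => // m /= Nm.
have h : (u / v) ^+ 2 < m%:R by rewrite (lt_le_trans (truncnS_gt _))// ler_nat.
have m0 : 0 < m%:R :> R by apply: le_lt_trans h; exact: sqr_ge0.
rewrite ltr_pdivrMr ?sqrtr_gt0// mulrC -ltr_pdivrMr//.
by rewrite -[ltLHS]gtr0_norm ?divr_gt0// -sqrtr_sqr ltr_sqrt.
Qed.

(** An exact identity: because [m * that] equals [R q], subtracting [pi0 * q] from [V / R] centres
    [V] precisely at [m * (pi0 * that)]. *)
Lemma FDP_centered (R : realType) (m : nat) (q pi0 : R) (p : 'I_m -> R) (h : 'I_m -> bool) :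
  (0 < m)%N -> 0 < q -> (0 < BH_rejections q p)%N ->
  let that := (BH_rejections q p)%:R * q / m%:R in
  Num.sqrt m%:R * (FDP q p h - pi0 * q) = q / that *
    ((Num.sqrt m%:R)^-1 * (#|[pred i | (p i <= that) && ~~ h i]|%:R - m%:R * (pi0 * that))).
Proof.
move=> m0 q0 r0 /=; rewrite FDPE// (maxn_idPl r0).
set n := #|_|; set r := BH_rejections q p in r0 n *.
have mR : 0 < m%:R :> R by rewrite ltr0n.
have rR : 0 < r%:R :> R by rewrite ltr0n.
have sm : 0 < Num.sqrt m%:R :> R by rewrite sqrtr_gt0.
move: mR (sqr_sqrtr (ltW mR)) sm; rewrite (_ : n%:R = n%:R :> R)//.
move: (m%:R) (n%:R) (r%:R) rR => x y z z0 x0; set s := Num.sqrt x => sx s0.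
by rewrite -sx; field; rewrite !gt_eqF.
Qed.

Lemma ratio_perturbation (R : realType) (q tau t w w0 dl h L : R) :
  0 < q -> 0 < tau -> `|t - tau| <= dl -> dl <= tau / 2 -> `|w - w0| <= h -> `|w0| <= L ->
  `|q / t * w - q / tau * w0| <= 2 * q / tau * h + 2 * q / tau ^+ 2 * dl * L.
Proof.
move=> q0 tau0 tdl dlt wh w0L.
have t2 : tau / 2 <= t by move: tdl; rewrite ler_distl; lra.
have t0 : 0 < t by apply: lt_le_trans t2; rewrite divr_gt0.
have tV : t^-1 <= 2 / tau by rewrite -[leRHS]invrK lef_pV2 ?posrE ?invr_gt0 ?divr_gt0// invf_div.
have -> : q / t * w - q / tau * w0 = q / t * (w - w0) + q * (tau - t) / (t * tau) * w0.
  by field; rewrite !gt_eqF.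
have h0 : 0 <= h by exact: le_trans wh.
have dl0 : 0 <= dl by exact: le_trans tdl.
apply: (le_trans (ler_normD _ _)); apply: lerD.
  rewrite normrM; apply: ler_pM => //; rewrite gtr0_norm ?divr_gt0//.
  by rewrite [2 * q]mulrC -mulrA ler_pM2l.
rewrite normrM; apply: ler_pM => //.
rewrite normrM normrM (gtr0_norm q0) normfV (gtr0_norm (mulr_gt0 t0 tau0)) (invfM t tau) (distrC tau).
have -> : 2 * q / tau ^+ 2 * dl = q * dl * (2 / tau / tau) by field; rewrite gt_eqF.
apply: ler_pM => //; first by rewrite mulr_ge0// ltW.
- by rewrite mulr_ge0// invr_ge0 ltW.
- by rewrite ler_pM2l.
- by rewrite ler_pM2r ?invr_gt0.
Qed.

Lemma sum_centered (R : pzRingType) m (f : 'I_m -> R) (s : R) :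
  \sum_i (f i - s) = \sum_i f i - m%:R * s.
Proof. by rewrite sumrB sumr_const card_ord mulr_natl. Qed.

(** * Mixing coefficients and the null process of the array *)

Section triangular_array.
Context (R : realType) (d : nat -> measure_display)
  (T : forall m, measurableType (d m)) (P : forall m, probability (T m) R).
Variables (H : forall m, 'I_m -> {RV (P m) >-> bool})
  (eps : forall m, 'I_m -> {RV (P m) >-> R}) (Gamma : forall m, 'M[R]_m).

(* sigma_past n = <<s past_generators n>> and, indices starting at 0,
   sigma_future n.+1 = <<s future_generators n>>. *)
Definition past_generators m (n : nat) : set (set (T m)) :=
  \bigcup_(i in [set i : 'I_m | (i.+1 <= n)%N])
    preimage_set_system setT (xi (@H m) (@eps m) i) measurable.
Definition future_generators m (n : nat) : set (set (T m)) :=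
  \bigcup_(i in [set i : 'I_m | (n.+1 <= i.+1)%N])
    preimage_set_system setT (xi (@H m) (@eps m) i) measurable.

Lemma measurable_xi m (i : 'I_m) : measurable_fun setT (xi (@H m) (@eps m) i).
Proof. by apply: measurable_fun_pair. Qed.

Lemma measurable_past m n : past_generators n `<=` (measurable : set (set (T m))).
Proof. by move=> _ [i _] [B mB <-]; exact: measurable_xi. Qed.

Lemma measurable_future m n : future_generators n `<=` (measurable : set (set (T m))).
Proof. by move=> _ [i _] [B mB <-]; exact: measurable_xi. Qed.

Let al := alpha_mixing P H eps.

Lemma alpha_element_le1 m n k (A0 A1 : set (T m)) :
  sigma_past (@H m) (@eps m) n A0 -> sigma_future (@H m) (@eps m) k A1 ->
  `|prob (P m) (A0 `&` A1) - prob (P m) A0 * prob (P m) A1| <= 1.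
Proof.
move=> h0 h1.
have m0 : measurable A0 by move: h0; apply: sub_sigma_measurable; exact: measurable_past.
have m1 : measurable A1.
  by move: h1; apply: sub_sigma_measurable => _ [i _] [B mB <-]; exact: measurable_xi.
have mI := measurableI _ _ m0 m1.
have := prob_ge0 (P m) A0; have := prob_ge0 (P m) A1; have := prob_ge0 (P m) (A0 `&` A1).
have := prob_le1 (P m) m0; have := prob_le1 (P m) m1; have := prob_le1 (P m) mI.
by move=> *; rewrite ler_norml; nra.
Qed.

(** The supremum in [alpha_mixing] has a default value for empty or unbounded sets; only with this
    does it bound its elements. *)
Lemma alpha_has_sup k : has_sup [set x : R | exists n m A0 A1,
    [/\ (0 < n)%N, (0 < m)%N,
        sigma_past (@H m) (@eps m) n A0,
        sigma_future (@H m) (@eps m) (n + k) A1 &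
        x = `|fine (P m (A0 `&` A1)) - fine (P m A0) * fine (P m A1)| ] ].
Proof.
split.
  exists `|fine (P 1%N (set0 `&` set0)) - fine (P 1%N set0) * fine (P 1%N set0)|.
  exists 1%N, 1%N, set0, set0; split => //.
    by have [] := @smallest_sigma_algebra _ setT (past_generators 1 : set (set (T 1%N))).
  by have [] := @smallest_sigma_algebra _ setT (\bigcup_(i in [set i : 'I_1 | (1 + k <= i.+1)%N])
    preimage_set_system setT (xi (@H 1) (@eps 1) i) measurable).
by exists 1 => _ [n [m [A0 [A1 [_ _ h0 h1 ->]]]]]; exact: (alpha_element_le1 h0 h1).
Qed.

Lemma alpha_mix m n k (A0 A1 : set (T m)) : (0 < m)%N -> (0 < n)%N ->
  <<s past_generators n >> A0 -> <<s future_generators (n + k) >> A1 ->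
  `|prob (P m) (A0 `&` A1) - prob (P m) A0 * prob (P m) A1| <= al k.+1.
Proof.
move=> m0 n0 h0 h1; apply: ub_le_sup; first exact: (alpha_has_sup k.+1).2.
exists n, m, A0, A1; split => //.
by rewrite addnS; exact: h1.
Qed.

Lemma alpha01 k : 0 <= al k <= 1.
Proof.
have [[x Ax] ub] := alpha_has_sup k; apply/andP; split.
  apply: (@le_trans _ _ x); last exact: ub_le_sup.
  by case: Ax => n [m [A0 [A1 [_ _ _ _ ->]]]].
apply: ge_sup; first by exists x.
by move=> _ [n [m [A0 [A1 [_ _ h0 h1 ->]]]]]; exact: (alpha_element_le1 h0 h1).
Qed.

Variables (q muA pi1 tau : R) (bt : nat -> R) (M : R).
Hypotheses (q01 : 0 < q < 1) (muA0 : 0 < muA) (pi101 : 0 < pi1 < 1) (tau01 : 0 < tau < 1).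
Hypothesis tauE : tau / q =
  (1 - pi1) * tau + pi1 * Phibar (Phibar_inv tau - muA%:E)%E.
Hypothesis model : forall m, (0 < m)%N -> two_group_model pi1 (@H m) (@eps m) (Gamma m).
Hypotheses (bt0 : forall k, 0 <= bt k)
  (albt : forall k, alpha_mixing P H eps k.+1 <= bt k.+1 ^+ 2)
  (btM : forall N, \sum_(k < N) bt k.+1 <= M).

Local Notation event B i := (xi (@H _) (@eps _) i @^-1` B).

(** The p-value as a function of one [xi], so that rejection events are preimages under [xi] and lie
    in the past and future sigma-algebras. *)
Definition xi_pvalue (u : R * bool) : R := Phibar (muA * u.2%:R + u.1)%:E.

Definition rejected (t : R) : set (R * bool) := [set u | xi_pvalue u <= t].
Definition null_rejected (t : R) : set (R * bool) := [set u | xi_pvalue u <= t /\ u.2 = false].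

Lemma measurable_xi_pvalue : measurable_fun setT xi_pvalue.
Proof.
have mPhibar : measurable_fun setT (fun x : R => Phibar x%:E).
  by apply: continuous_measurable_fun; exact: continuous_Phibar.
apply: (measurableT_comp mPhibar); apply: measurable_funD; last exact: measurable_fst.
apply: measurable_funM => //.
have mb : measurable_fun setT (fun b : bool => b%:R : R) by move=> _ ? _; exact: I.
by apply: (measurableT_comp mb); exact: measurable_snd.
Qed.

Let msnd b : measurable [set u : R * bool | u.2 = b].
Proof.
rewrite -[X in measurable X]setTI.
exact: (@measurable_snd _ _ R bool measurableT [set b] I).
Qed.

Lemma measurable_rejected t : measurable (rejected t).
Proof. by apply: measurable_set_le => //; exact: measurable_xi_pvalue. Qed.

Lemma measurable_null_rejected t : measurable (null_rejected t).
Proof.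
rewrite (_ : null_rejected t = rejected t `&` [set u | u.2 = false]); last first.
  by apply/seteqP; split.
by apply: measurableI => //; exact: measurable_rejected.
Qed.

Section row.
Variable m : nat.
Hypothesis m0 : (0 < m)%N.
Let p w := pvalue muA (@H m) (@eps m) w.

Let past_event (B : set (R * bool)) n (i : 'I_m) : measurable B -> (i < n)%N ->
  <<s @past_generators m n>> (event B i).
Proof.
by move=> mB ni; apply: sub_gen_smallest; exists i => //; exists B => //; rewrite setTI.
Qed.

Let future_event (B : set (R * bool)) n (i : 'I_m) : measurable B -> (n <= i)%N ->
  <<s @future_generators m n>> (event B i).
Proof.
by move=> mB ni; apply: sub_gen_smallest; exists i => //; exists B => //; rewrite setTI.
Qed.

Lemma measurable_xi_event (B : set (R * bool)) (i : 'I_m) : measurable B -> measurable (event B i).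
Proof.
move=> mB; rewrite -[X in measurable X]setTI.
exact: (@measurable_xi m i measurableT B mB).
Qed.

Lemma variance_xi_events (B : set (R * bool)) s : measurable B ->
  (forall i : 'I_m, prob (P m) (event B i) = s) ->
  mean (P m) (fun w => ((Num.sqrt m%:R)^-1 * \sum_(i < m) (\1_(event B i) w - s)) ^+ 2) <=
  Num.sqrt s * (1 + (M + M)).
Proof.
move=> mB Bs; apply: (@mean_sqr_events_le _ _ _ (P m) m (fun i : 'I_m => event B i)
  (@past_generators m) (@future_generators m)
  (alpha_mixing P H eps) bt s M) => //.
- exact: measurable_past.
- by move=> n i ni; exact: past_event.
- by move=> n i ni; exact: future_event.
- by move=> n k A1 A2 n0; exact: alpha_mix.
Qed.

Lemma char_xi_events (B : set (R * bool)) s (l g : nat) (t th : R) : measurable B ->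
  (forall i : 'I_m, prob (P m) (event B i) = s) -> (0 < l)%N ->
  `|mean (P m) (fun w => cos (t * ((Num.sqrt m%:R)^-1 * \sum_(i < m) (\1_(event B i) w - s)) + th)) -
    expR (- (t ^+ 2 * mean (P m) (fun w =>
      ((Num.sqrt m%:R)^-1 * \sum_(i < m) (\1_(event B i) w - s)) ^+ 2) / 2)) * cos th| <=
  mixing_error m l g (alpha_mixing P H eps) (1 + (M + M)) t.
Proof.
move=> mB Bs l0; apply: (@char_events _ _ _ (P m) m (fun i : 'I_m => event B i)
  (@past_generators m) (@future_generators m)
  (alpha_mixing P H eps) bt s M) => //.
- exact: measurable_past.
- exact: measurable_future.
- by move=> n i ni; exact: past_event.
- by move=> n i ni; exact: future_event.
- by move=> n k A1 A2 n0; exact: alpha_mix.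
Qed.

Let pvalue_le i w t z : Phibar z%:E = t ->
  (xi_pvalue (xi (@H m) (@eps m) i w) <= t) = (z <= muA * (H i w)%:R + eps i w).
Proof. by move=> <-; rewrite /xi_pvalue Phibar_le. Qed.

Let null_eventE (i : 'I_m) t z : Phibar z%:E = t ->
  event (null_rejected t) i = [set w | H i w = false /\ z <= eps i w].
Proof.
move=> zt; apply/seteqP; split => w /=; rewrite /null_rejected/= (pvalue_le i w zt).
  by move=> [+ h]; rewrite h mulr0 add0r.
by move=> [h ze]; rewrite h mulr0 add0r.
Qed.

Lemma prob_null_rejected (i : 'I_m) t : 0 < t < 1 ->
  prob (P m) (event (null_rejected t) i) = (1 - pi1) * t.
Proof.
move=> t01; have [z _ zt] := Phibar_inv_fin t01.
by rewrite (null_eventE i zt) (prob_prior_tail pi101 (model m0)) zt.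
Qed.

Lemma prob_rejected (i : 'I_m) t : 0 < t < 1 -> prob (P m) (event (rejected t) i) =
  (1 - pi1) * t + pi1 * Phibar (Phibar_inv t - muA%:E)%E.
Proof.
move=> t01; have [z zE zt] := Phibar_inv_fin t01.
pose A : set (T m) := [set w | H i w = false /\ z <= eps i w].
pose B : set (T m) := [set w | H i w = true /\ z - muA <= eps i w].
have mA : measurable A.
  by rewrite /A -(null_eventE i zt); apply: measurable_xi_event; exact: measurable_null_rejected.
have ABE : event (rejected t) i = A `|` B.
  apply/seteqP; split => w; rewrite /rejected/= (pvalue_le i w zt) /A /B/=.
    case: (H i w) => /= h; [right|left]; split => //.
      by rewrite lerBlDl -[muA]mulr1.
    by rewrite mulr0 add0r in h.
  by case=> -[-> h]; rewrite ?mulr0 ?add0r// mulr1 -lerBlDl.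
have mB : measurable B.
  have -> : B = (event (rejected t) i) `\` A.
    rewrite ABE; apply/seteqP; split => w.
      by move=> [h1 h2]; split; [right|move=> [h3 _]; rewrite h1 in h3].
    by move=> [[]].
  by apply: measurableD => //; apply: measurable_xi_event; exact: measurable_rejected.
rewrite ABE /prob measureU//; last first.
  by apply/seteqP; split => // w [[h1 _] [h2 _]]; rewrite h1 in h2.
rewrite fineD ?fin_num_measure// -!/(prob _ _).
rewrite (prob_prior_tail pi101 (model m0) i false z) (prob_prior_tail pi101 (model m0) i true (z - muA)).
by rewrite zE zt.
Qed.

(** An increment of the null count is the count of this smaller event, so the variance bound with
    the square root of the probability yields the square root of [t - s]. *)
Lemma prob_null_increment (i : 'I_m) s t : 0 < s -> s <= t -> t < 1 ->
  prob (P m) (event (null_rejected t `\` null_rejected s) i) = (1 - pi1) * (t - s).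
Proof.
move=> s0 st t1; have t01 : 0 < t < 1 by rewrite t1 (lt_le_trans s0).
have s01 : 0 < s < 1 by rewrite s0 (le_lt_trans st).
have mt := measurable_xi_event i (measurable_null_rejected t).
have ms := measurable_xi_event i (measurable_null_rejected s).
rewrite mulrBr -(prob_null_rejected i t01) -(prob_null_rejected i s01) /prob -fineB ?fin_num_measure//.
congr fine.
transitivity (P m ((event (null_rejected t) i) `\` (event (null_rejected s) i))) => //.
rewrite measureD//; last by rewrite -ge0_fin_numE// fin_num_measure.
congr (_ - P m _)%E; apply/seteqP; split => w; first by case.
by move=> h; split => //; move: h => [h1 h2]; split => //; exact: le_trans st.
Qed.

Lemma sum_rejected t w : \sum_(i < m) \1_(event (rejected t) i) w = (count_le (p w) t)%:R :> R.
Proof.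
by apply: sum_indic_card.
Qed.

Lemma sum_null_rejected t w : \sum_(i < m) \1_(event (null_rejected t) i) w =
  #|[pred i | (p w i <= t) && ~~ H i w]|%:R :> R.
Proof.
apply: sum_indic_card => i; split; first by move=> [h1 /= h2]; rewrite /= h2 andbT.
by move=> /andP[h1 /negbTE h2]; split.
Qed.

End row.
Lemma variance_null_rejected m : (0 < m)%N ->
  mean (P m) (fun w => ((Num.sqrt m%:R)^-1 *
    \sum_(i < m) (\1_(event (null_rejected tau) i) w - (1 - pi1) * tau)) ^+ 2) =
  (1 - pi1) * tau - ((1 - pi1) * tau) ^+ 2 + (1 - pi1) ^+ 2 *
    (m%:R^-1 * \sum_(i < m) \sum_(j < m | j != i) rho_tilde tau tau (Gamma m i j)).
Proof.
move=> m0; have mR : 0 < m%:R :> R by rewrite ltr0n.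
set s := (1 - pi1) * tau.
pose A (i : 'I_m) := event (null_rejected tau) i.
have mA i : measurable (A i).
  by apply: measurable_xi_event; exact: measurable_null_rejected.
have As i : prob (P m) (A i) = s by exact: (prob_null_rejected m0).
pose X i w : R := \1_(A i) w - s.
have bX i : bounded_rv (X i) by apply: brvB; [exact: brv_indic|exact: brv_cst].
have XX i j : mean (P m) (fun w => X i w * X j w) = prob (P m) (A i `&` A j) - s ^+ 2.
  (* The covariance formula is relative to generators containing the events; the events themselves
     serve. *)
  pose GP (n : nat) := range A.
  apply: (@mean_centered_indic2 _ _ _ (P m) m A GP s) => //.
    by move=> n _ [k _ <-].
  by move=> n k _; apply: sub_gen_smallest; exists k.
rewrite (_ : (fun w => _) = (fun w => \sum_i \sum_j m%:R^-1 * (X i w * X j w))); last first.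
  apply/funext => w; rewrite exprMn exprVn sqr_sqrtr ?(ltW mR)//.
  rewrite expr2 mulr_suml mulr_sumr; apply: eq_bigr => i _.
  by rewrite mulr_sumr mulr_sumr.
have bXX i j : bounded_rv (fun w => m%:R^-1 * (X i w * X j w)).
  by bounded.
rewrite mean_sum => [|i _]; last by apply: brv_sum.
under eq_bigr do rewrite mean_sum//.
have E i j : mean (P m) (fun w => m%:R^-1 * (X i w * X j w)) =
    m%:R^-1 * (prob (P m) (A i `&` A j) - s ^+ 2).
  by rewrite meanZ ?XX//; exact: brvM.
have [z zE zt] := Phibar_inv_fin tau01.
have Eij i j : i != j -> prob (P m) (A i `&` A j) - s ^+ 2 =
    (1 - pi1) ^+ 2 * rho_tilde tau tau (Gamma m i j).
  move=> ij.
  have AE k : A k = [set w | H k w = false /\ z <= eps k w].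
    apply/seteqP; split => w; rewrite /A /null_rejected/= /xi_pvalue/= -zt Phibar_le.
      by move=> [+ h]; rewrite h mulr0 add0r.
    by move=> [h ze]; rewrite h mulr0 add0r.
  by rewrite !AE (prob_null_tail2 pi101 (model m0) z ij) zt /s; ring.
rewrite (eq_bigr (fun i => m%:R^-1 * (s - s ^+ 2) + m%:R^-1 * ((1 - pi1) ^+ 2 *
   \sum_(j < m | j != i) rho_tilde tau tau (Gamma m i j)))); last first.
  move=> i _; rewrite (bigD1 i)//= E setIid As; congr (_ + _).
  rewrite !mulr_sumr; apply: eq_bigr => j ji; rewrite E Eij// eq_sym//.
rewrite big_split/= sumr_const card_ord -[X in X + _ = _]mulr_natl mulrA divff ?gt_eqF// mul1r.
by congr (_ + _); rewrite -!mulr_sumr mulrCA.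
Qed.

Let pv m (w : T m) := pvalue muA (@H m) (@eps m) w.
Let K := 1 + (M + M).

(** Below, [null_process] is the [W(t)] and [rejection_point] the [t^] of the overview. *)
Definition null_count m (t : R) (w : T m) : R :=
  \sum_(i < m) \1_(event (null_rejected t) i) w.

Definition null_process m (t : R) (w : T m) : R :=
  (Num.sqrt m%:R)^-1 * (null_count t w - m%:R * ((1 - pi1) * t)).

Definition rejection_point m (w : T m) : R := (BH_rejections q (pv w))%:R * q / m%:R.

Let q0 : 0 < q. Proof. by have /andP[] := q01. Qed.

Let M0 : 0 <= M. Proof. by have := btM 0; rewrite big_ord0. Qed.

Let K0 : 0 <= K. Proof. by rewrite addr_ge0// addr_ge0. Qed.

Lemma brv_null_process m t : bounded_rv (@null_process m t).
Proof.
apply: brvM; first exact: brv_cst.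
apply: brvB; last exact: brv_cst.
apply: brv_sum => i _; apply: brv_indic; apply: measurable_xi_event.
exact: measurable_null_rejected.
Qed.

Section row.
Variable m : nat.
Hypothesis m0 : (0 < m)%N.
Let mR : 0 < m%:R :> R. Proof. by rewrite ltr0n. Qed.

Lemma variance_null_process t : 0 < t < 1 ->
  mean (P m) (fun w => null_process t w ^+ 2) <= K.
Proof.
move=> t01; have /andP[t0 t1] := t01; have /andP[p0 p1] := pi101.
rewrite /null_process /null_count; under eq_fun do rewrite -sum_centered.
apply: (le_trans (variance_xi_events m0 (measurable_null_rejected t)
  (fun i => prob_null_rejected m0 i t01))).
apply: ler_piMl => //; rewrite -[leRHS]sqrtr1 ler_wsqrtr//; apply: mulr_ile1; lra.
Qed.

Lemma variance_null_process_increment s t : 0 < s -> s <= t -> t < 1 ->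
  mean (P m) (fun w => (null_process t w - null_process s w) ^+ 2) <= Num.sqrt (t - s) * K.
Proof.
move=> s0 st t1; have /andP[p0 p1] := pi101.
rewrite (_ : (fun w => _) = (fun w => ((Num.sqrt m%:R)^-1 * \sum_i
    (\1_(event (null_rejected t `\` null_rejected s) i) w -
     (1 - pi1) * (t - s))) ^+ 2)).
  apply: (le_trans (variance_xi_events m0
    (measurableD (measurable_null_rejected t) (measurable_null_rejected s))
    (fun i => prob_null_increment m0 i s0 st t1))).
  rewrite ler_wpM2r// ler_wsqrtr// ler_piMl ?subr_ge0//; lra.
apply/funext => w; rewrite /null_process -mulrBr sum_centered; congr ((_ * _) ^+ 2).
rewrite (eq_bigr (fun i : 'I_m => \1_(event (null_rejected t) i) w -
    \1_(event (null_rejected s) i) w)).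
  by rewrite sumrB /null_count; ring.
move=> i _; rewrite !indicE.
have sub : null_rejected s `<=` null_rejected t.
  by move=> u [h1 h2]; split => //; exact: le_trans st.
set x := xi _ _ i.
have [xs|xs] := pselect (null_rejected s (x w)).
  rewrite (memNset (A := x @^-1` (_ `\` _))); last by case.
  by rewrite !mem_set ?subrr//; exact: sub.
rewrite (memNset (A := x @^-1` null_rejected s))// subr0.
have [xt|xt] := pselect (null_rejected t (x w)); first by rewrite !mem_set.
by rewrite !memNset// => -[].
Qed.

Lemma rejection_point_localised c s0 (J : nat) : 0 < c -> 0 < s0 ->
  (forall t, tau <= t < 1 ->
    (1 - pi1) * t + pi1 * Phibar (Phibar_inv t - muA%:E)%E - t / q <= - c * (t - tau)) ->
  (forall t, s0 <= t <= tau ->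
    c * (tau - t) <= (1 - pi1) * t + pi1 * Phibar (Phibar_inv t - muA%:E)%E - t / q) ->
  (0 < J)%N -> s0 <= tau - J%:R / Num.sqrt m%:R -> q + (Num.sqrt m%:R)^-1 < 1 ->
  q^-1 <= c * J%:R / 2 ->
  exists2 D : set (T m), measurable D /\ prob (P m) D <= K * 5 / (c ^+ 2 * J%:R) &
    forall w, ~ D w -> `|rejection_point w - tau| <= J%:R / Num.sqrt m%:R.
Proof.
move=> c0 s00 sr sl J0 sJ qm qJ.
pose N (t : R) (w : T m) : R := (count_le (pv w) t)%:R.
have NE t w : N t w = \sum_(i < m) \1_(event (rejected t) i) w.
  by rewrite sum_rejected.
apply: (@threshold_localisation _ _ _ (P m) m N
  (fun t => (1 - pi1) * t + pi1 * Phibar (Phibar_inv t - muA%:E)%E) (@rejection_point m)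
  q tau s0 c K) => //.
- by move=> s t w st; rewrite ler_nat leq_count_le.
- move=> t t01; apply: brvM; first exact: brv_cst.
  apply: brvB; last exact: brv_cst.
  rewrite (_ : N t = fun w => \sum_(i < m) \1_(event (rejected t) i) w); last first.
    by apply/funext => w; exact: NE.
  apply: brv_sum => i _; apply: brv_indic; apply: measurable_xi_event.
  exact: measurable_rejected.
- move=> t t01; under eq_fun do rewrite NE -sum_centered.
  apply: (le_trans (variance_xi_events m0 (measurable_rejected t)
    (fun i => prob_rejected m0 i t01))).
  apply: ler_piMl => //; rewrite -[leRHS]sqrtr1 ler_wsqrtr// -(prob_rejected m0 (Ordinal m0) t01).
  by apply: prob_le1; apply: measurable_xi_event; exact: measurable_rejected.
- move=> w; rewrite /rejection_point ler_pdivrMr// mulrC ler_pM2l// ler_nat.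
  by rewrite -(BH_rejections_fix (pv w) (ltW q0)) count_le_max.
- move=> w; rewrite /N /rejection_point BH_rejections_fix ?(ltW q0)//.
  by field; rewrite !gt_eqF.
- by move=> t w; exact: BH_rejections_ge_count.
Qed.

Lemma null_process_oscillation (L : nat) (dl eta : R) : 0 < dl -> dl <= eta ->
  0 < tau - L%:R * dl / Num.sqrt m%:R -> tau + L%:R * dl / Num.sqrt m%:R < 1 ->
  exists2 D : set (T m), measurable D /\
    prob (P m) D <= (L + L).+1%:R * (Num.sqrt (L%:R * dl / Num.sqrt m%:R) * K / eta ^+ 2) &
    forall w, ~ D w -> forall t, `|t - tau| <= L%:R * dl / Num.sqrt m%:R ->
      `|null_process t w - null_process tau w| <= 2 * eta.
Proof.
have /andP[p0 p1] := pi101.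
apply: (@oscillation_bound _ _ _ (P m) m (@null_count m) (1 - pi1) tau K) => //.
- by lra.
- move=> s t w st; apply: ler_sum => i _; rewrite !indicE ler_nat.
  have [h|h] := pselect (null_rejected s (xi (@H m) (@eps m) i w)).
    rewrite mem_set// mem_set//; case: h => h1 h2; split => //; exact: le_trans st.
  by rewrite memNset.
- by move=> t _; exact: brv_null_process.
- exact: variance_null_process_increment.
Qed.

End row.

Let X m (w : T m) := Num.sqrt m%:R * (FDP q (pv w) ((@H m)^~ w) - (1 - pi1) * q).
Let Y m (w : T m) := q / tau * null_process tau w.

Lemma measurable_FDP_centered m : measurable_fun setT (@X m).
Proof.
apply: measurable_funM => //; apply: measurable_funB; last exact: measurable_cst.
apply: measurable_FDP => // [i c|i].
  exact: (measurable_xi_event i (measurable_rejected c)).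
exact: (@measurable_funPTI _ _ _ _ (H i) [set true] I).
Qed.

(** Three exceptional events have probability at most [eta / 3] each: [t^] far from [tau], large
    oscillation of [W] around [tau], and [|W(tau)| >= Lw]. Off them the oscillation and the
    replacement of [q / t^] by [q / tau] each cost at most [e / 3]. All constants are fixed before
    [m]. *)
Lemma FDP_centered_close (e eta : R) : 0 < e -> 0 < eta ->
  \forall m \near \oo, prob (P m) [set w | e <= `|X w - Y w|] <= eta.
Proof.
move=> e0 eta0; have /andP[t0 t1] := tau01; have /andP[p0 p1] := pi101.
have q1 : q < 1 by have /andP[] := q01.
have [c [s0 [c0 /andP[s00 s0t] sr sl]]] := rejection_curve_slopes muA0 p0 tau01 tauE.
(* The first summand ensures [1 / q <= c J / 2], the second a localisation failure of at most
   [eta / 3]. *)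
pose J := (Num.truncn (2 / (q * c) + 15 * K / (eta * c ^+ 2))).+1.
have Jgt : 2 / (q * c) + 15 * K / (eta * c ^+ 2) < J%:R by exact: truncnS_gt.
have a1 : 0 <= 2 / (q * c) by nonneg.
have a2 : 0 <= 15 * K / (eta * c ^+ 2) by nonneg.
have J1 : q^-1 <= c * J%:R / 2.
  have : 2 / (q * c) <= J%:R by lra.
  rewrite ler_pdivrMr ?mulr_gt0// => h.
  rewrite -div1r ler_pdivrMr//; lra.
have J0 : (0 < J)%N by [].
have JR : 0 < J%:R :> R by [].
have J2 : K * 5 / (c ^+ 2 * J%:R) <= eta / 3.
  have : 15 * K / (eta * c ^+ 2) <= J%:R by lra.
  rewrite ler_pdivrMr ?mulr_gt0 ?exprn_gt0// => h.
  rewrite ler_pdivrMr ?mulr_gt0 ?exprn_gt0//; lra.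
pose Lw := Num.sqrt (3 * (K + 1) / eta).
have Lw2 : Lw ^+ 2 = 3 * (K + 1) / eta by rewrite sqr_sqrtr//; nonneg; lra.
have K1 : 0 < K + 1 by rewrite ltr_wpDl.
have Lw0 : 0 < Lw by rewrite sqrtr_gt0 divr_gt0// mulr_gt0.
have LwK : K / Lw ^+ 2 <= eta / 3.
  rewrite Lw2 invf_div mulrA ler_pdivrMr ?mulr_gt0// [leRHS](_ : _ = eta * (K + 1)); last by field.
  by rewrite mulrC ler_pM2l// lerDl.
(* Both mesh and tolerance of the oscillation bound; [2 h] multiplied by [2 q / tau] is [e / 3]. *)
pose h := e * tau / (12 * q).
have h0 : 0 < h by rewrite /h divr_gt0// mulr_gt0.
have hE : 2 * q / tau * (2 * h) = e / 3 by rewrite /h; field; rewrite !gt_eqF.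
pose L := (Num.truncn (J%:R / h)).+1.
have LJ : J%:R <= L%:R * h by rewrite -ler_pdivrMr// ltW// truncnS_gt.
have LR : 0 < L%:R :> R by [].
have Lh : 0 < L%:R * h by exact: mulr_gt0.
(* Once the half-width of the window is below [b^2], the union bound over its grid is at most
   [eta / 3]. *)
pose b := eta * h ^+ 2 / (3 * (K + 1) * (L + L).+1%:R).
have b0 : 0 < b by apply: divr_gt0; [exact: mulr_gt0 (exprn_gt0 2 h0)|rewrite !mulr_gt0].
have mn : 0 < Num.min (tau / 2) (1 - tau) by rewrite lt_min divr_gt0// subr_gt0.
have u0 : 0 < 2 * q / tau ^+ 2 * J%:R * Lw.
  by do 2 apply: mulr_gt0 => //; apply: divr_gt0; [exact: mulr_gt0|exact: exprn_gt0].
near=> m.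
have m0 : (0 < m)%N by near: m; exact: nbhs_infty_gt.
set r := (Num.sqrt m%:R)^-1 : R.
have r0 : 0 < r by rewrite invr_gt0 sqrtr_gt0 ltr0n.
have r1 : J%:R * r < tau - s0.
  by rewrite /r; near: m; apply: near_mul_invr_sqrt; rewrite ?subr_gt0.
have r2 : 1 * r < 1 - q by rewrite /r; near: m; apply: near_mul_invr_sqrt; rewrite ?subr_gt0.
have r3 : L%:R * h * r < Num.min (tau / 2) (1 - tau).
  by rewrite /r; near: m; exact: near_mul_invr_sqrt.
have r4 : L%:R * h * r < b ^+ 2.
  by rewrite /r; near: m; apply: near_mul_invr_sqrt => //; exact: exprn_gt0.
have r5 : 2 * q / tau ^+ 2 * J%:R * Lw * r < e / 3.
  by rewrite /r; near: m; apply: near_mul_invr_sqrt => //; exact: divr_gt0.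
have [r3a r3b] : L%:R * h * r < tau / 2 /\ L%:R * h * r < 1 - tau.
  by move: r3; rewrite lt_min => /andP[].
have tau2 : tau / 2 < tau by rewrite ltr_pdivrMr// ltr_pMr// ltr1n.
have r1' : s0 <= tau - J%:R * r by rewrite lerBrDl -lerBrDr ltW.
have r2' : q + r < 1 by move: r2; rewrite mul1r ltrBrDl.
have r3l : 0 < tau - L%:R * h * r by rewrite subr_gt0 (lt_trans r3a).
have r3r : tau + L%:R * h * r < 1 by rewrite -ltrBrDl.
have [D1 [mD1 pD1] nD1] := rejection_point_localised m0 c0 s00 sr sl J0 r1' r2' J1.
have [D2 [mD2 pD2] nD2] := null_process_oscillation m0 h0 (lexx h) r3l r3r.
pose D3 := [set w : T m | Lw <= `|null_process tau w|].
have mD3 : measurable D3.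
  apply: measurable_set_le => //.
  by have [] := brv_norm (brv_null_process m tau).
have pD3 : prob (P m) D3 <= eta / 3.
  apply: (le_trans (chebyshev_sqr (P m) Lw0 (brv_null_process m tau))).
  apply: le_trans LwK; rewrite ler_wpM2r ?invr_ge0 ?sqr_ge0//.
  exact: variance_null_process.
have pD2' : prob (P m) D2 <= eta / 3.
  apply: (le_trans pD2); rewrite -/r.
  have sb : Num.sqrt (L%:R * h * r) <= b.
    by rewrite -[leRHS]gtr0_norm// -sqrtr_sqr ler_wsqrtr// ltW.
  have cf : 0 <= (L + L).+1%:R * (K / h ^+ 2) by nonneg.
  rewrite [leLHS](_ : _ = (L + L).+1%:R * (K / h ^+ 2) * Num.sqrt (L%:R * h * r)); last by ring.
  apply: (le_trans (ler_wpM2l cf sb)).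
  have -> : (L + L).+1%:R * (K / h ^+ 2) * b = eta / 3 * (K / (K + 1)).
    by rewrite /b; field; rewrite !gt_eqF.
  by rewrite ler_piMr ?divr_ge0 ?(ltW eta0)// ler_pdivrMr// mul1r lerDl.
have mX : measurable [set w : T m | e <= `|X w - Y w|].
  apply: measurable_set_le => //.
  apply: measurableT_comp => //; apply: measurable_funB; first exact: measurable_FDP_centered.
  by apply: measurable_funM => //; exact: (brv_null_process m tau).1.
have mD12 := measurableU _ _ mD1 mD2.
apply: (@le_trans _ _ (prob (P m) ((D1 `|` D2) `|` D3))).
  apply: le_prob => //; first exact: measurableU.
  move=> w /= ew; apply: contrapT => nD; move: ew; apply/negP; rewrite -ltNge.
  have n1 : ~ D1 w by move=> hD; apply: nD; left; left.
  have n2 : ~ D2 w by move=> hD; apply: nD; left; right.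
  have n3 : `|null_process tau w| <= Lw.
    by rewrite leNgt; apply/negP => hD; apply: nD; right; exact: ltW.
  have loc := nD1 w n1; rewrite -/r in loc.
  have Jh : J%:R * r <= L%:R * h * r by rewrite ler_wpM2r// ltW.
  have osc := nD2 w n2 (rejection_point w); rewrite -/r in osc.
  have {}osc := osc (le_trans loc Jh).
  (* With no rejection [t^] would be 0, at distance [tau] from [tau], against the localisation. *)
  have R0 : (0 < BH_rejections q (pv w))%N.
    rewrite lt0n; apply: contraTneq loc => R0.
    have -> : rejection_point w = 0 by rewrite /rejection_point R0 !mul0r.
    by rewrite sub0r normrN (gtr0_norm t0) -ltNge (le_lt_trans Jh)// (lt_trans r3a).
  rewrite /X (FDP_centered (1 - pi1) _ m0 q0 R0) /Y.
  have := ratio_perturbation q0 t0 loc (ltW (le_lt_trans Jh r3a)) osc n3.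
  rewrite {1}/null_process /null_count sum_null_rejected -/(rejection_point w).
  move=> /le_lt_trans; apply; rewrite hE.
  have -> : 2 * q / tau ^+ 2 * (J%:R * r) * Lw = 2 * q / tau ^+ 2 * J%:R * Lw * r by ring.
  have eE : e = e / 3 + (e / 3 + e / 3) by field.
  by rewrite [ltRHS]eE ltrD2l (lt_trans r5)// ltrDl divr_gt0.
apply: (le_trans (prob_setU (P m) mD12 mD3)).
have -> : eta = eta / 3 + eta / 3 + eta / 3 by field.
apply: lerD => //; apply: (le_trans (prob_setU (P m) mD1 mD2)); apply: lerD => //.
exact: le_trans pD1 J2.
Unshelve. all: by end_near.
Qed.

End triangular_array.

(** * Assembly of the limit theorem *)

Theorem corollary4p1 (R : realType) (q muA pi1 tau a b : R)
  (d : nat -> measure_display) (T : forall m, measurableType (d m))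
  (P : forall m, probability (T m) R)
  (H : forall m, 'I_m -> {RV (P m) >-> bool})
  (eps : forall m, 'I_m -> {RV (P m) >-> R})
  (Gamma : forall m, 'M[R]_m)
  (varrho : R -> R -> R) :
  let pi0 := 1 - pi1 in
  let alpha := alpha_mixing P H eps in
  0 < q < 1 -> 0 < muA -> 0 < pi1 < 1 ->
  (forall m, (0 < m)%N -> two_group_model pi1 (@H m) (@eps m) (Gamma m)) ->
  0 < tau < 1 ->
  tau / q = pi0 * tau + pi1 * Phibar (Phibar_inv tau - muA%:E)%E ->
  0 <= a -> b <= 1 -> a < tau < b -> a < q < b ->
  (exists (Q : nat) (gamma : R),
    [/\ ~~ odd Q, (2 < Q)%N, 0 < gamma,
        gamma / (2 + gamma) + 2 / Q%:R < 1 &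
        (\sum_(1 <= k <oo)
          (k%:R ^+ (Q - 2) * alpha k `^ (gamma / (Q%:R + gamma)))%:E < +oo)%E]) ->
  (forall t s, t \in `[a, Phibar (Phibar_inv b - muA%:E)%E] ->
    s \in `[a, Phibar (Phibar_inv b - muA%:E)%E] ->
    (m%:R^-1 * \sum_(i < m) \sum_(j < m | j != i) rho_tilde t s (Gamma m i j))
      @[m --> \oo] --> varrho t s) ->
  cvg_in_distribution P
    (fun m w => Num.sqrt m%:R *
      (FDP q (pvalue muA (@H m) (@eps m) w) ((@H m)^~ w) - pi0 * q))
    (normal_law 0 (pi0 ^+ 2 * q ^+ 2 / tau ^+ 2 *
      (tau / pi0 - tau ^+ 2 + varrho tau tau))).
Proof.
move=> pi0 alpha q01 muA0 pi101 model tau01 tauE a0 b1 /andP[atau taub] _.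
move=> [Q [gamma [oQ Q2 gam0 gamQ sfin]]] cvgrho.
have /andP[t0 t1] := tau01; have /andP[p0 p1] := pi101; have /andP[q0 q1] := q01.
have pi00 : 0 < pi0 by rewrite subr_gt0.
have [bt [M [M0 bt0 albt btM alM]]] :=
  mixing_rates (alpha01 H eps) oQ Q2 gam0 gamQ sfin.
(* Shifting by [muA > 0] raises the tail probability, so the right end is at least [b]; for [b = 1]
   the inverse is [-oo] and the right end is 1. *)
have tauI : tau \in `[a, Phibar (Phibar_inv b - muA%:E)%E].
  rewrite in_itv/= (ltW atau)/=; have [bE|bn] := eqVneq b 1.
    by rewrite bE -(Phibar_ninfty R) Phibar_inv_eq/= Phibar_ninfty ltW.
  have [|z zE zb] := @Phibar_inv_fin R b; first by rewrite (lt_trans t0)//= lt_neqAle bn.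
  rewrite zE; apply: (le_trans (ltW taub)); rewrite -{1}zb -EFinB Phibar_le.
  by rewrite lerBlDr lerDl ltW.
pose K := 1 + (M + M).
have K0 : 0 <= K by rewrite addr_ge0// addr_ge0.
pose W m (w : T m) := @null_process R d T P H eps muA pi1 m tau w.
pose vm m := mean (P m) (fun w => W m w ^+ 2).
pose s2 := pi0 * tau - (pi0 * tau) ^+ 2 + pi0 ^+ 2 * varrho tau tau.
have vs : vm m @[m --> \oo] --> s2.
  apply: (@cvg_trans _ ((pi0 * tau - (pi0 * tau) ^+ 2 + pi0 ^+ 2 *
    (m%:R^-1 * \sum_(i < m) \sum_(j < m | j != i) rho_tilde tau tau (Gamma m i j)))
    @[m --> \oo])).
    apply: near_eq_cvg; exists 1%N => // m m0 /=.
    rewrite -(variance_null_rejected muA pi101 tau01 model m0) /vm /W.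
    by congr mean; apply/funext => w; rewrite /null_process /null_count -sum_centered.
  by apply: cvgD; [exact: cvg_cst|apply: cvgMr; exact: cvgrho].
(* A limit of second moments. It may be 0, in which case the limit law is a point mass. *)
have s20 : 0 <= s2.
  rewrite -(cvg_lim _ vs)//; apply: limr_ge; first exact: (cvgP _ vs).
  by apply: nearW => m; apply: mean_ge0 => w; exact: sqr_ge0.
set v := pi0 ^+ 2 * q ^+ 2 / tau ^+ 2 * _.
have vE : v = (q / tau) ^+ 2 * s2 by rewrite /v /s2; field; rewrite !gt_eqF.
have v0 : 0 <= v by rewrite vE mulr_ge0// sqr_ge0.
have [mu muE muc] := mean_normal_law_cos v0.
move=> x; rewrite -!muE.
apply: (@levy_slutsky R d T P _ (fun m w => q / tau * W m w) mu).
- by move=> m; exact: (@measurable_FDP_centered R d T P H eps q muA pi1 q01 m).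
- by move=> m; apply: measurable_funM => //; exact: (brv_null_process H eps muA pi1 m tau).1.
- move=> e e0.
  (* Tightness by Chebyshev: [c] bounds the second moment, and the added 1 in the radius keeps it
     positive. *)
  pose c := (q / tau) ^+ 2 * K; have c0 : 0 <= c by rewrite mulr_ge0// sqr_ge0.
  have c1 : 0 < (c + 1) / e by rewrite divr_gt0// ltr_wpDl.
  exists (Num.sqrt ((c + 1) / e)); first by rewrite sqrtr_gt0.
  exists 1%N => // m m0 /=.
  have bY : bounded_rv (fun w : T m => q / tau * W m w).
    by apply: brvM; [exact: brv_cst|exact: brv_null_process].
  have s0 : 0 < Num.sqrt ((c + 1) / e) by rewrite sqrtr_gt0.
  apply: (le_trans (chebyshev_sqr (P m) s0 bY)); rewrite (sqr_sqrtr (ltW c1)) invf_div mulrA.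
  rewrite ler_pdivrMr ?ltr_wpDl// mulrC ler_pM2l//; apply: (@le_trans _ _ c); last by rewrite lerDl.
  under eq_fun do rewrite exprMn.
  rewrite meanZ; last by apply: brvX; exact: brv_null_process.
  rewrite ler_wpM2l ?sqr_ge0//.
  exact: (variance_null_process muA pi101 model bt0 albt btM m0 tau01).
(* The factor [q / tau] passes into the frequency. The mean [f] is compared with the Gaussian value
   [g] at the actual variance of row [m], and only [g] needs the convergence of variances. *)
- move=> t th; rewrite muc; pose t' := t * (q / tau).
  pose f m := mean (P m) (fun w => cos (t * (q / tau * W m w) + th)).
  pose g m := expR (- (t' ^+ 2 * vm m / 2)) * cos th.
  have gl : g m @[m --> \oo] --> expR (- (t ^+ 2 * v / 2)) * cos th.
    have -> : t ^+ 2 * v / 2 = t' ^+ 2 * s2 / 2 by rewrite vE /t'; ring.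
    have h : (- (t' ^+ 2 * vm m / 2)) @[m --> \oo] --> - (t' ^+ 2 * s2 / 2).
      by apply: cvgN; apply: cvgMl; apply: cvgMr.
    apply: cvgMl.
    exact: (cvg_comp (fun m => - (t' ^+ 2 * vm m / 2)) (@expR R) h (@continuous_expR R _)).
  have fg : f m - g m @[m --> \oo] --> (0 : R).
    apply/cvgrPdist_le => e e0.
    have [m1 m1P] := mixing_error_cvg0 t' (addr_ge0 ler01 (addr_ge0 M0 M0)) (sqr_ge0 M) alM e0.
    exists (maxn m1 1) => // m /=; rewrite geq_max => /andP[/m1P [l [gap [l0 le]]] m0].
    rewrite sub0r normrN; apply: le_trans le; rewrite /f /g.
    have WE w : W m w = (Num.sqrt m%:R)^-1 *
        \sum_i (\1_(xi (@H m) (@eps m) i @^-1` null_rejected muA tau) w - pi0 * tau).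
      by rewrite sum_centered.
    rewrite /vm; under eq_fun do rewrite mulrA -/t' WE.
    under [in X in _ - X]eq_fun do rewrite WE.
    exact: (char_xi_events bt0 albt btM m0 gap t' th (measurable_null_rejected muA tau)
      (fun i => prob_null_rejected muA pi101 model m0 i tau01) l0).
  have -> : (fun m => mean (P m) (fun w => cos (t * (q / tau * W m w) + th))) =
      (fun m => f m - g m + g m) by apply/funext => m; rewrite subrK.
  by rewrite -[X in _ --> X]add0r; exact: cvgD.
- move=> e e0; apply/cvgrPdist_le => eta eta0.
  have := FDP_centered_close q01 muA0 pi101 tau01 tauE model bt0 albt btM e0 eta0.
  apply: filterS => m; rewrite sub0r normrN ger0_norm//; exact: prob_ge0.
Qed.
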